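(* Let $\{X_n\}_{n>0}$ be a sequence of random variables whose distributions $\mu_{X_n}$ are infinitely divisible with respect to free additive convolution $\boxplus$. Let $\lambda>0$, let $\nu=\sum_{i=1}^k a_i\delta_{b_i}$ be a probability measure on $\mathbb{R}$ (with $k\ge 1$, $a_i\ge 0$, $b_i\in\mathbb{R}$), and let $\pi_\boxplus(\lambda,\nu)$ be the free compound Poisson measure with rate $\lambda$ and jump distribution $\nu$. If $E[X_n^i]\to m_i(\pi_\boxplus(\lambda,\nu))$ as $n\to\infty$ for every $i=1,\dots,2k+2$, then $\mu_{X_n}$ converges weakly to $\pi_\boxplus(\lambda,\nu)$.
   Context: For a probability measure $\mu$ on $\mathbb{R}$, $m_i(\mu)=\int_{\mathbb{R}} x^i\,\mu(dx)$ denotes its $i$-th moment; the convergence of moments presupposes that the moments in question are finite. Let $G_\mu(z)=\int_{\mathbb{R}}\frac{\mu(dx)}{z-x}$ ($z\in\mathbb{C}^+$, the open upper half-plane) and $F_\mu=1/G_\mu$. There are $\eta,M>0$ such that $F_\mu$ has a right inverse $F_\mu^{-1}$ (with $F_\mu^{-1}(z)/z\to1$ as $|z|\to\infty$) defined on $\Gamma_{\eta,M}=\{z\in\mathbb{C}^+: |\mathrm{Re}\,z|<\eta\,\mathrm{Im}\,z,\ |z|>M\}$; the Voiculescu transform is $\phi_\mu(z)=F_\mu^{-1}(z)-z$ there. The free additive convolution $\mu_1\boxplus\mu_2$ is the unique probability measure with $\phi_{\mu_1\boxplus\mu_2}=\phi_{\mu_1}+\phi_{\mu_2}$ on a common domain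 of the form $\Gamma_{\eta,M}$. A probability measure $\mu$ is $\boxplus$-infinitely divisible, written $\mu\in ID(\boxplus)$, if for every $N\in\mathbb{N}$ there is a probability measure $\nu_N$ on $\mathbb{R}$ with $\mu=\nu_N^{\boxplus N}$. The free cumulants $(\kappa_n(\mu))_{n\ge1}$ are determined by $m_n(\mu)=\sum_{\pi\in NC(n)}\prod_{V\in\pi}\kappa_{|V|}(\mu)$, where $NC(n)$ is the set of non-crossing partitions of $\{1,\dots,n\}$ and the product runs over the blocks $V$ of $\pi$. The free compound Poisson measure $\pi_\boxplus(\lambda,\nu)$ is the probability measure with free cumulants $\kappa_n=\lambda\, m_n(\nu)$ for all $n\ge1$ (for finitely supported $\nu$ it exists, is compactly supported, and is hence uniquely determined). *)

(* Defs.v *)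
From HB Require Import structures.
From mathcomp Require Import all_boot all_order all_algebra.
From mathcomp Require Import all_classical all_reals all_analysis.
From mathcomp Require Import complex.

Set Implicit Arguments.
Unset Strict Implicit.
Unset Printing Implicit Defensive.
Import Order.TTheory GRing.Theory Num.Theory.
Import numFieldNormedType.Exports.

Local Open Scope classical_set_scope.
Local Open Scope ring_scope.
Local Open Scope complex_scope.

Section measures_on_R.
Context {R : realType}.

Implicit Types (mu nu rho : probability R R).

Definition moment mu (i : nat) : R := \int[mu]_x (x ^+ i).

Definition has_moment mu (i : nat) : Prop :=
  mu.-integrable setT (fun x : R => (x ^+ i)%:E).

Definition weak_cvg (mu_ : nat -> probability R R) mu : Prop :=
  forall f : R -> R, continuous f -> [bounded f x | x in setT] ->
    \int[mu_ n]_x f x @[n --> \oo] --> \int[mu]_x f x.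

(* The integral of a complex-valued function is taken componentwise. *)
Definition cauchy_transform mu (z : R[i]) : R[i] :=
  (\int[mu]_x complex.Re ((z - x%:C)^-1)) +i*
  (\int[mu]_x complex.Im ((z - x%:C)^-1)).

Definition F_transform mu (z : R[i]) : R[i] := (cauchy_transform mu z)^-1.

Definition upper_half_plane : set R[i] := [set z | 0 < complex.Im z].

Definition Gamma (eta M : R) : set R[i] :=
  [set z | [/\ upper_half_plane z,
               `|complex.Re z| < eta * complex.Im z & M%:C < `|z|]].

(* [H] is a right inverse of [F_transform mu] on [Gamma eta M] such that
   [H z / z] tends to 1 as [|z|] tends to infinity in [Gamma eta M].  The germ
   at infinity of such an [H] is unique. *)
Definition is_F_right_inverse mu (eta M : R) (H : R[i] -> R[i]) : Prop :=
  (forall z, Gamma eta M z ->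
     upper_half_plane (H z) /\ F_transform mu (H z) = z) /\
  (forall e : R, 0 < e -> exists K : R,
     forall z, Gamma eta M z -> K%:C < `|z| -> `|H z / z - 1| < e%:C).

Definition is_voiculescu_transform mu (eta M : R) (phi : R[i] -> R[i]) : Prop :=
  exists2 H, is_F_right_inverse mu eta M H &
    forall z, Gamma eta M z -> phi z = H z - z.

Definition is_free_convolution (mu1 mu2 mu : probability R R) : Prop :=
  exists eta M phi1 phi2 phi, [/\ 0 < eta, 0 < M,
    is_voiculescu_transform mu1 eta M phi1, is_voiculescu_transform mu2 eta M phi2 &
    is_voiculescu_transform mu eta M phi /\
    forall z, Gamma eta M z -> phi z = phi1 z + phi2 z].

(* [is_free_power nu N mu] states that [mu] is the [N]-fold free convolution power of [nu].
   Measures are compared on measurable sets only, since they are represented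
   by functions on arbitrary sets. *)
Inductive is_free_power nu : nat -> probability R R -> Prop :=
| is_free_power1 mu :
    (forall A, measurable A -> mu A = nu A) -> is_free_power nu 1 mu
| is_free_powerS N rho mu :
    is_free_power nu N rho -> is_free_convolution rho nu mu -> is_free_power nu N.+1 mu.

Definition freely_infinitely_divisible mu : Prop :=
  forall N : nat, (0 < N)%N -> exists nu, is_free_power nu N mu.

End measures_on_R.

Definition crossing n (V W : {set 'I_n}) : bool :=
  [exists a in V, exists b in W, exists c in V, exists d in W,
    [&& (a < b)%N, (b < c)%N & (c < d)%N]].

Definition NC n : {set {set {set 'I_n}}} :=
  [set p | finset.partition p [set: 'I_n]%SET &&
    [forall V in p, forall W in p, (V != W) ==> ~~ crossing V W]]%SET.

(* [kappa n] is the [n]-th free cumulant for [n >= 1]; [kappa 0] is irrelevant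
   because blocks are non-empty. *)
Definition are_free_cumulants {R : realType} (mu : probability R R) (kappa : nat -> R) :
    Prop :=
  forall n : nat, (0 < n)%N -> has_moment mu n /\
    moment mu n = \sum_(p in NC n) \prod_(V in p) kappa #|V|.

Definition is_free_compound_poisson {R : realType} (lambda : R) (nu mu : probability R R) :
    Prop :=
  are_free_cumulants mu (fun n => lambda * moment nu n).

(* Main.v *)
Require Import Defs.
From HB Require Import structures.
From mathcomp Require Import all_boot all_order all_algebra.
From mathcomp Require Import all_classical all_reals all_analysis.
From mathcomp Require Import measurable_realfun complex.
From mathcomp Require Import cyclic separable cyclotomic ring lra.

(** Write [mu_n] for the laws of the random variables and [kap_j = lambda * \sum a_i b_i^j]
    for the free cumulants of the compound Poisson law [mu].

    Let [nu_n] be a law whose free convolution power with [N = n + 2] factors is [mu_n].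
    When [N] grows, the moments [N m_j(nu_n)] approach the free cumulants of [mu_n], so
    that the hypothesis on moments gives [N m_j(nu_n) -> kap_j] for [1 <= j <= 2k + 2]
    ([free_root_cumulants]). In other words, the measures [N x^2 nu_n] have moments of order
    at most [2k] which converge to those of [\sum lambda a_i b_i^2 delta_(b_i)]. The limit
    has at most [k] atoms, and such a measure is determined by these moments: the integral
    of the square of [\prod (X - b_i)] tends to 0, which forces the mass to concentrate at
    the [b_i]. Hence [N \int x^2 / (f - x) dnu_n] tends to [\sum lambda a_i b_i^2 / (f - b_i)]
    for every fixed [f] in the upper half-plane ([resolvent_limit]).

    This goes back to [mu_n] through subordination. With [f_n = F_(mu_n) w] and
    [om_n = f_n + (w - f_n) / N], the definition of free convolution says that
    [G_(nu_n) om_n = G_(mu_n) w], which can be rewritten as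
    [w - f_n = N m_1(nu_n) + N \int x^2 / (om_n - x) dnu_n + O(1 / N)] ([subord_equation]).
    The compound Poisson law satisfies the limit equation
    [w - f = kap_1 + \sum lambda a_i b_i^2 / (f - b_i)] ([compound_poisson_equation]), whose
    right-hand side is a contraction in [f] when [Im w] is large. So [f_n -> f], that is,
    the Cauchy transforms converge on a half-line of the imaginary axis
    ([cauchy_cvg_axis]); by Vitali's theorem they converge on the upper half-plane
    ([cauchy_cvg]). As the second moments are bounded, weak convergence follows by
    approximating continuous functions by Poisson integrals ([weak_cvg_cauchy]).

    Three points need more work. (1) The definition of free convolution only gives the
    subordination identity near infinity, on a domain which depends on [n]. Vitali's theorem
    extends it to a half-line which depends only on a bound of the second moments
    ([free_power_subordination]). The analytic functions occurring here are handled as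
    uniform limits of polynomials on discs, for which Cauchy's estimates come from
    averages over roots of unity ([coef_bound_on_disc], [vitali]). (2) The moments of [nu_n]
    are read off asymptotic expansions in [1 / w] along the imaginary axis, where Fatou's
    lemma shows that they are finite; they are given by a polynomial recursion in the
    moments of [mu_n] and in [1 / N] ([free_root_moments]). (3) At [1 / N = 0] this recursion
    is the one obtained by removing the first point of a non-crossing partition
    ([cumulant_momentS], [root_poly0]), which identifies the limits with the free cumulants.
    The same recursion, with bounds by Catalan numbers, yields the equation of the compound
    Poisson law. *)

Set Implicit Arguments.
Unset Strict Implicit.
Unset Printing Implicit Defensive.
Import Order.TTheory GRing.Theory Num.Theory.
Import numFieldNormedType.Exports.
Import Normc.

Local Open Scope classical_set_scope.
Local Open Scope ring_scope.
Local Open Scope complex_scope.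

(** * Modulus of complex numbers *)

Section modulus.
Context {R : realType}.
Implicit Types z w : R[i].

Lemma normc_norm z : `|z| = (normc z)%:C.
Proof. by case: z. Qed.

Lemma normc_ge0 z : 0 <= normc z.
Proof. by case: z => a b /=; rewrite sqrtr_ge0. Qed.

Lemma normc_eq0 z : (normc z == 0) = (z == 0).
Proof.
by apply/eqP/eqP => [|->]; [exact: eq0_normc | exact: normc0].
Qed.

Lemma normc_gt0 z : (0 < normc z) = (z != 0).
Proof. by rewrite lt_def normc_ge0 andbT normc_eq0. Qed.

Lemma normcX z n : normc (z ^+ n) = normc z ^+ n.
Proof.
by elim: n => [|n IH]; rewrite ?expr0 ?normc1 // !exprS normcM IH.
Qed.

Lemma normcB z w : normc (z - w) = normc (w - z).
Proof. by rewrite -normcN opprB. Qed.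

Lemma normc_real (a : R) : normc a%:C = `|a|.
Proof. by rewrite /= expr0n /= addr0 sqrtr_sqr. Qed.

Lemma le_normcB z w : normc (z - w) <= normc z + normc w.
Proof. by have := le_normcD z (- w); rewrite normcN. Qed.

Lemma le_normc_dist z w : normc z - normc w <= normc (z - w).
Proof. by rewrite lerBlDr; apply: le_trans (le_normcD _ _); rewrite subrK. Qed.

Lemma normc_sum (I : Type) (r : seq I) (P : pred I) (F : I -> R[i]) :
  normc (\sum_(i <- r | P i) F i) <= \sum_(i <- r | P i) normc (F i).
Proof.
elim/big_ind2 : _ => //; first by rewrite normc0.
by move=> a b c d h1 h2; apply: le_trans (le_normcD _ _) (lerD h1 h2).
Qed.

Lemma normc_Re z : `|complex.Re z| <= normc z.
Proof.
case: z => a b /=; rewrite -[leLHS]ger0_norm // -sqrtr_sqr real_normK ?num_real //.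
by apply: ler_wsqrtr; rewrite lerDl sqr_ge0.
Qed.

Lemma normc_Im z : `|complex.Im z| <= normc z.
Proof.
case: z => a b /=; rewrite -[leLHS]ger0_norm // -sqrtr_sqr real_normK ?num_real //.
by apply: ler_wsqrtr; rewrite lerDr sqr_ge0.
Qed.

Lemma normc_ReIm z : normc z <= `|complex.Re z| + `|complex.Im z|.
Proof.
case: z => a b.
have -> : a +i* b = a%:C + (0 +i* b) by rewrite /= -[RHS]/((a + 0) +i* (0 + b)) addr0 add0r.
apply: le_trans (le_normcD _ _) _.
by rewrite normc_real /= expr0n /= add0r addr0 add0r sqrtr_sqr.
Qed.

Lemma ReD z w : complex.Re (z + w) = complex.Re z + complex.Re w.
Proof. by case: z w => [a b] [c d]. Qed.
Lemma ImD z w : complex.Im (z + w) = complex.Im z + complex.Im w.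
Proof. by case: z w => [a b] [c d]. Qed.
Lemma ReN z : complex.Re (- z) = - complex.Re z.
Proof. by case: z. Qed.
Lemma ImN z : complex.Im (- z) = - complex.Im z.
Proof. by case: z. Qed.
Lemma ReM z w : complex.Re (z * w) =
  complex.Re z * complex.Re w - complex.Im z * complex.Im w.
Proof. by case: z w => [a b] [c d]. Qed.
Lemma ImM z w : complex.Im (z * w) =
  complex.Re z * complex.Im w + complex.Im z * complex.Re w.
Proof. by case: z w => [a b] [c d]. Qed.
Lemma ReV z : complex.Re z^-1 =
  complex.Re z / (complex.Re z ^+ 2 + complex.Im z ^+ 2).
Proof. by case: z. Qed.
Lemma ImV z : complex.Im z^-1 =
  - complex.Im z / (complex.Re z ^+ 2 + complex.Im z ^+ 2).
Proof. by case: z => a b /=; rewrite mulNr. Qed.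

Lemma normc_sq z : normc z ^+ 2 = complex.Re z ^+ 2 + complex.Im z ^+ 2.
Proof. by case: z => a b /=; rewrite sqr_sqrtr // addr_ge0 ?sqr_ge0. Qed.

Lemma ImVE z : complex.Im z^-1 = - complex.Im z / normc z ^+ 2.
Proof. by rewrite ImV normc_sq. Qed.

Lemma upper_neq0 z : 0 < complex.Im z -> z != 0.
Proof. by move=> h; apply/eqP => z0; move: h; rewrite z0 ltxx. Qed.

Lemma Im_subR z (x : R) : complex.Im (z - x%:C) = complex.Im z.
Proof. by rewrite ImD ImN subr0. Qed.

Lemma subR_neq0 z (x : R) : 0 < complex.Im z -> z - x%:C != 0.
Proof. by move=> h; apply: upper_neq0; rewrite Im_subR. Qed.

Lemma Im_le_normc_subR z (x : R) : 0 < complex.Im z ->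
  complex.Im z <= normc (z - x%:C).
Proof.
move=> h; apply: le_trans (normc_Im _).
by rewrite Im_subR ler_norm.
Qed.

Lemma normc_resolvent z (x : R) : 0 < complex.Im z ->
  normc (z - x%:C)^-1 <= (complex.Im z)^-1.
Proof.
move=> h; rewrite normcV lef_pV2 ?posrE //; first exact: Im_le_normc_subR.
by rewrite normc_gt0 subR_neq0.
Qed.

End modulus.

(** * Integrals of complex-valued functions *)

Section complex_integral.
Context {R : realType}.
Implicit Types (mu : probability R R) (f h : R -> R) (g : R -> R[i]).

Definition cmeasurable g :=
  measurable_fun setT (fun x => complex.Re (g x)) /\
  measurable_fun setT (fun x => complex.Im (g x)).

Lemma measurable_inv_fun f : measurable_fun setT f ->
  measurable_fun setT (fun x => (f x)^-1).
Proof.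
move=> mf; apply: (@measurableT_comp _ _ _ _ _ _ (fun y : R => y^-1)) => //.
rewrite (_ : [set: R] = [set 0] `|` [set~ 0]); last by rewrite setUv.
apply/measurable_funU => //.
  exact: measurableC.
split; first exact: measurable_fun_set1.
apply: open_continuous_measurable_fun.
  by apply: closed_openC; exact: closed_eq.
by move=> x; rewrite inE /= => /eqP x0; exact: inv_continuous.
Qed.

Lemma cmeasurable_cst c : cmeasurable (cst c).
Proof. by split; exact: measurable_cst. Qed.

Lemma cmeasurable_real f : measurable_fun setT f -> cmeasurable (fun x => (f x)%:C).
Proof. by move=> mf; split => //=. Qed.

Lemma cmeasurableD g1 g2 : cmeasurable g1 -> cmeasurable g2 ->
  cmeasurable (fun x => g1 x + g2 x).
Proof.
move=> [h1 h2] [h3 h4]; split.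
  by under eq_fun do rewrite ReD; exact: measurable_funD.
by under eq_fun do rewrite ImD; exact: measurable_funD.
Qed.

Lemma cmeasurableN g : cmeasurable g -> cmeasurable (fun x => - g x).
Proof.
move=> [h1 h2]; split.
  by under eq_fun do rewrite ReN; exact: measurable_funN.
by under eq_fun do rewrite ImN; exact: measurable_funN.
Qed.

Lemma cmeasurableB g1 g2 : cmeasurable g1 -> cmeasurable g2 ->
  cmeasurable (fun x => g1 x - g2 x).
Proof. by move=> h1 h2; apply: cmeasurableD => //; exact: cmeasurableN. Qed.

Lemma cmeasurableM g1 g2 : cmeasurable g1 -> cmeasurable g2 ->
  cmeasurable (fun x => g1 x * g2 x).
Proof.
move=> [h1 h2] [h3 h4]; split.
  by under eq_fun do rewrite ReM; apply: measurable_funB; exact: measurable_funM.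
by under eq_fun do rewrite ImM; apply: measurable_funD; exact: measurable_funM.
Qed.

Lemma cmeasurableX g n : cmeasurable g -> cmeasurable (fun x => g x ^+ n).
Proof.
move=> mg; elim: n => [|n IH].
  by under eq_fun do rewrite expr0; exact: cmeasurable_cst.
by under eq_fun do rewrite exprS; exact: cmeasurableM.
Qed.

Lemma cmeasurableV g : cmeasurable g -> cmeasurable (fun x => (g x)^-1).
Proof.
move=> [h1 h2].
have h : measurable_fun setT
    (fun x => (complex.Re (g x) ^+ 2 + complex.Im (g x) ^+ 2)^-1).
  by apply: measurable_inv_fun; apply: measurable_funD; exact: measurable_funX.
split.
  by under eq_fun do rewrite ReV; exact: measurable_funM.
under eq_fun do rewrite ImV; apply: measurable_funM => //.
exact: measurable_funN.
Qed.

Lemma cmeasurable_id : cmeasurable (fun x => x%:C).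
Proof. by apply: cmeasurable_real. Qed.

Lemma cmeasurable_resolvent (z : R[i]) : cmeasurable (fun x => (z - x%:C)^-1).
Proof.
apply: cmeasurableV; apply: cmeasurableB; last exact: cmeasurable_id.
exact: cmeasurable_cst.
Qed.

Lemma measurable_normc g : cmeasurable g -> measurable_fun setT (fun x => normc (g x)).
Proof.
move=> [h1 h2].
rewrite (_ : (fun x => normc (g x)) =
    Num.sqrt \o (fun x => complex.Re (g x) ^+ 2 + complex.Im (g x) ^+ 2)).
  apply: measurableT_comp.
    by apply: continuous_measurable_fun => x; exact: sqrt_continuous.
  by apply: measurable_funD; exact: measurable_funX.
by apply/funext => x /=; case: (g x).
Qed.

Definition Rintegrable mu f := mu.-integrable setT (EFin \o f).

Lemma Rintegrable_measurable mu f : Rintegrable mu f -> measurable_fun setT f.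
Proof. by move=> /integrableP[/measurable_EFinP]. Qed.

Lemma Rintegrable_le mu f h : measurable_fun setT f ->
  (forall x, `|f x| <= h x) -> Rintegrable mu h -> Rintegrable mu f.
Proof.
move=> mf fh ih; apply: (le_integrable measurableT _ _ ih).
  exact/measurable_EFinP.
by move=> x _ /=; rewrite lee_fin (le_trans (fh x)) // ler_norm.
Qed.

Lemma Rintegrable_cst mu c : Rintegrable mu (cst c).
Proof. exact: finite_measure_integrable_cst. Qed.

Lemma RintegrableZ mu c f : Rintegrable mu f -> Rintegrable mu (fun x => c * f x).
Proof.
move=> fi; have := integrableZl measurableT c fi.
by apply: eq_integrable => // x _ /=; rewrite EFinM.
Qed.

Lemma RintegrableD mu f1 f2 : Rintegrable mu f1 -> Rintegrable mu f2 ->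
  Rintegrable mu (fun x => f1 x + f2 x).
Proof.
move=> h1 h2; have := integrableD measurableT h1 h2.
by apply: eq_integrable => // x _ /=; rewrite EFinD.
Qed.

Lemma RintegrableB mu f1 f2 : Rintegrable mu f1 -> Rintegrable mu f2 ->
  Rintegrable mu (fun x => f1 x - f2 x).
Proof.
move=> h1 h2; have := integrableB measurableT h1 h2.
by apply: eq_integrable => // x _ /=; rewrite EFinB.
Qed.

Lemma Rintegral_prob_cst mu c : \int[mu]_x c = c.
Proof.
rewrite (_ : (\int[mu]_x c) = \int[mu]_(x in setT) (cst c) x) //.
by rewrite Rintegral_cst //= probability_setT mulr1.
Qed.

Lemma Rintegral_mono mu f h : Rintegrable mu f -> Rintegrable mu h ->
  (forall x, f x <= h x) -> \int[mu]_x f x <= \int[mu]_x h x.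
Proof. by move=> fi ih fh; apply: le_Rintegral => // x _. Qed.

Lemma Rintegral_le_bound mu f h : measurable_fun setT f -> Rintegrable mu h ->
  (forall x, `|f x| <= h x) -> `|\int[mu]_x f x| <= \int[mu]_x h x.
Proof.
move=> mf ih fh; have fi := Rintegrable_le mf fh ih.
apply: le_trans (le_normr_Rintegral measurableT fi) _.
apply: le_Rintegral => //.
exact: (integrable_norm fi).
Qed.

Lemma Rintegral_cvg mu (f_ : nat -> R -> R) f h :
  (forall n, measurable_fun setT (f_ n)) -> measurable_fun setT f ->
  Rintegrable mu h -> (forall n x, `|f_ n x| <= h x) ->
  (forall x, f_ ^~ x @ \oo --> f x) ->
  \int[mu]_x f_ n x @[n --> \oo] --> \int[mu]_x f x.
Proof.
move=> mf_ mf ih fh f0.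
have [|||||fi _ H] := @dominated_convergence _ _ _ mu setT measurableT
  (fun n => EFin \o f_ n) (EFin \o f) (EFin \o h).
- by move=> n; exact/measurable_EFinP.
- exact/measurable_EFinP.
- by apply: aeW => x _; apply/fine_cvgP; split; [exact: nearW | exact: f0].
- exact: ih.
- by apply: aeW => x n _; rewrite /= lee_fin.
have fn : (\int[mu]_x (f x)%:E)%E \is a fin_num by exact: integrable_fin_num.
by move: H; rewrite -(fineK fn) => /fine_cvgP[_].
Qed.

Definition cint mu g : R[i] :=
  (\int[mu]_x complex.Re (g x)) +i* (\int[mu]_x complex.Im (g x)).

Definition cintegrable mu g :=
  Rintegrable mu (fun x => complex.Re (g x)) /\
  Rintegrable mu (fun x => complex.Im (g x)).

Lemma cintegrable_le mu g h : cmeasurable g ->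
  (forall x, normc (g x) <= h x) -> Rintegrable mu h -> cintegrable mu g.
Proof.
move=> [m1 m2] gh ih; split.
  by apply: (Rintegrable_le m1 _ ih) => x; apply: le_trans (normc_Re _) (gh x).
by apply: (Rintegrable_le m2 _ ih) => x; apply: le_trans (normc_Im _) (gh x).
Qed.

Lemma eq_cint mu g1 g2 : g1 =1 g2 -> cint mu g1 = cint mu g2.
Proof. by move=> /funext ->. Qed.

Lemma cintD mu g1 g2 : cintegrable mu g1 -> cintegrable mu g2 ->
  cint mu (fun x => g1 x + g2 x) = cint mu g1 + cint mu g2.
Proof.
move=> [a1 b1] [a2 b2]; rewrite /cint.
under eq_Rintegral do rewrite ReD.
under [X in _ +i* X]eq_Rintegral do rewrite ImD.
by rewrite !RintegralD.
Qed.

Lemma cintegrableD mu g1 g2 : cintegrable mu g1 -> cintegrable mu g2 ->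
  cintegrable mu (fun x => g1 x + g2 x).
Proof.
move=> [a1 b1] [a2 b2]; split.
  by under eq_fun do rewrite ReD; exact: RintegrableD.
by under eq_fun do rewrite ImD; exact: RintegrableD.
Qed.

Lemma cintZ mu c g : cintegrable mu g ->
  cint mu (fun x => c * g x) = c * cint mu g.
Proof.
case: c => a b [i1 i2]; rewrite /cint.
under eq_Rintegral do rewrite ReM /=.
under [X in _ +i* X]eq_Rintegral do rewrite ImM /=.
by rewrite RintegralB ?RintegralD ?RintegralZl //; exact: RintegrableZ.
Qed.

Lemma cintegrableZ mu c g : cintegrable mu g -> cintegrable mu (fun x => c * g x).
Proof.
case: c => a b [i1 i2]; split.
  by under eq_fun do rewrite ReM /=; apply: RintegrableB; exact: RintegrableZ.
by under eq_fun do rewrite ImM /=; apply: RintegrableD; exact: RintegrableZ.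
Qed.

Lemma cintB mu g1 g2 : cintegrable mu g1 -> cintegrable mu g2 ->
  cint mu (fun x => g1 x - g2 x) = cint mu g1 - cint mu g2.
Proof.
move=> i1 i2; rewrite -mulN1r -cintZ // -cintD //; last exact: cintegrableZ.
by apply: eq_cint => x; rewrite mulN1r.
Qed.

Lemma cint_real mu f : cint mu (fun x => (f x)%:C) = (\int[mu]_x f x)%:C.
Proof. by rewrite /cint /= Rintegral_prob_cst. Qed.

Lemma cintegrable_real mu f : Rintegrable mu f -> cintegrable mu (fun x => (f x)%:C).
Proof. by move=> h; split => //=; exact: Rintegrable_cst. Qed.

Lemma cint_cst mu c : cint mu (cst c) = c.
Proof. by case: c => a b; rewrite /cint /= !Rintegral_prob_cst. Qed.

Lemma cintegrable_cst mu c : cintegrable mu (cst c).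
Proof. by split; exact: Rintegrable_cst. Qed.

Lemma cint_sum mu n (g : nat -> R -> R[i]) : (forall i, (i < n)%N -> cintegrable mu (g i)) ->
  cintegrable mu (fun x => \sum_(i < n) g i x) /\
  cint mu (fun x => \sum_(i < n) g i x) = \sum_(i < n) cint mu (g i).
Proof.
elim: n => [|n IH] gi.
  under eq_fun do rewrite big_ord0.
  by rewrite big_ord0; split; [exact: cintegrable_cst | exact: cint_cst].
have [i1 e1] := IH (fun i lt => gi i (ltnW lt)).
under eq_fun do rewrite big_ord_recr /=.
rewrite big_ord_recr /= -e1 -cintD //; last exact: gi.
by split => //; apply: cintegrableD => //; exact: gi.
Qed.

(** Multiplying by a unimodular constant turns the integral into its modulus,
    so the bound reduces to a bound on a real integral. *)
Lemma normc_cint_le mu g h : cmeasurable g -> Rintegrable mu h ->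
  (forall x, normc (g x) <= h x) -> normc (cint mu g) <= \int[mu]_x h x.
Proof.
move=> mg ih gh.
have ig := cintegrable_le mg gh ih.
set I := cint mu g.
have [I0|I0] := eqVneq I 0.
  rewrite I0 normc0; apply: Rintegral_ge0 => x _.
  exact: le_trans (normc_ge0 _) (gh x).
pose u := (normc I)%:C / I.
have nI : normc I != 0 by rewrite normc_eq0.
have nu : normc u = 1.
  by rewrite /u normcM normcV normc_real ger0_norm ?normc_ge0 // divff.
have -> : normc I = complex.Re (cint mu (fun x => u * g x)).
  by rewrite cintZ // -/I /u mulfVK //.
rewrite /cint /=; apply: le_Rintegral => //.
  by case: (cintegrableZ u ig).
move=> x _; apply: le_trans (gh x); apply: le_trans (ler_norm _) _.
by apply: le_trans (normc_Re _) _; rewrite normcM nu mul1r.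
Qed.

End complex_integral.
(** * Convergence of complex sequences *)

Section complex_sequences.
Context {R : realType}.
Implicit Types (u v : nat -> R[i]) (l m : R[i]).

Lemma cvg0_le (a b : nat -> R) : (forall n, 0 <= a n <= b n) ->
  b @ \oo --> (0 : R) -> a @ \oo --> (0 : R).
Proof.
move=> ab b0; apply: (squeeze_cvgr _ (cvg_cst 0) b0).
exact: nearW.
Qed.

(** The form in which a fixed truncation is combined with a limit in [n]. *)
Lemma cvg0_approx (a : nat -> R) : (forall n, 0 <= a n) ->
  (forall e, 0 < e -> exists2 b : nat -> R, b @ \oo --> (0 : R) &
     \forall n \near \oo, a n <= b n + e) ->
  a @ \oo --> (0 : R).
Proof.
move=> a0 H; apply/cvgr0Pnorm_le => e e0.
have [b b0 ab] := H (e / 2) (divr_gt0 e0 (ltr0n _ 2)).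
have /cvgr0Pnorm_le /(_ _ (divr_gt0 e0 (ltr0n _ 2))) hb := b0.
near=> n.
rewrite ger0_norm //.
have h1 : a n <= b n + e / 2 by near: n.
have h2 : `|b n| <= e / 2 by near: n; exact: hb.
rewrite (le_trans h1) // [leRHS](splitr e) lerD2r (le_trans _ h2) //.
exact: ler_norm.
Unshelve. all: by end_near.
Qed.

Definition ccvg u l := normc (u n - l) @[n --> \oo] --> (0 : R).

Lemma ccvgP u l : ccvg u l <->
  (complex.Re (u n) @[n --> \oo] --> complex.Re l) /\
  (complex.Im (u n) @[n --> \oo] --> complex.Im l).
Proof.
have subRe n : complex.Re (u n - l) = complex.Re (u n) - complex.Re l.
  by rewrite ReD ReN.
have subIm n : complex.Im (u n - l) = complex.Im (u n) - complex.Im l.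
  by rewrite ImD ImN.
split => [h|[h1 h2]].
  split; apply/subr_cvg0; apply/norm_cvg0P.
    by apply: (cvg0_le _ h) => n; rewrite normr_ge0 -subRe normc_Re.
  by apply: (cvg0_le _ h) => n; rewrite normr_ge0 -subIm normc_Im.
have {}h1 : `|complex.Re (u n) - complex.Re l| @[n --> \oo] --> (0 : R).
  by apply/norm_cvg0P/subr_cvg0.
have {}h2 : `|complex.Im (u n) - complex.Im l| @[n --> \oo] --> (0 : R).
  by apply/norm_cvg0P/subr_cvg0.
apply: (@cvg0_le _ (fun n => `|complex.Re (u n) - complex.Re l| +
   `|complex.Im (u n) - complex.Im l|)).
  by move=> n; rewrite normc_ge0 -subRe -subIm normc_ReIm.
by rewrite -[X in _ --> X]addr0; exact: cvgD.
Qed.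

Lemma ccvg_cst l : ccvg (fun=> l) l.
Proof. by apply/ccvgP; split; exact: cvg_cst. Qed.

Lemma ccvg_real (f : nat -> R) (a : R) : f @ \oo --> a ->
  ccvg (fun n => (f n)%:C) a%:C.
Proof. by move=> h; apply/ccvgP; split => //=; exact: cvg_cst. Qed.

Lemma ccvgD u v l m : ccvg u l -> ccvg v m -> ccvg (fun n => u n + v n) (l + m).
Proof.
move=> /ccvgP[a b] /ccvgP[c d]; apply/ccvgP; split.
  by under eq_fun do rewrite ReD; rewrite ReD; exact: cvgD.
by under eq_fun do rewrite ImD; rewrite ImD; exact: cvgD.
Qed.

Lemma ccvgN u l : ccvg u l -> ccvg (fun n => - u n) (- l).
Proof.
move=> /ccvgP[a b]; apply/ccvgP; split.
  by under eq_fun do rewrite ReN; rewrite ReN; exact: cvgN.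
by under eq_fun do rewrite ImN; rewrite ImN; exact: cvgN.
Qed.

Lemma ccvgB u v l m : ccvg u l -> ccvg v m -> ccvg (fun n => u n - v n) (l - m).
Proof. by move=> ul /ccvgN; exact: ccvgD. Qed.

Lemma ccvgM u v l m : ccvg u l -> ccvg v m -> ccvg (fun n => u n * v n) (l * m).
Proof.
move=> /ccvgP[a b] /ccvgP[c d]; apply/ccvgP; split.
  by under eq_fun do rewrite ReM; rewrite ReM; apply: cvgB; exact: cvgM.
by under eq_fun do rewrite ImM; rewrite ImM; apply: cvgD; exact: cvgM.
Qed.

Lemma ccvgX u l k : ccvg u l -> ccvg (fun n => u n ^+ k) (l ^+ k).
Proof.
move=> ul; elim: k => [|k IH].
  by under eq_fun do rewrite expr0; rewrite expr0; exact: ccvg_cst.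
by under eq_fun do rewrite exprS; rewrite exprS; exact: ccvgM.
Qed.

Lemma ccvg_sum (I : Type) (r : seq I) (P : pred I) (u : I -> nat -> R[i]) (l : I -> R[i]) :
  (forall i, ccvg (u i) (l i)) ->
  ccvg (fun n => \sum_(i <- r | P i) u i n) (\sum_(i <- r | P i) l i).
Proof.
move=> ul; elim: r => [|i r IH].
  by under eq_fun do rewrite big_nil; rewrite big_nil; exact: ccvg_cst.
under eq_fun do rewrite big_cons; rewrite big_cons; case: (P i) => //.
exact: ccvgD.
Qed.

Lemma ccvg_neq0 u l : ccvg u l -> l != 0 -> \forall n \near \oo, u n != 0.
Proof.
move=> ul l0; have nl : 0 < normc l by rewrite normc_gt0.
have /cvgr0Pnorm_lt /(_ _ nl) h := ul.
near=> n; apply/eqP => un0.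
have : `|normc (u n - l)| < normc l by near: n; exact: h.
by rewrite un0 sub0r normcN ger0_norm ?normc_ge0 // ltxx.
Unshelve. all: by end_near.
Qed.

Lemma ccvgV u l : l != 0 -> ccvg u l -> ccvg (fun n => (u n)^-1) l^-1.
Proof.
move=> l0 /ccvgP[a b].
have hs : complex.Re l ^+ 2 + complex.Im l ^+ 2 != 0.
  by rewrite -normc_sq sqrf_eq0 normc_eq0.
have h : (complex.Re (u n) ^+ 2 + complex.Im (u n) ^+ 2)^-1 @[n --> \oo] -->
   (complex.Re l ^+ 2 + complex.Im l ^+ 2)^-1.
  apply: cvgV => //; rewrite !expr2; under eq_fun do rewrite !expr2.
  by apply: cvgD; apply: cvgM.
apply/ccvgP; split.
  by under eq_fun do rewrite ReV; rewrite ReV; exact: cvgM.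
under eq_fun do rewrite ImV; rewrite ImV; apply: cvgM => //.
exact: cvgN.
Qed.

Lemma ccvg_unique u l m : ccvg u l -> ccvg u m -> l = m.
Proof.
move=> /ccvgP[a b] /ccvgP[c d]; apply/eqP; rewrite eq_complex.
by rewrite (cvg_unique _ a c) // (cvg_unique _ b d) // !eqxx.
Qed.

Lemma ccvg0P u : ccvg u 0 <-> normc (u n) @[n --> \oo] --> (0 : R).
Proof. by rewrite /ccvg; under eq_fun do rewrite subr0. Qed.

End complex_sequences.

(** * Uniform limits of polynomials on a disc *)

Section polynomials_on_discs.
Context {R : realType}.
Implicit Types (p q : {poly R[i]}) (c z h : R[i]) (r e S : R) (g : R[i] -> R[i]).

(** ['X^n - 1] splits and is separable, so that its roots cannot all have order
    less than [n]. *)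
Lemma complex_prim_root n : (0 < n)%N -> {z : R[i] | n.-primitive_root z}.
Proof.
pose p : {poly R[i]} := 'X^n - 1; have [r Dp] := closed_field_poly_normal p.
move=> n_gt0; apply/sigW; rewrite (monicP _) ?monicXnsubC // scale1r in Dp.
have rn1: all n.-unity_root r by apply/allP=> z; rewrite -root_prod_XsubC -Dp.
have sz_r: (n < (size r).+1)%N.
  by rewrite -(size_prod_XsubC r id) -Dp size_XnsubC.
have [|z] := hasP (has_prim_root n_gt0 rn1 _ sz_r); last by exists z.
rewrite -separable_prod_XsubC -Dp; apply: separable_Xn_sub_1.
by rewrite pnatr_eq0 -lt0n.
Qed.

(** Averaging [p (r z) z^(-j)] over the roots of unity [z] of an order larger
    than the degree isolates the coefficient of index [j]. *)
Lemma coef_bound_on_disc p r S (j : nat) : 0 <= r ->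
  (forall h, normc h <= r -> normc p.[h] <= S) -> normc p`_j * r ^+ j <= S.
Proof.
move=> r0 pS; pose n := (size p + j).+1.
have [x xn] := complex_prim_root (ltn0Sn (size p + j)).
have n0 : (n%:R : R[i]) != 0 by rewrite pnatr_eq0.
have nx : normc x = 1.
  have : normc x ^+ n = 1 by rewrite -normcX (prim_expr_order xn) normc1.
  by move/eqP; rewrite pexpr_eq1 // ?normc_ge0 // => /eqP.
have sumx m : (0 < m < n)%N -> \sum_(k < n) x ^+ (m * k) = 0.
  move=> /andP[m0 mn]; have xm : x ^+ m != 1.
    by rewrite -(prim_order_dvd xn); apply/negP => /(dvdn_leq m0); rewrite leqNgt mn.
  have := subrX1 (x ^+ m) n; rewrite -exprM mulnC exprM (prim_expr_order xn) expr1n subrr.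
  move/esym/eqP; rewrite mulf_eq0 subr_eq0 (negPf xm) /= => /eqP s0.
  by rewrite -[RHS]s0; apply: eq_bigr => k _; rewrite exprM.
have key : \sum_(k < n) p.[r%:C * x ^+ k] * x ^+ ((n - j) * k) =
    n%:R * (p`_j * r%:C ^+ j).
  under eq_bigr => k _.
    rewrite (@horner_coef_wide _ n); last by rewrite /n ltnW // ltnS leq_addr.
    rewrite mulr_suml.
    under eq_bigr => i _ do rewrite exprMn -exprM !mulrA -mulrA -exprD mulnC -mulnDl.
    over.
  rewrite exchange_big /=.
  have jn : (j < n)%N by rewrite /n ltnS leq_addl.
  rewrite (bigD1 (Ordinal jn)) //= subnKC; last exact: ltnW.
  rewrite [X in _ + X]big1 ?addr0.
    rewrite -mulr_sumr (eq_bigr (fun=> 1)) ?sumr_const ?card_ord.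
      by rewrite mulrC mulr_natl.
    by move=> k _; rewrite exprM (prim_expr_order xn) expr1n.
  move=> i ij; rewrite -mulr_sumr.
  have [ilt|ige] := ltnP i j.
    rewrite sumx ?mulr0 //; apply/andP; split.
      by rewrite addn_gt0 subn_gt0 jn orbT.
    by rewrite -[X in (_ < X)%N](subnKC (ltnW jn)) ltn_add2r.
  have jlt : (j < i)%N.
    by rewrite ltn_neqAle ige andbT; apply: contra ij => /eqP e; apply/eqP/val_inj.
  rewrite (eq_bigr (fun k : 'I_n => x ^+ ((i - j) * k))).
    rewrite sumx ?mulr0 // subn_gt0 jlt /=.
    by apply: leq_ltn_trans (ltn_ord i); exact: leq_subr.
  move=> k _; have -> : (i + (n - j) = n + (i - j))%N.
    by rewrite addnBA ?(ltnW jn) // addnBA // addnC.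
  by rewrite mulnDl exprD exprM (prim_expr_order xn) expr1n mul1r.
have : normc (n%:R * (p`_j * r%:C ^+ j)) <= n%:R * S.
  rewrite -key; apply: le_trans (normc_sum _ _ _) _.
  have le_k (k : 'I_n) : normc (p.[r%:C * x ^+ k] * x ^+ ((n - j) * k)) <= S.
    rewrite normcM normcX nx expr1n mulr1; apply: pS.
    by rewrite normcM normc_real ger0_norm // normcX nx expr1n mulr1.
  apply: le_trans (ler_sum _ (fun k _ => le_k k)) _.
  by rewrite sumr_const card_ord mulr_natl.
have nn : normc (n%:R : R[i]) = n%:R.
  by rewrite -(rmorph_nat (real_complex R)) normc_real normr_nat.
rewrite normcM nn ler_pM2l ?ltr0n // normcM normcX normc_real.
by rewrite (ger0_norm r0).
Qed.

(** Cauchy's estimates, summed over the coefficients of index at least [m]. *)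
Lemma horner_drop_bound p r S m h : 0 < r -> normc h < r ->
  (forall h', normc h' <= r -> normc p.[h'] <= S) ->
  normc (drop_poly m p).[h] <= S / r ^+ m / (1 - normc h / r).
Proof.
move=> r0 hr pS; set t := normc h / r.
have t0 : 0 <= t by rewrite divr_ge0 ?normc_ge0 // ltW.
have t1 : t < 1 by rewrite ltr_pdivrMr // mul1r.
have S0 : 0 <= S by apply: le_trans (pS 0 _); rewrite ?normc_ge0 ?normc0 // ltW.
have le_i (i : 'I_(size (drop_poly m p))) :
    normc ((drop_poly m p)`_i * h ^+ i) <= S / r ^+ m * t ^+ i.
  rewrite coef_drop_poly normcM normcX.
  rewrite /t expr_div_n mulrA [leRHS]mulrAC ler_wpM2r ?exprn_ge0 ?normc_ge0 //.
  rewrite -mulrA -invfM -exprD ler_pdivlMr ?exprn_gt0 // [X in r ^+ X]addnC.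
  exact: coef_bound_on_disc (ltW r0) pS.
rewrite horner_coef; apply: le_trans (normc_sum _ _ _) _.
apply: le_trans (ler_sum _ (fun i _ => le_i i)) _.
rewrite -mulr_sumr ler_wpM2l ?divr_ge0 ?exprn_ge0 ?(ltW r0) //.
rewrite -[leRHS]mul1r ler_pdivlMr ?subr_gt0 // mulrC.
rewrite -opprB mulNr -subrX1 opprB lerBlDr lerDl exprn_ge0 //.
Qed.

Lemma horner_dropS p m h :
  (drop_poly m p).[h] = p`_m + h * (drop_poly m.+1 p).[h].
Proof.
have -> : drop_poly m p = (p`_m)%:P + 'X * drop_poly m.+1 p.
  apply/polyP => i; rewrite coefD coefC coefXM !coef_drop_poly.
  by case: i => [|i]; rewrite ?addr0 // add0r addnS.
by rewrite hornerD hornerC hornerM hornerX.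
Qed.

Lemma horner_take_drop p m h :
  p.[h] = \sum_(i < m) p`_i * h ^+ i + h ^+ m * (drop_poly m p).[h].
Proof.
elim: m => [|m IH]; first by rewrite big_ord0 add0r expr0 mul1r drop_poly0l.
by rewrite IH big_ord_recr /= horner_dropS exprSr; ring.
Qed.

(** A uniformly bounded sequence of polynomials which tends to zero on a segment
    issued from the origin has coefficients tending to zero: divide repeatedly by
    the variable. *)
Lemma vitali_coef (p : nat -> {poly R[i]}) r S (s1 : R) : 0 < r -> 0 < s1 ->
  (forall n h, normc h <= r -> normc (p n).[h] <= S) ->
  (forall s, 0 < s < s1 -> ccvg (fun n => (p n).[0 +i* s]) 0) ->
  forall m, ccvg (fun n => (p n)`_m) 0.
Proof.
move=> r0 s10 pS ps.
set sm := Num.min s1 (r / 2).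
have step m : (forall s, 0 < s < sm -> ccvg (fun n => (drop_poly m (p n)).[0 +i* s]) 0) ->
    ccvg (fun n => (p n)`_m) 0.
  move=> H.
  apply/ccvg0P/cvg0_approx => [n|e e0]; first exact: normc_ge0.
  have S0 : 0 <= S by apply: le_trans (pS 0%N 0 _); rewrite ?normc_ge0 ?normc0 // ltW.
  set C := S / r ^+ m.+1 * 2.
  have C0 : 0 <= C by rewrite mulr_ge0 ?divr_ge0 // exprn_ge0 // ltW.
  pose s := Num.min (sm / 2) (e / (C + 1)).
  have C1 : 0 < C + 1 by rewrite ltr_wpDl.
  have smin0 : 0 < sm by rewrite lt_min s10 divr_gt0.
  have sgt0 : 0 < s by rewrite lt_min !divr_gt0.
  have slt : s < sm.
    by rewrite gt_min [X in X || _](_ : _ = true) // ltr_pdivrMr // ltr_pMr // ltr1n.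
  have nis : normc (0 +i* s) = s by rewrite /= expr0n /= add0r sqrtr_sqr ger0_norm // ltW.
  have sr2 : s <= r / 2 by move: (ltW slt); rewrite le_min => /andP[].
  exists (fun n => normc (drop_poly m (p n)).[0 +i* s]).
    by apply/ccvg0P; apply: H; rewrite sgt0 slt.
  apply: nearW => n.
  have -> : (p n)`_m = (drop_poly m (p n)).[0 +i* s] -
     (0 +i* s) * (drop_poly m.+1 (p n)).[0 +i* s] by rewrite horner_dropS addrK.
  apply: le_trans (le_normcB _ _) _; rewrite lerD2l normcM nis.
  have slr : normc (0 +i* s) < r.
    by rewrite nis (le_lt_trans sr2) // ltr_pdivrMr // ltr_pMr // ltr1n.
  have := horner_drop_bound m.+1 r0 slr (pS n); rewrite nis => hb.
  apply: (@le_trans _ _ (s * C)).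
    rewrite ler_wpM2l ?(ltW sgt0) //; apply: le_trans hb _.
    rewrite /C ler_wpM2l ?divr_ge0 ?exprn_ge0 ?(ltW r0) //.
    rewrite -[leRHS]invrK lef_pV2 ?posrE ?invr_gt0 //; last first.
      by rewrite subr_gt0 ltr_pdivrMr // mul1r -nis.
    rewrite lerBrDl -lerBrDr ler_pdivrMr //.
    by apply: le_trans sr2 _; lra.
  apply: (@le_trans _ _ (e / (C + 1) * (C + 1))); last by rewrite mulfVK // gt_eqF.
  apply: ler_pM => //; rewrite ?(ltW sgt0) //; last by rewrite lerDl.
  by rewrite /s ge_min lexx orbT.
move=> m; apply: (step).
elim: m => [|m IH] s sb.
  under eq_fun do rewrite drop_poly0l; apply: ps.
  by move: sb; rewrite lt_min => /andP[-> /andP[->]].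
have s0 : (0 +i* s) != 0 :> R[i].
  by apply: upper_neq0 => /=; case/andP: sb.
have := ccvgM (ccvgB (IH s sb) (step _ IH)) (ccvg_cst (0 +i* s)^-1).
rewrite subrr mul0r; congr ccvg; apply/funext => n.
by rewrite horner_dropS addrAC subrr add0r mulrC mulKf.
Qed.

Lemma geo_small (q C e : R) : 0 <= q < 1 -> 0 < e -> exists m, C * q ^+ m <= e.
Proof.
move=> /andP[q0 q1] e0.
have : (fun m => C * q ^+ m) @ \oo --> (0 : R).
  rewrite -[X in _ --> X](mulr0 C); apply: cvgMr.
  by apply: cvg_expr; rewrite ger0_norm.
move/cvgr0Pnorm_le => /(_ _ e0) [m _ /(_ m (leqnn m)) hm]; exists m.
exact: le_trans (ler_norm _) hm.
Qed.

(** The coefficients tend to zero, and Cauchy's estimates make the tails of the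
    expansions uniformly small inside the disc. *)
Lemma vitali_poly (p : nat -> {poly R[i]}) r S (s1 : R) h : 0 < r -> 0 < s1 ->
  (forall n h, normc h <= r -> normc (p n).[h] <= S) ->
  (forall s, 0 < s < s1 -> ccvg (fun n => (p n).[0 +i* s]) 0) ->
  normc h < r -> ccvg (fun n => (p n).[h]) 0.
Proof.
move=> r0 s10 pS ps hr.
have cf := vitali_coef r0 s10 pS ps.
have S0 : 0 <= S by apply: le_trans (pS 0%N 0 _); rewrite ?normc_ge0 ?normc0 // ltW.
set t := normc h / r.
have t0 : 0 <= t by rewrite divr_ge0 ?normc_ge0 // ltW.
have t1 : t < 1 by rewrite ltr_pdivrMr // mul1r.
apply/ccvg0P/cvg0_approx => [n|e e0]; first exact: normc_ge0.
have [|m] := @geo_small t (S / (1 - t)) e _ e0; first by rewrite t0.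
rewrite mulrC => hm.
exists (fun n => normc (\sum_(i < m) (p n)`_i * h ^+ i)).
  apply/ccvg0P.
  have := @ccvg_sum _ _ (index_enum 'I_m) predT (fun i n => (p n)`_i * h ^+ i)
    (fun i => 0 * h ^+ i) (fun i => ccvgM (cf i) (ccvg_cst (h ^+ i))).
  by rewrite big1 // => i _; rewrite mul0r.
apply: nearW => n; rewrite (horner_take_drop _ m).
apply: le_trans (le_normcD _ _) _; rewrite lerD2l normcM normcX.
apply: le_trans _ hm.
apply: (@le_trans _ _ (normc h ^+ m * (S / r ^+ m / (1 - t)))).
  by apply: ler_wpM2l; [rewrite exprn_ge0 ?normc_ge0 | exact: (horner_drop_bound m r0 hr (pS n))].
by rewrite /t expr_div_n; lra.
Qed.

(** [g] is a uniform limit on the closed disc of polynomials; this class of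
    analytic functions is stable under the algebraic operations used below. *)
Definition poly_approx c r g := forall e, 0 < e ->
  exists p, forall z, normc (z - c) <= r -> normc (g z - p.[z - c]) <= e.

Lemma horner_bound p r : 0 <= r ->
  exists2 S, 0 <= S & forall h, normc h <= r -> normc p.[h] <= S.
Proof.
move=> r0; exists (\sum_(i < size p) normc p`_i * r ^+ i).
  by apply: sumr_ge0 => i _; rewrite mulr_ge0 ?normc_ge0 // exprn_ge0.
move=> h hr; rewrite horner_coef; apply: le_trans (normc_sum _ _ _) _.
apply: ler_sum => i _; rewrite normcM normcX ler_wpM2l ?normc_ge0 //.
by rewrite lerXn2r // nnegrE ?normc_ge0.
Qed.

Lemma poly_approx_bound c r g : 0 <= r -> poly_approx c r g ->
  exists2 S, 0 <= S & forall z, normc (z - c) <= r -> normc (g z) <= S.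
Proof.
move=> r0 /(_ _ ltr01)[p hp]; have [S S0 hS] := horner_bound p r0.
exists (1 + S) => [|z zr]; first by rewrite addr_ge0.
by rewrite -[g z](subrK p.[z - c]) (le_trans (le_normcD _ _)) // lerD ?hp ?hS.
Qed.

Lemma eq_poly_approx c r g1 g2 : (forall z, normc (z - c) <= r -> g1 z = g2 z) ->
  poly_approx c r g1 -> poly_approx c r g2.
Proof. by move=> e12 h e /h[p hp]; exists p => z zr; rewrite -e12 ?hp. Qed.

Lemma poly_approx_horner c r p : poly_approx c r (fun z => p.[z - c]).
Proof. by move=> e e0; exists p => z zr; rewrite subrr normc0 ltW. Qed.

Lemma poly_approx_cst c r w : poly_approx c r (fun=> w).
Proof. by move=> e e0; exists w%:P => z zr; rewrite hornerC subrr normc0 ltW. Qed.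

Lemma poly_approx_id c r : poly_approx c r id.
Proof.
apply: (eq_poly_approx _ (poly_approx_horner c r ('X + c%:P))) => z _.
by rewrite hornerD hornerX hornerC subrK.
Qed.

Lemma poly_approxD c r g1 g2 : poly_approx c r g1 -> poly_approx c r g2 ->
  poly_approx c r (fun z => g1 z + g2 z).
Proof.
move=> h1 h2 e e0; have e2 : 0 < e / 2 by rewrite divr_gt0.
have [p hp] := h1 _ e2; have [q hq] := h2 _ e2; exists (p + q) => z zr.
rewrite hornerD (_ : _ - _ = (g1 z - p.[z - c]) + (g2 z - q.[z - c])); last by ring.
by rewrite (le_trans (le_normcD _ _)) // [leRHS]splitr lerD ?hp ?hq.
Qed.

Lemma poly_approxM c r g1 g2 : 0 <= r -> poly_approx c r g1 -> poly_approx c r g2 ->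
  poly_approx c r (fun z => g1 z * g2 z).
Proof.
move=> r0 h1 h2 e e0.
have [S S0 hS] := poly_approx_bound r0 h1.
have S1 : 0 < S + 1 by rewrite ltr_wpDl.
have [q hq] := h2 (e / 2 / (S + 1)) (divr_gt0 (divr_gt0 e0 (ltr0n _ 2)) S1).
have [Q Q0 hQ] := horner_bound q r0.
have Q1 : 0 < Q + 1 by rewrite ltr_wpDl.
have [p hp] := h1 (e / 2 / (Q + 1)) (divr_gt0 (divr_gt0 e0 (ltr0n _ 2)) Q1).
exists (p * q) => z zr.
rewrite hornerM (_ : _ - _ = (g1 z - p.[z - c]) * q.[z - c] + g1 z * (g2 z - q.[z - c]));
  last by ring.
rewrite (le_trans (le_normcD _ _)) // !normcM [leRHS]splitr lerD //.
  apply: (@le_trans _ _ (e / 2 / (Q + 1) * (Q + 1))); last by rewrite mulfVK // gt_eqF.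
  by apply: ler_pM; rewrite ?normc_ge0 ?hp // (le_trans (hQ _ zr)) // lerDl.
apply: (@le_trans _ _ ((S + 1) * (e / 2 / (S + 1)))); last by rewrite mulrC mulfVK // gt_eqF.
by apply: ler_pM; rewrite ?normc_ge0 ?hq // (le_trans (hS _ zr)) // lerDl.
Qed.

Lemma poly_approxN c r g : 0 <= r -> poly_approx c r g -> poly_approx c r (fun z => - g z).
Proof.
move=> r0 h; apply: (eq_poly_approx _ (poly_approxM r0 (poly_approx_cst c r (-1)) h)).
by move=> z _; rewrite mulN1r.
Qed.

Lemma poly_approxB c r g1 g2 : 0 <= r -> poly_approx c r g1 -> poly_approx c r g2 ->
  poly_approx c r (fun z => g1 z - g2 z).
Proof. by move=> r0 h1 h2; apply: poly_approxD => //; exact: poly_approxN. Qed.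

Lemma poly_approxX c r g n : 0 <= r -> poly_approx c r g ->
  poly_approx c r (fun z => g z ^+ n).
Proof.
move=> r0 h; elim: n => [|n IH].
  exact: (eq_poly_approx _ (poly_approx_cst c r 1)).
by apply: (eq_poly_approx _ (poly_approxM r0 h IH)) => z _; rewrite exprS.
Qed.

Lemma poly_approx_sum c r n (g : nat -> R[i] -> R[i]) :
  (forall i, poly_approx c r (g i)) ->
  poly_approx c r (fun z => \sum_(i < n) g i z).
Proof.
move=> h; elim: n => [|n IH].
  by apply: (eq_poly_approx _ (poly_approx_cst c r 0)) => z _; rewrite big_ord0.
by apply: (eq_poly_approx _ (poly_approxD IH (h n))) => z _; rewrite big_ord_recr.
Qed.

Lemma poly_approx_unif c r g : (forall e, 0 < e -> exists2 g', poly_approx c r g' &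
    forall z, normc (z - c) <= r -> normc (g z - g' z) <= e) ->
  poly_approx c r g.
Proof.
move=> H e e0; have e2 : 0 < e / 2 by rewrite divr_gt0.
have [g' /(_ _ e2)[p hp] hg] := H _ e2; exists p => z zr.
rewrite (_ : _ - _ = (g z - g' z) + (g' z - p.[z - c])); last by ring.
by rewrite (le_trans (le_normcD _ _)) // [leRHS]splitr lerD ?hp ?hg.
Qed.

Lemma geometric_remainder (x : R[i]) m : x != 1 ->
  (1 - x)^-1 = \sum_(i < m) x ^+ i + x ^+ m / (1 - x).
Proof.
move=> x1; have x1' : 1 - x != 0 by rewrite subr_eq0 eq_sym.
apply: (mulfI x1'); rewrite mulfV // mulrDr mulrCA mulfV // mulr1.
by rewrite -opprB mulNr -subrX1 opprB subrK.
Qed.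

Lemma poly_approx_geometric c r (q : R) g : 0 <= r -> q < 1 -> poly_approx c r g ->
  (forall z, normc (z - c) <= r -> normc (g z) <= q) ->
  poly_approx c r (fun z => (1 - g z)^-1).
Proof.
move=> r0 q1 hg gq; apply: poly_approx_unif => e e0.
have q0 : 0 <= q by apply: le_trans (gq c _); rewrite ?normc_ge0 // subrr normc0.
have [|m hm] := @geo_small q (1 - q)^-1 e _ e0; first by rewrite q0.
exists (fun z => \sum_(i < m) g z ^+ i).
  by apply: (@poly_approx_sum _ _ _ (fun i z => g z ^+ i)) => i; exact: poly_approxX.
move=> z zr; have gz := gq z zr.
have g1 : g z != 1.
  by apply/eqP => g1; move: gz; rewrite g1 normc1 leNgt q1.
rewrite (geometric_remainder m g1) addrAC subrr add0r normcM normcV normcX mulrC.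
apply: le_trans _ hm; apply: ler_pM; rewrite ?invr_ge0 ?normc_ge0 ?exprn_ge0 ?normc_ge0 //.
  have h : 1 - q <= normc (1 - g z).
    apply: le_trans _ (le_normc_dist _ _); rewrite normc1; lra.
  by rewrite lef_pV2 ?posrE ?subr_gt0 // (lt_le_trans _ h) // subr_gt0.
by rewrite lerXn2r // nnegrE ?normc_ge0.
Qed.

(** Replacing [g n] by a polynomial at distance at most [1 / (n + 1)] reduces the
    statement to polynomials. *)
Lemma vitali (g : nat -> R[i] -> R[i]) c r S (s1 : R) z : 0 < r -> 0 < s1 ->
  (forall n, poly_approx c r (g n)) ->
  (forall n z, normc (z - c) <= r -> normc (g n z) <= S) ->
  (forall s, 0 < s < s1 -> ccvg (fun n => g n (c + (0 +i* s))) 0) ->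
  normc (z - c) < r -> ccvg (g ^~ z) 0.
Proof.
move=> r0 s10 ga gS gs zr.
have inv0 n : 0 < n.+1%:R^-1 :> R by rewrite invr_gt0.
have [p hp] : {p : nat -> {poly R[i]} | forall n z, normc (z - c) <= r ->
    normc (g n z - (p n).[z - c]) <= n.+1%:R^-1}.
  have H n := cid (ga n _ (inv0 n)).
  by exists (fun n => sval (H n)) => n; exact: (svalP (H n)).
have pg w : normc (w - c) <= r -> ccvg (fun n => g n w - (p n).[w - c]) 0.
  move=> wr; apply/ccvg0P; apply: (cvg0_le _ (@cvg_harmonic R)) => n.
  by rewrite normc_ge0 /= hp.
have : ccvg (fun n => (p n).[z - c]) 0.
  have s2 : 0 < Num.min s1 r by rewrite lt_min s10.
  apply: (@vitali_poly p r (S + 1) (Num.min s1 r)) => //.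
    move=> n h hr; have hr' : normc ((c + h) - c) <= r by rewrite addrAC subrr add0r.
    have := hp n _ hr'; have := gS n _ hr'; rewrite [c + h - c]addrAC subrr add0r => h1 h2.
    rewrite (_ : (p n).[h] = g n (c + h) - (g n (c + h) - (p n).[h])); last by ring.
    apply: le_trans (le_normcB _ _) (lerD h1 (le_trans h2 _)).
    by rewrite invf_le1 // ler1n.
  move=> s /andP[s0]; rewrite lt_min => /andP[ss1 sr].
  have hr' : normc ((c + (0 +i* s)) - c) <= r.
    by rewrite addrAC subrr add0r /= expr0n /= add0r sqrtr_sqr ger0_norm // ltW.
  have ss : 0 < s < s1 by rewrite s0.
  have := ccvgB (gs s ss) (pg _ hr'); rewrite subrr; congr ccvg; apply/funext => n.
  by rewrite [c + _ - c]addrAC subrr add0r; ring.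
move=> h; have := ccvgD (pg z (ltW zr)) h; rewrite addr0.
by congr ccvg; apply/funext => n; rewrite subrK.
Qed.

End polynomials_on_discs.
(** * Right inverses of F near infinity *)

Section germs.
Context {R : realType}.
Implicit Types (mu nu rho : probability R R) (z w : R[i]) (K M eta t : R).

Local Notation G := (cauchy_transform (R := R)).

Lemma cauchy_transformE mu z : G mu z = cint mu (fun x => (z - x%:C)^-1).
Proof. by []. Qed.

Lemma cintegrable_resolvent mu z : 0 < complex.Im z ->
  cintegrable mu (fun x => (z - x%:C)^-1).
Proof.
move=> z0; apply: (cintegrable_le (cmeasurable_resolvent z) (h := cst (complex.Im z)^-1)).
  by move=> x; exact: normc_resolvent.
exact: Rintegrable_cst.
Qed.

Lemma normc_cauchy_le mu z : 0 < complex.Im z -> normc (G mu z) <= (complex.Im z)^-1.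
Proof.
move=> z0; rewrite cauchy_transformE -[leRHS](Rintegral_prob_cst mu).
apply: (normc_cint_le (cmeasurable_resolvent z)); first exact: Rintegrable_cst.
by move=> x; exact: normc_resolvent.
Qed.

Lemma normc_cone_ratio K z (x : R) : 0 < complex.Im z -> normc z <= K * complex.Im z ->
  normc (z / (z - x%:C)) <= K.
Proof.
move=> z0 zK; rewrite normcM normcV ler_pdivrMr; last by rewrite normc_gt0 subR_neq0.
apply: (le_trans zK); rewrite ler_wpM2l ?Im_le_normc_subR //.
have : 0 <= K * complex.Im z by apply: le_trans zK; exact: normc_ge0.
by rewrite pmulr_lge0.
Qed.

(** In a cone, the functions [x / (z - x)] are dominated by one function of
    arbitrarily small integral as soon as [z] is large. *)
Lemma cone_domination mu K e : 1 <= K -> 0 < e ->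
  exists M h, [/\ 0 < M, Rintegrable mu h, \int[mu]_x h x <= e &
    forall z x, 0 < complex.Im z -> normc z <= K * complex.Im z -> M < normc z ->
      normc (x%:C / (z - x%:C)) <= h x].
Proof.
move=> K1 e0; have K0 : 0 < K by apply: lt_le_trans K1.
pose h n (x : R) := Num.min (K * `|x| / n.+1%:R) (K + 1).
have hm n : measurable_fun setT (h n).
  apply: measurable_minr; last exact: measurable_cst.
  apply: measurable_funM; last exact: measurable_cst.
  apply: measurable_funM; first exact: measurable_cst.
  exact: normr_measurable.
have h0 n x : 0 <= h n x.
  by rewrite le_min !mulr_ge0 ?invr_ge0 ?(ltW K0) //= addr_ge0 // ltW.
have hK n x : `|h n x| <= K + 1 by rewrite ger0_norm // ge_min lexx orbT.
have : \int[mu]_x h n x @[n --> \oo] --> \int[mu]_x (cst 0 x : R).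
  apply: (Rintegral_cvg hm (measurable_cst _) (Rintegrable_cst mu (K + 1)) hK) => x.
  apply: (@cvg0_le _ _ (fun n => K * `|x| * n.+1%:R^-1)).
    by move=> n; rewrite h0 /= /h ge_min lexx.
  by rewrite -[X in _ --> X](mulr0 (K * `|x|)); apply: cvgMr; exact: cvg_harmonic.
rewrite Rintegral_prob_cst => /cvgr0Pnorm_le /(_ _ e0)[n _ /(_ n (leqnn n)) hn].
exists n.+1%:R, (h n); split => //.
- exact: (Rintegrable_le (hm n) (hK n) (Rintegrable_cst mu (K + 1))).
- exact: le_trans (ler_norm _) hn.
move=> z x z0 zK nz; rewrite le_min; apply/andP; split.
  rewrite normcM normcV normc_real.
  have zx : 0 < normc (z - x%:C) by rewrite normc_gt0 subR_neq0.
  rewrite ler_pdivrMr // -!mulrA [K * _]mulrCA.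
  rewrite -[leLHS]mulr1 ler_wpM2l //.
  rewrite mulrCA mulrC ler_pdivlMr // mul1r.
  apply: (le_trans (ltW nz)); apply: le_trans zK _.
  by rewrite ler_pM2l // Im_le_normc_subR.
have -> : x%:C / (z - x%:C) = z / (z - x%:C) - 1.
  have := subR_neq0 x z0 => zx0; apply: (mulIf zx0).
  by rewrite mulrBl !mulfVK // mul1r; ring.
apply: le_trans (le_normcB _ _) _; rewrite normc1 lerD2r.
exact: normc_cone_ratio.
Qed.

Lemma cmeasurable_xresolvent z : cmeasurable (fun x : R => x%:C / (z - x%:C)).
Proof. exact: cmeasurableM (cmeasurable_id) (cmeasurable_resolvent z). Qed.

Lemma xresolvent_bound z x : 0 < complex.Im z ->
  normc (x%:C / (z - x%:C)) <= normc z / complex.Im z + 1.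
Proof.
move=> z0; have -> : x%:C / (z - x%:C) = z / (z - x%:C) - 1.
  have := subR_neq0 x z0 => zx0; apply: (mulIf zx0).
  by rewrite mulrBl !mulfVK // mul1r; ring.
apply: le_trans (le_normcB _ _) _; rewrite normc1 lerD2r.
by apply: normc_cone_ratio => //; rewrite mulfVK // gt_eqF.
Qed.

Lemma cintegrable_xresolvent mu z : 0 < complex.Im z ->
  cintegrable mu (fun x => x%:C / (z - x%:C)).
Proof.
move=> z0; apply: (cintegrable_le (cmeasurable_xresolvent z)).
  by move=> x; exact: xresolvent_bound.
exact: Rintegrable_cst.
Qed.

Lemma zcauchy_transform mu z : 0 < complex.Im z ->
  z * G mu z = 1 + cint mu (fun x => x%:C / (z - x%:C)).
Proof.
move=> z0; rewrite cauchy_transformE -cintZ; last exact: cintegrable_resolvent.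
rewrite -[X in X + _](cint_cst mu) -cintD; first last.
- exact: cintegrable_xresolvent.
- exact: cintegrable_cst.
apply: eq_cint => x /=; have zx0 := subR_neq0 x z0.
by apply: (mulIf zx0); rewrite mulrDl !mulfVK // mul1r subrK.
Qed.

(** [G] is injective in a cone near infinity, because
    [z w (G w - G z) = (z - w) (1 + o(1))] there. *)
Lemma cauchy_transform_inj mu K : 1 <= K -> exists2 M, 0 < M &
  forall z w, 0 < complex.Im z -> normc z <= K * complex.Im z -> M < normc z ->
    0 < complex.Im w -> normc w <= K * complex.Im w -> M < normc w ->
    G mu z = G mu w -> z = w.
Proof.
move=> K1; have K0 : 0 < K by apply: lt_le_trans K1.
have e0 : 0 < (2 * (1 + K))^-1 by rewrite invr_gt0 mulr_gt0 // addr_gt0.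
have [M [h [M0 ih he hh]]] := cone_domination mu K1 e0.
exists M => // z w z0 zK zM w0 wK wM Gzw.
apply: contraTeq isT => zw /=.
have z0' := upper_neq0 z0; have w0' := upper_neq0 w0.
pose g (x : R) := z / (z - x%:C) * (w / (w - x%:C)).
have mg : cmeasurable g.
  by do ! apply: cmeasurableM => //; try exact: cmeasurable_resolvent;
     exact: cmeasurable_cst.
have gK x : normc (g x) <= K * K.
  by rewrite normcM ler_pM ?normc_ge0 // normc_cone_ratio.
have ig : cintegrable mu g := cintegrable_le mg gK (Rintegrable_cst mu _).
have I0 : cint mu g = 0.
  have : G mu w - G mu z = 0 by rewrite Gzw subrr.
  rewrite !cauchy_transformE -cintB; try exact: cintegrable_resolvent.
  rewrite (_ : cint _ _ = cint mu (fun x => ((z - w) / (z * w)) * g x)).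
    rewrite cintZ // => /eqP; rewrite mulf_eq0 => /orP[|/eqP //].
    by rewrite mulf_eq0 subr_eq0 (negPf zw) /= invr_eq0 mulf_eq0 (negPf z0') (negPf w0').
  apply: eq_cint => x; rewrite /g; have zx0 := subR_neq0 x z0; have wx0 := subR_neq0 x w0.
  by field; rewrite zx0 wx0 z0' w0'.
have : normc (cint mu (fun x => g x - 1)) <= \int[mu]_x ((1 + K) * h x).
  apply: normc_cint_le; first exact: cmeasurableB mg (cmeasurable_cst 1).
    exact: RintegrableZ.
  move=> x; rewrite (_ : g x - 1 = x%:C / (z - x%:C) + x%:C / (w - x%:C) * (z / (z - x%:C))).
    apply: le_trans (le_normcD _ _) _; rewrite mulrDl mul1r lerD ?hh //.
    by rewrite normcM mulrC ler_pM ?normc_ge0 ?hh // normc_cone_ratio.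
  rewrite /g; have zx0 := subR_neq0 x z0; have wx0 := subR_neq0 x w0.
  by field; rewrite zx0 wx0.
rewrite cintB //; last exact: cintegrable_cst.
rewrite I0 cint_cst sub0r normcN normc1 RintegralZl // => h1.
have : 1 <= (1 + K) * (2 * (1 + K))^-1.
  by apply: le_trans h1 _; rewrite ler_wpM2l // addr_ge0 // ltW.
rewrite invfM mulrCA mulfV ?mulr1; last by rewrite gt_eqF // addr_gt0.
by move=> h2; exfalso; lra.
Qed.

Lemma GammaP eta M z : Gamma eta M z <->
  [/\ 0 < complex.Im z, `|complex.Re z| < eta * complex.Im z & M < normc z].
Proof. by rewrite /Gamma /upper_half_plane /= normc_norm ltcR. Qed.

Lemma Gamma_le eta M eta' M' z : eta' <= eta -> M <= M' ->
  Gamma eta' M' z -> Gamma eta M z.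
Proof.
move=> he hM /GammaP[h1 h2 h3]; apply/GammaP; split => //.
  by apply: lt_le_trans h2 _; rewrite ler_wpM2r // ltW.
exact: le_lt_trans h3.
Qed.

Lemma F_right_inverse_le mu eta M eta' M' H : eta' <= eta -> M <= M' ->
  is_F_right_inverse mu eta M H -> is_F_right_inverse mu eta' M' H.
Proof.
move=> he hM [h1 h2]; split => [z|e e0]; first by move/(Gamma_le he hM); exact: h1.
by have [K hK] := h2 e e0; exists K => z /(Gamma_le he hM); exact: hK.
Qed.

(** As [H z / z] tends to 1, the values of [H] stay in a cone and go to infinity with
    [z], which is where [G] is injective. *)
Lemma F_right_inverse_cone mu eta M H : 0 < eta -> is_F_right_inverse mu eta M H ->
  exists2 M1, 0 < M1 & forall z, Gamma eta M1 z ->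
    [/\ 0 < complex.Im (H z), normc (H z) <= 3 * (1 + eta) * complex.Im (H z),
        normc z / 2 <= normc (H z) & G mu (H z) = z^-1].
Proof.
move=> eta0 [h1 h2].
have K0 : 0 < 1 + eta by rewrite addr_gt0.
have e0 : 0 < (2 * (1 + eta))^-1 by rewrite invr_gt0 mulr_gt0.
have [L hL] := h2 _ e0.
exists (Num.max 1 (Num.max M L)); first by rewrite lt_max ltr01.
move=> z hz; have [z0 zre zM] := (GammaP _ _ _).1 hz.
have zG : Gamma eta M z by apply: Gamma_le hz => //; rewrite !le_max lexx /= orbT.
have zL : L < normc z by apply: le_lt_trans zM; rewrite !le_max lexx /= !orbT.
have [Hz0 FHz] := h1 _ zG.
have := hL z zG; rewrite !normc_norm !ltcR => /(_ zL) hH.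
have zn0 : 0 < normc z by rewrite normc_gt0 upper_neq0.
have zK : normc z <= (1 + eta) * complex.Im z.
  apply: le_trans (normc_ReIm _) _; rewrite mulrDl mul1r addrC.
  by rewrite (gtr0_norm z0) lerD2l ltW.
have d : normc (H z - z) <= normc z / (2 * (1 + eta)).
  rewrite (_ : H z - z = (H z / z - 1) * z); last first.
    by rewrite mulrBl mulfVK ?mul1r // upper_neq0.
  by rewrite normcM mulrC ler_pM2l // ltW.
have d1 : normc (H z - z) <= complex.Im z / 2.
  apply: le_trans d _; rewrite ler_pdivrMr ?mulr_gt0 //.
  by apply: le_trans zK _; rewrite mulrA mulfVK // mulrC.
have d2 : normc (H z - z) <= normc z / 2.
  by apply: le_trans d1 _; rewrite ler_wpM2r // (le_trans (ler_norm _) (normc_Im _)).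
have Im_ge : complex.Im z / 2 <= complex.Im (H z).
  have := le_trans (normc_Im _) d1; rewrite ImD ImN ler_norml => /andP[h _].
  by move: h; rewrite lerBrDr; lra.
split => //.
- have : normc (H z) <= normc z + normc z / 2.
    rewrite (_ : H z = z + (H z - z)); last by rewrite addrC subrK.
    by apply: le_trans (le_normcD _ _) _; rewrite lerD2l.
  move=> h; apply: le_trans h _.
  have : (1 + eta) * (complex.Im z / 2) <= (1 + eta) * complex.Im (H z) by rewrite ler_pM2l.
  lra.
- have := le_normc_dist z (H z); rewrite normcB => h; lra.
- by rewrite -[in RHS]FHz /F_transform invrK.
Qed.

(** Both [H z] and [H' z] are preimages of [z^-1] under [G] in a common cone. *)
Lemma F_right_inverse_germ mu eta M H M' H' : 0 < eta ->
  is_F_right_inverse mu eta M H -> is_F_right_inverse mu eta M' H' ->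
  exists2 M1, 0 < M1 & forall z, Gamma eta M1 z -> H z = H' z.
Proof.
move=> eta0 h h'.
have [M1 M10 hM1] := F_right_inverse_cone eta0 h.
have [M2 M20 hM2] := F_right_inverse_cone eta0 h'.
have [|M3 M30 hM3] := @cauchy_transform_inj mu (3 * (1 + eta)); first lra.
exists (Num.max M1 (Num.max M2 (2 * M3))); first by rewrite lt_max M10.
move=> z hz.
have [|a1 a2 a3 a4] := hM1 z.
  by apply: Gamma_le hz => //; rewrite le_max lexx.
have [|b1 b2 b3 b4] := hM2 z.
  by apply: Gamma_le hz => //; rewrite !le_max lexx orbT.
have [_ _ zM] := (GammaP _ _ _).1 hz.
have zM3 : M3 < normc z / 2.
  rewrite ltr_pdivlMr // mulrC; apply: le_lt_trans zM.
  by rewrite !le_max lexx !orbT.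
by apply: hM3 => //; rewrite ?a4 ?b4 //; apply: lt_le_trans zM3 _.
Qed.

Lemma cauchy_transform_eq mu nu : (forall A, measurable A -> mu A = nu A) ->
  G mu =1 G nu.
Proof.
move=> mn z; rewrite /cauchy_transform /Rintegral.
have E f : (\int[mu]_x (f x)%:E = \int[nu]_x (f x)%:E)%E.
  by apply: eq_measure_integral => A mA _; exact: mn.
by rewrite !E.
Qed.

(** Voiculescu transforms add up along a convolution power. Each convolution comes with
    its own right inverses on its own domain; they are identified by the uniqueness of
    germs. *)
Lemma free_power_germ nu N mu : is_free_power nu N mu ->
  forall eta M H1 H2, 0 < eta ->
    is_F_right_inverse mu eta M H1 -> is_F_right_inverse nu eta M H2 ->
  exists eta' M', [/\ 0 < eta', 0 < M' & forall z, Gamma eta' M' z ->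
    H1 z - z = N%:R * (H2 z - z)].
Proof.
elim=> {N mu} [mu mn|N rho mu _ IH conv] eta M H1 H2 eta0 hH1 hH2.
  have hH1' : is_F_right_inverse nu eta M H1.
    case: hH1 => a b; split => // z /a [c d]; split => //.
    by rewrite -[RHS]d /F_transform (cauchy_transform_eq mn).
  have [M1 M10 h] := F_right_inverse_germ eta0 hH1' hH2.
  by exists eta, M1; split => // z /h ->; rewrite mul1r.
have [e1 [M1 [p1 [p2 [p3 [e10 M10 [K1 k1 pk1] [K2 k2 pk2] [[K3 k3 pk3] sum]]]]]]] := conv.
have [e2 [M2 [e20 M20 h12]]] := IH _ _ _ _ e10 k1 k2.
pose e' := Num.min eta (Num.min e1 e2).
have e'0 : 0 < e' by rewrite !lt_min eta0 e10.
have le_eta : e' <= eta by rewrite ge_min lexx.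
have le_e1 : e' <= e1 by rewrite !ge_min lexx orbT.
have le_e2 : e' <= e2 by rewrite !ge_min lexx !orbT.
have [M3 M30 g1] := F_right_inverse_germ e'0
  (F_right_inverse_le le_eta (lexx _) hH1) (F_right_inverse_le le_e1 (lexx _) k3).
have [M4 M40 g2] := F_right_inverse_germ e'0
  (F_right_inverse_le le_eta (lexx _) hH2) (F_right_inverse_le le_e1 (lexx _) k2).
pose M' := Num.max M1 (Num.max M2 (Num.max M3 M4)).
have M'0 : 0 < M' by rewrite lt_max M10.
have m1 : M1 <= M' by rewrite le_max lexx.
have m2 : M2 <= M' by rewrite !le_max lexx !orbT.
have m3 : M3 <= M' by rewrite !le_max lexx !orbT.
have m4 : M4 <= M' by rewrite !le_max lexx !orbT.
exists e', M'; split => // z hz.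
have hz1 := Gamma_le le_e1 m1 hz.
rewrite (g1 _ (Gamma_le (lexx _) m3 hz)) (g2 _ (Gamma_le (lexx _) m4 hz)).
rewrite -pk3 // sum // pk1 // pk2 // (h12 _ (Gamma_le le_e2 m2 hz)).
by rewrite -natr1; ring.
Qed.

(** The subordination function [om] of an [N]-fold free convolution power [mu] of
    [nu], for which [F_nu (om w) = F_mu w]. *)
Definition subord mu N w : R[i] :=
  F_transform mu w + (w - F_transform mu w) / N%:R.

(** Let [f = F w]. Both [w] and the right inverse of [F_mu] at [f] are preimages of [f]
    in a cone, hence equal; additivity of the Voiculescu transforms then says that [om]
    is the right inverse of [F_nu] at [f]. *)
Lemma free_power_subordination_near nu N mu : is_free_power nu N.+2 mu ->
  exists2 t0, 0 < t0 & forall t, t0 < t ->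
    0 < complex.Im (subord mu N.+2 (0 +i* t)) /\
    G nu (subord mu N.+2 (0 +i* t)) = G mu (0 +i* t).
Proof.
move=> hp; have conv : exists rho, is_free_convolution rho nu mu /\ is_free_power nu N.+1 rho.
  by inversion hp; subst; exists rho.
have [rho [[e1 [M1 [p1 [p2 [p3 [e10 M10 [K1 k1 pk1] [K2 k2 pk2] [[K3 k3 pk3] sum]]]]]]] _]] := conv.
have [e2 [M2 [e20 M20 h32]]] := free_power_germ hp e10 k3 k2.
pose e := Num.min e1 e2.
have e0 : 0 < e by rewrite lt_min e10.
have le1 : e <= e1 by rewrite ge_min lexx.
have le2 : e <= e2 by rewrite ge_min lexx orbT.
have [M3 M30 c3] := F_right_inverse_cone e0 (F_right_inverse_le le1 (lexx M1) k3).
have [M4 M40 c2] := F_right_inverse_cone e0 (F_right_inverse_le le1 (lexx M1) k2).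
have [|M5 M50 inj] := @cauchy_transform_inj mu (3 * (1 + e)); first lra.
(* [f] is within [4 / 3 * dl * t] of [w = i t], hence in the cone of opening [e]. *)
pose dl := e / (4 * (1 + e)).
have dl0 : 0 < dl by rewrite divr_gt0 // mulr_gt0 // addr_gt0.
have dl1 : dl <= 1 / 4 by rewrite ler_pdivrMr; lra.
have dle : 4 * dl * (1 + e) = e by rewrite /dl; field; lra.
have [M6 [h [M60 ih he hh]]] := cone_domination mu (lexx 1) dl0.
pose L := Num.max M2 (Num.max M3 (Num.max M4 M5)).
have l2 : M2 <= L by rewrite le_max lexx.
have l3 : M3 <= L by rewrite !le_max lexx !orbT.
have l4 : M4 <= L by rewrite !le_max lexx !orbT.
have l5 : M5 <= L by rewrite !le_max lexx !orbT.
have L0 : 0 < L by rewrite lt_max M20.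
exists (Num.max (4 * L) M6); first by rewrite lt_max M60 orbT.
move=> t; rewrite gt_max => /andP[tL tM6].
pose w : R[i] := 0 +i* t; pose f := F_transform mu w; pose om := subord mu N.+2 w.
rewrite -/w -/om.
have t0 : 0 < t by apply: lt_trans M60 tM6.
have w0 : 0 < complex.Im w by [].
have nw : normc w = t by rewrite /= expr0n /= add0r sqrtr_sqr gtr0_norm.
have w0' := upper_neq0 w0.
pose D := cint mu (fun x => x%:C / (w - x%:C)).
have nD : normc D <= dl.
  apply: le_trans (normc_cint_le (cmeasurable_xresolvent w) ih _) he.
  by move=> x; apply: hh; rewrite // ?nw //= mul1r.
have wG : w * G mu w = 1 + D by rewrite zcauchy_transform.
have D1 : 3 / 4 <= normc (1 + D).
  have := le_normc_dist 1 (- D); rewrite opprK normcN normc1 => h1; lra.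
have D0 : 1 + D != 0 by rewrite -normc_gt0; lra.
have fE : f = w / (1 + D).
  by rewrite /f /F_transform -wG invfM mulrA mulfV // mul1r.
have fw : normc (f - w) <= 4 / 3 * dl * t.
  rewrite fE (_ : _ - w = - (w * D / (1 + D))); last by field.
  rewrite normcN !normcM normcV nw -mulrA mulrC ler_wpM2r ?(ltW t0) //.
  rewrite ler_pdivrMr; last lra.
  have : 4 / 3 * dl * (3 / 4) <= 4 / 3 * dl * normc (1 + D) by rewrite ler_wpM2l //; lra.
  lra.
have fre : `|complex.Re f| <= 4 / 3 * dl * t.
  by have := le_trans (normc_Re _) fw; rewrite ReD ReN /= subr0.
have fim : t - 4 / 3 * dl * t <= complex.Im f.
  by have := le_trans (normc_Im _) fw; rewrite ImD ImN /= ler_norml => /andP[h1 _]; lra.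
have fn : t / 2 <= normc f.
  apply: le_trans _ (le_trans (ler_norm _) (normc_Im _)).
  have : dl * t <= 1 / 4 * t by rewrite ler_wpM2r // ltW.
  lra.
have fG : Gamma e L f.
  apply/GammaP; split; first by have : dl * t <= 1 / 4 * t; [rewrite ler_wpM2r // ltW|lra].
    apply: le_lt_trans fre _.
    apply: lt_le_trans (_ : e * (t - 4 / 3 * dl * t) <= _); last by rewrite ler_pM2l.
    have : 4 * dl * (1 + e) * t = e * t by rewrite dle.
    have : 0 < dl * t by rewrite mulr_gt0.
    have : 0 < e * dl * t by apply: mulr_gt0 => //; exact: mulr_gt0.
    lra.
  by apply: lt_le_trans fn; lra.
have f0 : f != 0 by rewrite fE mulf_neq0 // invr_eq0.
have [a1 a2 a3 a4] := c3 _ (Gamma_le (lexx _) l3 fG).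
have [b1 b2 b3 b4] := c2 _ (Gamma_le (lexx _) l4 fG).
have K3f : K3 f = w.
  apply: inj => //; rewrite ?nw ?a4 /f /F_transform ?invrK //.
  - by apply: (le_lt_trans l5); apply: lt_le_trans a3; lra.
  - rewrite /= ; have : 0 <= e * t by rewrite mulr_ge0 // ltW.
    lra.
  - lra.
have E := h32 _ (Gamma_le le2 l2 fG).
have -> : om = K2 f.
  rewrite /om /subord -/f -{1}K3f E [N.+2%:R * _]mulrC mulfK ?pnatr_eq0 //.
  by rewrite addrC subrK.
by rewrite b4 /f /F_transform invrK.
Qed.

End germs.
(** * The subordination identity on a fixed half-line *)

Section continuation.
Context {R : realType}.
Implicit Types (mu nu : probability R R) (z w c : R[i]) (r B : R).

Local Notation G := (cauchy_transform (R := R)).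

(** The values of [g] lie in a disc centred at [c0] inside the upper half-plane, so
    that the resolvents expand in powers of [g - c0] with a geometric remainder, uniformly
    in [x]. *)
Lemma poly_approx_cauchy nu c0 c r (rho : R) (g : R[i] -> R[i]) : 0 <= r ->
  rho < complex.Im c0 -> poly_approx c r g ->
  (forall z, normc (z - c) <= r -> normc (g z - c0) <= rho) ->
  poly_approx c r (fun z => G nu (g z)).
Proof.
move=> r0 rhoY hg gr; set Y := complex.Im c0.
have rho0 : 0 <= rho by apply: le_trans (gr c _); rewrite ?normc_ge0 // subrr normc0.
have Y0 : 0 < Y by apply: le_lt_trans rhoY.
have Yrho : 0 < Y - rho by rewrite subr_gt0.
apply: poly_approx_unif => e e0.
have [|m hm] := @geo_small R (rho / Y) (Y - rho)^-1 e _ e0.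
  by rewrite divr_ge0 ?(ltW Y0) // ltr_pdivrMr // mul1r.
pose gam (l : nat) := cint nu (fun x => (c0 - x%:C)^-1 ^+ l.+1).
exists (fun z => \sum_(l < m) (- (g z - c0)) ^+ l * gam l).
  apply: (@poly_approx_sum _ _ _ _ (fun l z => (- (g z - c0)) ^+ l * gam l)) => l.
  apply: poly_approxM => //; last exact: poly_approx_cst.
  apply: poly_approxX => //; apply: poly_approxN => //; apply: poly_approxB => //.
  exact: poly_approx_cst.
move=> z zr; have gz := gr z zr; set d := - (g z - c0).
have nd : normc d <= rho by rewrite normcN.
have Img : Y - rho <= complex.Im (g z).
  have := le_trans (normc_Im _) gz; rewrite ImD ImN -/Y ler_norml => /andP[h _]; lra.
have g0 : 0 < complex.Im (g z) by apply: lt_le_trans Img.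
pose h (x : R) := (g z - x%:C)^-1 * (c0 - x%:C)^-1 ^+ m.
have expand (x : R) : (g z - x%:C)^-1 =
    \sum_(l < m) d ^+ l * (c0 - x%:C)^-1 ^+ l.+1 + d ^+ m * h x.
  have u0 := subR_neq0 x Y0; have v0 := subR_neq0 x g0.
  have q1 : d / (c0 - x%:C) != 1.
    apply: contra v0 => /eqP q1; rewrite (_ : _ - _ = (c0 - x%:C) - d); last by rewrite /d; ring.
    by rewrite -[d](divfK u0) q1 mul1r subrr.
  have E : (g z - x%:C)^-1 = (c0 - x%:C)^-1 * (1 - d / (c0 - x%:C))^-1.
    rewrite -invfM; congr (_^-1).
    by rewrite mulrBr mulr1 mulrCA mulfV // mulr1 /d; ring.
  rewrite [LHS]E (geometric_remainder m q1) mulrDr mulr_sumr; congr (_ + _).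
    by apply: eq_bigr => l _; rewrite exprMn exprS; ring.
  by rewrite /h E exprMn; ring.
have mh : cmeasurable h.
  apply: cmeasurableM; first exact: cmeasurable_resolvent.
  by apply: cmeasurableX; exact: cmeasurable_resolvent.
have hb x : normc (h x) <= (Y - rho)^-1 * Y^-1 ^+ m.
  rewrite normcM normcX ler_pM ?exprn_ge0 ?normc_ge0 //.
    by apply: le_trans (normc_resolvent _ _) _ => //; rewrite lef_pV2 ?posrE.
  by rewrite lerXn2r ?nnegrE ?normc_ge0 ?invr_ge0 ?(ltW Y0) // normc_resolvent.
have ih := cintegrable_le mh hb (Rintegrable_cst nu _).
have igam l : cintegrable nu (fun x => (c0 - x%:C)^-1 ^+ l.+1).
  apply: (cintegrable_le (h := cst (Y^-1 ^+ l.+1))); last exact: Rintegrable_cst.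
    by apply: cmeasurableX; exact: cmeasurable_resolvent.
  move=> x; rewrite normcX lerXn2r ?nnegrE ?normc_ge0 ?invr_ge0 ?(ltW Y0) //.
  exact: normc_resolvent.
have [is1 es1] := cint_sum (n := m) (fun l _ => cintegrableZ (d ^+ l) (igam l)).
rewrite cauchy_transformE (eq_cint _ expand) cintD //; last exact: cintegrableZ.
rewrite es1 cintZ //.
rewrite (eq_bigr (fun l : 'I_m => d ^+ l * gam l)); last by move=> l _; rewrite cintZ.
rewrite addrAC subrr add0r normcM normcX.
apply: le_trans _ hm; rewrite expr_div_n -exprVn mulrC mulrCA mulrC.
rewrite ler_pM ?normc_ge0 ?exprn_ge0 ?normc_ge0 //.
  by rewrite lerXn2r ?nnegrE ?normc_ge0.
rewrite -[leRHS](Rintegral_prob_cst nu).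
by apply: normc_cint_le => //; exact: Rintegrable_cst.
Qed.

Lemma abs_moment_le mu B : has_moment mu 2 -> moment mu 2 <= B -> 1 <= B ->
  Rintegrable mu (fun x => `|x|) /\ \int[mu]_x `|x| <= B.
Proof.
move=> h2 m2B B1.
have ih : Rintegrable mu (fun x => 2^-1 * (1 + x ^+ 2)).
  by apply: RintegrableZ; apply: RintegrableD => //; exact: Rintegrable_cst.
have hx (x : R) : `|x| <= 2^-1 * (1 + x ^+ 2).
  have := sqr_ge0 (`|x| - 1); rewrite sqrrB real_normK ?num_real // => h; lra.
have mabs : measurable_fun setT (fun x : R => `|x|) by exact: normr_measurable.
have iabs : Rintegrable mu (fun x => `|x|).
  by apply: Rintegrable_le ih => // x; rewrite normr_id.
split => //; apply: (@le_trans _ _ (\int[mu]_x (2^-1 * (1 + x ^+ 2)))).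
  exact: le_Rintegral.
rewrite RintegralZl //; last by apply: RintegrableD => //; exact: Rintegrable_cst.
rewrite RintegralD //; last exact: Rintegrable_cst.
rewrite Rintegral_prob_cst; move: m2B; rewrite /moment => m2B; lra.
Qed.

(** In [w * G w = 1 + \int x / (w - x)] the integral is at most a first moment over
    [Im w]; multiplying it once more by [w] brings in the second moment. *)
Lemma F_transform_estimates mu B w : has_moment mu 2 -> moment mu 2 <= B -> 1 <= B ->
  8 * B <= complex.Im w ->
  [/\ normc (w * G mu w - 1) <= 1 / 8, w * G mu w != 0 &
      normc (F_transform mu w - w) <= 2 * B].
Proof.
move=> h2 m2B B1 Bw.
have [iabs absB] := abs_moment_le h2 m2B B1.
have w0 : 0 < complex.Im w by lra.
have w0' := upper_neq0 w0.
set D := cint mu (fun x => x%:C / (w - x%:C)).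
have wG : w * G mu w = 1 + D by rewrite zcauchy_transform.
have Imi : (complex.Im w)^-1 <= (8 * B)^-1 by rewrite lef_pV2 ?posrE //; lra.
have Bi : B * (8 * B)^-1 = 1 / 8 by field; lra.
have Bi1 : (8 * B)^-1 <= 1 / 8 by rewrite -[leRHS]Bi -[leLHS]mul1r ler_wpM2r // invr_ge0; lra.
have B8 : 0 < (8 * B)^-1 by rewrite invr_gt0; lra.
have nD : normc D <= 1 / 8.
  apply: (@le_trans _ _ (\int[mu]_x ((complex.Im w)^-1 * `|x|))).
    apply: normc_cint_le; first exact: cmeasurable_xresolvent.
      exact: RintegrableZ.
    by move=> x; rewrite normcM normc_real mulrC ler_wpM2r // normc_resolvent.
  rewrite RintegralZl // -[leRHS]Bi mulrC ler_pM ?invr_ge0 ?(ltW w0) //.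
  exact: Rintegral_ge0.
have wD : normc (w * D) <= 9 / 8 * B.
  have E x : w * (x%:C / (w - x%:C)) = x%:C + x%:C ^+ 2 / (w - x%:C).
    by have wx0 := subR_neq0 x w0; field.
  have mw : cmeasurable (fun x : R => w * (x%:C / (w - x%:C))).
    by apply: cmeasurableM; [exact: cmeasurable_cst|exact: cmeasurable_xresolvent].
  rewrite /D -cintZ; last exact: cintegrable_xresolvent.
  apply: (@le_trans _ _ (\int[mu]_x (`|x| + (complex.Im w)^-1 * x ^+ 2))).
    apply: normc_cint_le => //; first by apply: RintegrableD => //; exact: RintegrableZ.
    move=> x; rewrite E; apply: le_trans (le_normcD _ _) _; rewrite normc_real lerD2l.
    rewrite normcM normcX normc_real mulrC real_normK ?num_real //.
    by rewrite ler_wpM2r ?sqr_ge0 // normc_resolvent.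
  rewrite RintegralD //; last exact: RintegrableZ.
  rewrite RintegralZl //.
  have : (complex.Im w)^-1 * moment mu 2 <= (8 * B)^-1 * B.
    apply: ler_pM => //; first by rewrite invr_ge0 ltW.
    by apply: Rintegral_ge0 => x _; rewrite sqr_ge0.
  rewrite mulrC [X in _ <= X]mulrC Bi mulrC /moment => h; lra.
have D1 : 7 / 8 <= normc (1 + D).
  have := le_normc_dist 1 (- D); rewrite opprK normcN normc1 => h1; lra.
have D0 : 1 + D != 0 by rewrite -normc_gt0; lra.
split; rewrite ?wG //; first by rewrite addrAC subrr add0r.
have -> : F_transform mu w - w = - (w * D / (1 + D)).
  have -> : F_transform mu w = w / (1 + D).
    by rewrite /F_transform -wG invfM mulrA mulfV // mul1r.
  by field.
rewrite normcN normcM normcV ler_pdivrMr; last lra.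
by nra.
Qed.

Lemma subord_estimates mu N B w : has_moment mu 2 -> moment mu 2 <= B -> 1 <= B ->
  8 * B <= complex.Im w -> (0 < N)%N ->
  normc (subord mu N w - w) <= 2 * B /\ complex.Im w - 2 * B <= complex.Im (subord mu N w).
Proof.
move=> h2 m2B B1 Bw N0; have [_ _ h] := F_transform_estimates h2 m2B B1 Bw.
have n0 : (N%:R : R[i]) != 0 by rewrite pnatr_eq0 -lt0n.
have h1 : normc (subord mu N w - w) <= 2 * B.
  have -> : subord mu N w - w = (1 - N%:R^-1)%:C * (F_transform mu w - w).
    rewrite /subord rmorphB /= rmorph1 fmorphV rmorph_nat.
    by field.
  rewrite normcM normc_real; apply: le_trans _ h.
  rewrite -[leRHS]mul1r ler_wpM2r ?normc_ge0 // ger0_norm.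
    by rewrite gerBl invr_ge0.
  by rewrite subr_ge0 invf_le1 ?ltr0n // ler1n.
split => //; have := le_trans (normc_Im _) h1; rewrite ImD ImN ler_norml => /andP[h3 _].
lra.
Qed.

(** Both sides of the subordination identity are analytic in a half-plane which
    depends only on a bound of the second moment of [mu]; a disc centred far up the
    imaginary axis reaches every point of the axis above that bound. *)
Lemma free_power_subordination nu N mu B (t : R) : is_free_power nu N.+2 mu ->
  has_moment mu 2 -> moment mu 2 <= B -> 1 <= B -> 8 * B < t ->
  G nu (subord mu N.+2 (0 +i* t)) = G mu (0 +i* t).
Proof.
move=> hp h2 m2B B1 Bt.
have [t0 t00 ht0] := free_power_subordination_near hp.
(* Just above [c] the identity is known since [Y > t0]; the disc of radius [r] reaches
   down to the height [8 B], below [t]. *)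
pose Y := Num.max t0 t + 1; pose c : R[i] := 0 +i* Y; pose r := Y - 8 * B.
have Yt0 : t0 < Y by rewrite /Y; apply: (@le_lt_trans _ _ (Num.max t0 t)); [rewrite le_max lexx|rewrite ltrDl].
have Yt : t < Y by rewrite /Y; apply: (@le_lt_trans _ _ (Num.max t0 t)); [rewrite le_max lexx orbT|rewrite ltrDl].
have r0 : 0 < r by rewrite /r; lra.
have disc_Im z : normc (z - c) <= r -> 8 * B <= complex.Im z.
  move=> h; have := le_trans (normc_Im _) h; rewrite ImD ImN /= /r ler_norml => /andP[h3 _].
  lra.
have aG : poly_approx c r (G mu).
  apply: (@poly_approx_cauchy mu c c r r id) => //; [exact: ltW| |exact: poly_approx_id].
  by rewrite /r /=; lra.
have aF : poly_approx c r (F_transform mu).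
  have a1 : poly_approx c r (fun z => z * (1 - (1 - z * G mu z))^-1).
    apply: poly_approxM; [exact: ltW|exact: poly_approx_id|].
    apply: (@poly_approx_geometric _ _ _ (1 / 8)); [exact: ltW|lra| |].
      apply: poly_approxB; [exact: ltW|exact: poly_approx_cst|].
      by apply: poly_approxM => //; [exact: ltW|exact: poly_approx_id].
    by move=> z /disc_Im zB; rewrite normcB; have [] := F_transform_estimates h2 m2B B1 zB.
  apply: (eq_poly_approx _ a1) => z /disc_Im zB.
  have z0 : z != 0 by apply: upper_neq0; lra.
  rewrite opprB addrCA subrr addr0 /F_transform invfM mulrA mulfV // mul1r //.
have aS : poly_approx c r (subord mu N.+2).
  apply: poly_approxD => //; apply: poly_approxM; [exact: ltW| |exact: poly_approx_cst].
  by apply: poly_approxB => //; [exact: ltW|exact: poly_approx_id].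
have aGS : poly_approx c r (fun z => G nu (subord mu N.+2 z)).
  apply: (@poly_approx_cauchy nu c c r (r + 2 * B)) => //; [exact: ltW|rewrite /r /=; lra|].
  move=> z zr; have zB := disc_Im z zr.
  have [h _] := subord_estimates h2 m2B B1 zB (ltn0Sn N.+1).
  rewrite (_ : _ - c = (z - c) + (subord mu N.+2 z - z)); last by ring.
  exact: le_trans (le_normcD _ _) (lerD zr h).
have aP : poly_approx c r (fun z => G nu (subord mu N.+2 z) - G mu z).
  by apply: poly_approxB => //; exact: ltW.
have [S S0 hS] := poly_approx_bound (ltW r0) aP.
have tr : normc ((0 +i* t) - c) < r.
  rewrite -[_ - c]/((0 - 0) +i* (t - Y)) subrr /= expr0n /= add0r sqrtr_sqr.
  by rewrite ltr0_norm /r; lra.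
have := vitali r0 ltr01 (fun=> aP) (fun=> hS) _ tr => /(_ _)/(ccvg_unique (ccvg_cst _)).
move=> h; apply/eqP; rewrite -subr_eq0; apply/eqP; apply: h => s /andP[s0 s1].
have -> : c + (0 +i* s) = 0 +i* (Y + s) by rewrite -[LHS]/((0 + 0) +i* (Y + s)) addr0.
have [_ ->] := ht0 (Y + s) ltac:(lra).
by rewrite subrr; exact: ccvg_cst.
Qed.

End continuation.
(** * Asymptotic expansions along the imaginary axis *)

Section expansions.
Context {R : realType}.
Context (T : R) (T0 : 0 < T).
Implicit Types (p q : {poly R}) (g h : nat -> R[i]).

Definition axis (n : nat) : R[i] := 0 +i* (n%:R + T).

Lemma Im_axis_gt0 n : 0 < complex.Im (axis n).
Proof. by rewrite /= ltr_wpDl. Qed.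

Lemma axis_neq0 n : axis n != 0.
Proof. by apply: upper_neq0; exact: Im_axis_gt0. Qed.

Lemma normc_axis n : normc (axis n) = n%:R + T.
Proof.
by rewrite /= expr0n /= add0r sqrtr_sqr ger0_norm // ltW // ltr_wpDl.
Qed.

Lemma cvg_axis_inv : ccvg (fun n => (axis n)^-1) 0.
Proof.
apply/ccvg0P/(@cvg0_le _ _ (fun n => (1 + T^-1) * n.+1%:R^-1)).
  move=> n; rewrite normc_ge0 normcV normc_axis.
  have n0 : 0 < n%:R + T by rewrite ltr_wpDl.
  rewrite ler_pdivlMr ?ltr0n // mulrC ler_pdivrMr //.
  have : 0 <= T^-1 * n%:R by rewrite mulr_ge0 // invr_ge0 ltW.
  have : T^-1 * T = 1 by rewrite mulVf // gt_eqF.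
  by rewrite -natr1 !mulrDl mul1r mulrDr => -> h; move: T0; lra.
by rewrite -[X in _ --> X](mulr0 (1 + T^-1)); apply: cvgMr; exact: cvg_harmonic.
Qed.

Lemma ccvg_horner (p : {poly R[i]}) (u : nat -> R[i]) l : ccvg u l ->
  ccvg (fun n => p.[u n]) p.[l].
Proof.
move=> ul; under eq_fun do rewrite horner_coef; rewrite horner_coef.
apply: ccvg_sum => i.
by apply: ccvgM; [exact: ccvg_cst | exact: ccvgX].
Qed.

Definition hornerC_axis p n : R[i] := (map_poly (real_complex R) p).[(axis n)^-1].

Lemma cvg_horner_axis p : ccvg (hornerC_axis p) (p`_0)%:C.
Proof.
have := ccvg_horner (map_poly (real_complex R) p) cvg_axis_inv.
by rewrite horner_coef0 coef_map.
Qed.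

(** [g] has the asymptotic expansion [p] in powers of [1 / w], up to [o(w^-K)],
    where [w] runs along the imaginary axis. *)
Definition expansion K g p := ccvg (fun n => axis n ^+ K * (g n - hornerC_axis p n)) 0.

Lemma expansion_cvg_sub K g p : expansion K g p -> ccvg (fun n => g n - hornerC_axis p n) 0.
Proof.
move=> /(ccvgM (ccvgX K cvg_axis_inv)); rewrite mulr0; congr ccvg; apply/funext => n.
by rewrite exprVn mulKf // expf_neq0 // axis_neq0.
Qed.

Lemma expansion_cvg K g p : expansion K g p -> ccvg g (p`_0)%:C.
Proof.
move=> /expansion_cvg_sub /ccvgD /(_ (cvg_horner_axis p)); rewrite add0r.
by congr ccvg; apply/funext => n; rewrite subrK.
Qed.

Lemma expansionB K g h p q : expansion K g p -> expansion K h q ->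
  expansion K (fun n => g n - h n) (p - q).
Proof.
move=> e1 e2; have := ccvgB e1 e2; rewrite subr0; congr ccvg; apply/funext => n.
by rewrite /hornerC_axis rmorphB hornerD hornerN /=; ring.
Qed.

Lemma expansionD K g h p q : expansion K g p -> expansion K h q ->
  expansion K (fun n => g n + h n) (p + q).
Proof.
move=> e1 e2; have := ccvgD e1 e2; rewrite addr0; congr ccvg; apply/funext => n.
by rewrite /hornerC_axis rmorphD hornerD /=; ring.
Qed.

Lemma expansionM K g h p q : expansion K g p -> expansion K h q ->
  expansion K (fun n => g n * h n) (p * q).
Proof.
move=> e1 e2.
have := ccvgD (ccvgM e1 (expansion_cvg e2)) (ccvgM (cvg_horner_axis p) e2).
rewrite mul0r mulr0 addr0; congr ccvg; apply/funext => n.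
by rewrite /hornerC_axis rmorphM hornerM /=; ring.
Qed.

Lemma expansion_horner K p : expansion K (hornerC_axis p) p.
Proof.
rewrite /expansion; under eq_fun do rewrite subrr mulr0; exact: ccvg_cst.
Qed.

Lemma expansion_cst K (a : R) : expansion K (fun=> a%:C) a%:P.
Proof.
have := expansion_horner K a%:P; congr expansion; apply/funext => n.
by rewrite /hornerC_axis map_polyC hornerC.
Qed.

Lemma expansion_modXn K g p q s : expansion K g p -> p = q + 'X^(K.+1) * s ->
  expansion K g q.
Proof.
move=> e pq; have := ccvgD e (ccvgM cvg_axis_inv (cvg_horner_axis s)).
rewrite mul0r addr0; congr ccvg; apply/funext => n.
have w0 := axis_neq0 n.
have -> : hornerC_axis p n = hornerC_axis q n + (axis n)^-1 ^+ K.+1 * hornerC_axis s n.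
  by rewrite pq /hornerC_axis rmorphD rmorphM /= map_polyXn hornerD hornerM hornerXn.
rewrite opprD addrA mulrBr exprSr mulrA mulrCA mulrA.
by rewrite exprVn mulVf ?expf_neq0 // mul1r subrK.
Qed.

(** Removing the leading term and multiplying by [w] costs one order of precision. *)
Lemma expansion_shift K g p : expansion K.+1 g p ->
  expansion K (fun n => axis n * (g n - (p`_0)%:C)) (drop_poly 1 p).
Proof.
rewrite /expansion; congr ccvg; apply/funext => n; have w0 := axis_neq0 n.
have -> : hornerC_axis p n = (p`_0)%:C + (axis n)^-1 * hornerC_axis (drop_poly 1 p) n.
  have {1}-> : p = (p`_0)%:P + 'X * drop_poly 1 p.
    by apply/polyP => -[|i]; rewrite coefD coefC coefXM ?coef_drop_poly //= ?addr0 // add0r addn1.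
  by rewrite /hornerC_axis rmorphD rmorphM /= map_polyC map_polyX hornerD hornerM hornerX hornerC.
by rewrite exprSr; field.
Qed.

Lemma expansionW K g p : expansion K.+1 g p -> expansion K g p.
Proof.
move=> /(ccvgM cvg_axis_inv); rewrite mulr0; congr ccvg; apply/funext => n.
by rewrite exprS !mulrA mulVf ?axis_neq0 // mul1r.
Qed.

Lemma expansion_le K K' g p : (K' <= K)%N -> expansion K g p -> expansion K' g p.
Proof.
by move=> /subnK <-; elim: (K - K')%N => // k IH; rewrite addSn => /expansionW.
Qed.

(** The inverse of [p] modulo ['X^(K + 1)], when [p] has constant term 1. *)
Definition inv_modXn K p : {poly R} := \sum_(l < K.+1) (1 - p) ^+ l.

Lemma mul_inv_modXn K p : p`_0 = 1 -> exists s, p * inv_modXn K p = 1 + 'X^(K.+1) * s.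
Proof.
move=> p0; exists (- (drop_poly 1 (1 - p)) ^+ K.+1).
have e : 1 - p = 'X * drop_poly 1 (1 - p).
  apply/polyP => -[|i]; rewrite coefXM ?coef_drop_poly ?addn1 //.
  by rewrite coefB coef1 p0 subrr.
have := subrX1 (1 - p) K.+1; rewrite [1 - p - 1]addrAC subrr add0r mulNr.
rewrite -/(inv_modXn K p) => /(congr1 -%R); rewrite opprK => <-.
by rewrite {1}e exprMn opprB mulrN.
Qed.

Lemma near_eq_ccvg (u v : nat -> R[i]) l : (\forall n \near \oo, u n = v n) ->
  ccvg u l -> ccvg v l.
Proof.
move=> uv; rewrite /ccvg => h; apply: cvg_trans h.
by apply: near_eq_cvg; near=> n; congr (normc (_ - _)); near: n.
Unshelve. all: by end_near.
Qed.

Lemma expansionV K g p : p`_0 = 1 -> expansion K g p ->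
  expansion K (fun n => (g n)^-1) (inv_modXn K p).
Proof.
move=> p0 e; have [s hs] := mul_inv_modXn K p0.
have := expansionM e (expansion_horner K (inv_modXn K p)).
rewrite hs => /expansion_modXn /(_ erefl) e1.
have gl := expansion_cvg e; rewrite p0 in gl.
have l0 : (1 : R)%:C != 0 by rewrite -normc_gt0 normc1.
have nl0 : - (1 : R)%:C != 0 by rewrite oppr_eq0.
have := ccvgM e1 (ccvgV nl0 (ccvgN gl)); rewrite mul0r.
apply: near_eq_ccvg; have := ccvg_neq0 gl l0; apply: filterS => n gn.
have -> : hornerC_axis 1 n = 1 by rewrite /hornerC_axis rmorph1 hornerC.
by field.
Qed.

End expansions.

(** * Moments and expansions of Cauchy transforms *)

Section moments.
Context {R : realType}.
Implicit Types (mu nu : probability R R) (w : R[i]).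

Local Notation G := (cauchy_transform (R := R)).

Lemma measurable_absX j : measurable_fun setT (fun x : R => `|x| ^+ j).
Proof. by apply: measurable_funX; exact: normr_measurable. Qed.

Lemma has_moment_abs mu j : has_moment mu j <-> Rintegrable mu (fun x => `|x| ^+ j).
Proof.
split => h.
  apply: (Rintegrable_le (h := fun x => `|x ^+ j|)); first exact: measurable_absX.
    by move=> x; rewrite normrX normr_id -normrX.
  exact: (integrable_norm h).
apply: (@Rintegrable_le _ mu (fun x => x ^+ j) (fun x => `|x| ^+ j)) => //.
by move=> x; rewrite normrX.
Qed.

Lemma has_moment0 mu : has_moment mu 0.
Proof.
by apply: (Rintegrable_le (h := cst 1)) (Rintegrable_cst mu 1) => // x; rewrite expr0 normr1.
Qed.

Lemma moment0 mu : moment mu 0 = 1.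
Proof. by rewrite /moment; under eq_Rintegral do rewrite expr0; rewrite Rintegral_prob_cst. Qed.

Lemma has_moment_le mu i j : (i <= j)%N -> has_moment mu j -> has_moment mu i.
Proof.
move=> ij /has_moment_abs hj; apply/has_moment_abs.
apply: (Rintegrable_le (h := fun x => 1 + `|x| ^+ j)); first exact: measurable_absX.
  move=> x; rewrite normrX normr_id; have [x1|x1] := leP `|x| 1.
    apply: (@le_trans _ _ 1); first by rewrite exprn_ile1.
    by rewrite lerDl exprn_ge0.
  apply: (@le_trans _ _ (`|x| ^+ j)); last by rewrite lerDr.
  by rewrite ler_weXn2l // ltW.
by apply: RintegrableD => //; exact: Rintegrable_cst.
Qed.

(** The remainder of order [j] in the expansion of [w * G w]. *)
Definition resolvent_moment mu j w : R[i] :=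
  cint mu (fun x => x%:C ^+ j * (x%:C / (w - x%:C))).

Lemma cmeasurable_xX j : cmeasurable (fun x : R => x%:C ^+ j).
Proof. by apply: cmeasurableX; exact: cmeasurable_id. Qed.

Lemma cmeasurable_resolvent_moment j w :
  cmeasurable (fun x : R => x%:C ^+ j * (x%:C / (w - x%:C))).
Proof. exact: cmeasurableM (cmeasurable_xX j) (cmeasurable_xresolvent w). Qed.

Lemma cintegrable_resolvent_moment mu j w : has_moment mu j -> 0 < complex.Im w ->
  cintegrable mu (fun x => x%:C ^+ j * (x%:C / (w - x%:C))).
Proof.
move=> /has_moment_abs hj w0.
apply: (cintegrable_le (cmeasurable_resolvent_moment j w)
  (h := fun x => (normc w / complex.Im w + 1) * `|x| ^+ j)).
  move=> x; rewrite normcM normcX normc_real mulrC ler_wpM2r ?exprn_ge0 //.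
  exact: xresolvent_bound.
exact: RintegrableZ.
Qed.

Lemma cintegrable_xX mu j : has_moment mu j -> cintegrable mu (fun x => x%:C ^+ j).
Proof.
move=> h; under eq_fun do rewrite -rmorphXn; exact: cintegrable_real.
Qed.

Lemma cint_xX mu j : cint mu (fun x => x%:C ^+ j) = (moment mu j)%:C.
Proof. by under eq_cint do rewrite -rmorphXn; rewrite cint_real. Qed.

Lemma resolvent_momentS mu j w : has_moment mu j.+1 -> 0 < complex.Im w ->
  w * resolvent_moment mu j w = (moment mu j.+1)%:C + resolvent_moment mu j.+1 w.
Proof.
move=> h w0; have hj := has_moment_le (leqnSn j) h.
rewrite /resolvent_moment -cintZ; last exact: cintegrable_resolvent_moment.
rewrite -cint_xX -cintD; [|exact: cintegrable_xX|exact: cintegrable_resolvent_moment].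
apply: eq_cint => x; have wx0 := subR_neq0 x w0.
by rewrite exprSr; field.
Qed.

(** Dominated convergence: in a cone [x / (om - x)] is bounded, and it tends to zero. *)
Lemma resolvent_moment_cvg0 mu j (om : nat -> R[i]) (K : R) : has_moment mu j ->
  (forall n, normc (om n) <= K * complex.Im (om n)) ->
  (forall n, n.+1%:R <= complex.Im (om n)) ->
  ccvg (fun n => resolvent_moment mu j (om n)) 0.
Proof.
move=> hj omK omn; have om0 n : 0 < complex.Im (om n) by apply: lt_le_trans (omn n).
have hj' := (has_moment_abs mu j).1 hj.
pose f n (x : R) := `|x| ^+ j * normc (x%:C / (om n - x%:C)).
have mf n : measurable_fun setT (f n).
  apply: measurable_funM; first exact: measurable_absX.
  by apply: measurable_normc; exact: cmeasurable_xresolvent.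
have f0 n x : 0 <= f n x by rewrite mulr_ge0 ?exprn_ge0 ?normc_ge0.
have fb n x : `|f n x| <= (K + 1) * `|x| ^+ j.
  rewrite ger0_norm // /f mulrC ler_wpM2r ?exprn_ge0 //.
  apply: le_trans (xresolvent_bound _ (om0 n)) _.
  by rewrite lerD2r ler_pdivrMr.
apply/ccvg0P/(@cvg0_le _ _ (fun n => \int[mu]_x f n x)).
  move=> n; rewrite normc_ge0 /=; apply: normc_cint_le.
  - exact: cmeasurable_resolvent_moment.
  - by apply: Rintegrable_le (mf n) (fb n) _; exact: RintegrableZ.
  - by move=> x; rewrite normcM normcX normc_real.
rewrite -[X in _ --> X](Rintegral_prob_cst mu).
apply: (Rintegral_cvg mf (measurable_cst _) _ fb); first exact: RintegrableZ.
move=> x; apply: (@cvg0_le _ _ (fun n => `|x| ^+ j.+1 * n.+1%:R^-1)).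
  move=> n; rewrite f0 /f exprSr -mulrA ler_wpM2l ?exprn_ge0 //=.
  rewrite normcM normc_real ler_wpM2l //.
  apply: le_trans (normc_resolvent _ (om0 n)) _.
  by rewrite lef_pV2 ?posrE ?ltr0n.
by rewrite -[X in _ --> X](mulr0 (`|x| ^+ j.+1)); apply: cvgMr; exact: cvg_harmonic.
Qed.

Definition moment_poly K mu : {poly R} := \poly_(l < K.+1) moment mu l.

Lemma cauchy_expansion_axis mu K w : has_moment mu K -> 0 < complex.Im w ->
  w * G mu w = \sum_(l < K.+1) (moment mu l)%:C * w^-1 ^+ l +
     w^-1 ^+ K * resolvent_moment mu K w.
Proof.
move=> hK w0; have w0' := upper_neq0 w0; elim: K hK => [|K IH] hK.
  rewrite big_ord1 expr0 mul1r mulr1 moment0 zcauchy_transform //; congr (_ + _).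
  by apply: eq_cint => x; rewrite expr0 mul1r.
rewrite IH; last exact: has_moment_le hK.
rewrite [in RHS]big_ord_recr /= -addrA; congr (_ + _).
by rewrite [X in X + _]mulrC -mulrDr -resolvent_momentS // exprSr; field.
Qed.

Lemma cauchy_expansion mu K T : 1 <= T -> has_moment mu K ->
  expansion T K (fun n => axis T n * G mu (axis T n)) (moment_poly K mu).
Proof.
move=> T1 hK; have T0 : 0 < T by apply: lt_le_trans T1.
have h : ccvg (fun n => resolvent_moment mu K (axis T n)) 0.
  apply: (@resolvent_moment_cvg0 mu K (axis T) 1 hK).
    by move=> n; rewrite mul1r normc_axis.
  by move=> n /=; rewrite -natr1 lerD2l.
rewrite /expansion; move: h; congr ccvg; apply/funext => n.
have w0 := Im_axis_gt0 T0 n; have w0' := upper_neq0 w0.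
rewrite (cauchy_expansion_axis hK w0) /hornerC_axis.
rewrite (_ : map_poly _ _ = \poly_(l < K.+1) (moment mu l)%:C); last first.
  by apply/polyP => i; rewrite coef_map !coef_poly; case: ifP.
rewrite horner_poly addrAC subrr add0r mulrA exprVn mulfV ?mul1r //.
by rewrite expf_neq0.
Qed.

(** Fatou's lemma, the source of the finiteness of the moments of free roots. *)
Lemma Rintegrable_fatou mu (f_ : nat -> R -> R) (f : R -> R) (C : R) :
  (forall n x, 0 <= f_ n x) -> measurable_fun setT f ->
  (forall n, Rintegrable mu (f_ n)) -> (forall n, \int[mu]_x f_ n x <= C) ->
  (forall x, f_ ^~ x @ \oo --> f x) -> Rintegrable mu f.
Proof.
move=> f0 mf fi fC ff; apply/integrableP; split; first exact/measurable_EFinP.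
have h := @fatou _ _ _ mu setT measurableT (fun n => EFin \o f_ n)
  (fun n => measurable_int _ (fi n)) (fun n x _ => f0 n x).
have e x : limn_einf (fun n => (EFin \o f_ n) x) = (f x)%:E.
  apply: (cvg_limn_einf_sup _).1.
  by apply/fine_cvgP; split; [exact: nearW | exact: ff].
have ge0f x : 0 <= f x.
  by apply: (cvgr_to_ge (ff x)); exact: nearW.
have -> : (\int[mu]_x `|(EFin \o f) x| = \int[mu]_x (limn_einf (fun n => (EFin \o f_ n) x)))%E.
  by apply: eq_integral => x _; rewrite e /= ger0_norm.
apply: (le_lt_trans h); rewrite limn_einf_lim; apply: (@le_lt_trans _ _ C%:E); last exact: ltry.
apply: lime_le; first exact: is_cvg_einfs.
apply: nearW => n; apply: (@le_trans _ _ (\int[mu]_x (EFin \o f_ n) x)%E).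
  by apply: ereal_inf_lbound; exists n => /=.
have fn := integrable_fin_num measurableT (fi n).
by rewrite -(fineK fn) lee_fin; exact: fC.
Qed.

End moments.
(** * Moments of free convolution roots *)

Section root_moments.
Context {R : realType}.

Local Notation G := (cauchy_transform (R := R)).

(** Expansions in [1 / w] of the functions [N * \int x^j om / (om - x) dnu], where
    [nu] is the [N]-th free root of a law with moment polynomial [p] and [eps = 1 / N];
    the constant terms are the moments of [nu] scaled by [N]. *)
Fixpoint root_poly (eps : R) K (p : {poly R}) (j : nat) : {poly R} :=
  if j is j'.+1 then
    drop_poly 1 (root_poly eps K p j') * ((1 + eps%:P * (p - 1)) * inv_modXn K p)
  else p.

Lemma ccvg_bounded (u : nat -> R[i]) l : ccvg u l -> exists C, forall n, normc (u n) <= C.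
Proof.
move=> /cvgP/cvg_seq_bounded/pinfty_ex_gt0[C C0 /= hC].
exists (C + normc l) => n; rewrite -[u n](subrK l).
apply: le_trans (le_normcD _ _) _; rewrite lerD2r.
by have := hC n I; rewrite ger0_norm ?normc_ge0.
Qed.

Section subordinated.
Context (mu nu : probability R R) (N K : nat) (T : R) (om : nat -> R[i]).
Context (N0 : (0 < N)%N) (T1 : 1 <= T) (hK : has_moment mu K).
Let w := axis T.
Let M n := w n * G mu (w n).
Let eps := (N%:R : R)^-1.
Let p := moment_poly K mu.
Let B := root_poly eps K p.
Let q j := (B j)`_0.
Context (M_neq0 : forall n, M n != 0).
Context (omE : forall n, om n = subord mu N (w n)).
Context (Gom : forall n, G nu (om n) = G mu (w n)).
Context (om_cone : forall n, normc (om n) <= 2 * complex.Im (om n)).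
Context (Im_om : forall n, n.+1%:R <= complex.Im (om n)).
Context (om_le : forall n, normc (om n) <= 2 * normc (w n)).

Let T0 : 0 < T. Proof. exact: lt_le_trans T1. Qed.
Let w0 n : 0 < complex.Im (w n). Proof. exact: Im_axis_gt0. Qed.
Let om0 n : 0 < complex.Im (om n). Proof. by apply: lt_le_trans (Im_om n). Qed.

(** The functions of [w] whose expansions are the [root_poly]; the invariant [inv] below
    identifies them with integrals with respect to [nu]. *)
Fixpoint root_seq (j : nat) (n : nat) : R[i] :=
  if j is j'.+1 then om n * (root_seq j' n - (q j')%:C) else M n.

Let epsC : eps%:C = (N%:R : R[i])^-1.
Proof. by rewrite /eps fmorphV rmorph_nat. Qed.

Let omM n : om n = w n * ((1 + eps%:C * (M n - 1)) / M n).
Proof.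
have w0' := upper_neq0 (w0 n); have := M_neq0 n.
rewrite omE /subord /F_transform epsC /M mulf_eq0 negb_or => /andP[_ G0].
have n0 : (N%:R : R[i]) != 0 by rewrite pnatr_eq0 -lt0n.
by field; rewrite w0' G0 n0.
Qed.

Let p0 : p`_0 = 1.
Proof. by rewrite coef_poly /= moment0. Qed.

Lemma root_seq_expansion j : (j <= K)%N -> expansion T (K - j) (root_seq j) (B j).
Proof.
have eM : expansion T K M p by exact: cauchy_expansion.
have eL : expansion T K (fun n => (1 + eps%:C * (M n - 1)) / M n)
    ((1 + eps%:P * (p - 1)) * inv_modXn K p).
  apply: expansionM => //; last exact: expansionV.
  have e1 := expansion_cst T K (1 : R).
  by apply: (expansionD e1); apply: (expansionM T0 (expansion_cst T K eps)); exact: expansionB.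
elim: j => [|j IH] jK; first by rewrite subn0.
have := IH (ltnW jK); rewrite (_ : K - j = (K - j.+1).+1)%N; last by rewrite subnSK.
move=> /(expansion_shift T0) => e1.
have := expansionM T0 e1 (expansion_le T0 (leq_subr j.+1 K) eL).
congr expansion; apply/funext => n.
by rewrite /= -/(w n) omM; ring.
Qed.

Let inv j := has_moment nu j /\
  forall n, root_seq j n - (q j)%:C = N%:R * resolvent_moment nu j (om n).

Let inv0 : inv 0.
Proof.
split => [|n]; first exact: has_moment0.
have := zcauchy_transform nu (om0 n); rewrite Gom => h.
have -> : resolvent_moment nu 0 (om n) = om n * G mu (w n) - 1.
  rewrite h addrAC subrr add0r; apply: eq_cint => x.
  by rewrite expr0 mul1r.
have n0 : (N%:R : R[i]) != 0 by rewrite pnatr_eq0 -lt0n.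
have w0' := upper_neq0 (w0 n); have := M_neq0 n; rewrite mulf_eq0 negb_or => /andP[_ G0].
rewrite /= /q /B /= p0 omM epsC /M.
by field; rewrite w0' G0 n0.
Qed.

Let invS j : (j.+1 <= K)%N -> inv j -> has_moment nu j.+1 ->
  inv j.+1 /\ N%:R * moment nu j.+1 = q j.+1.
Proof.
move=> jK [hj cj] hj1.
have E n : root_seq j.+1 n = N%:R * ((moment nu j.+1)%:C + resolvent_moment nu j.+1 (om n)).
  by rewrite /= cj mulrCA resolvent_momentS.
have l1 : ccvg (root_seq j.+1) (N%:R * (moment nu j.+1))%:C.
  have := ccvgM (ccvg_cst N%:R) (ccvgD (ccvg_cst (moment nu j.+1)%:C)
    (resolvent_moment_cvg0 hj1 om_cone Im_om)).
  rewrite addr0 rmorphM rmorph_nat; congr ccvg; apply/funext => n.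
  by rewrite E.
have l2 := expansion_cvg T0 (root_seq_expansion jK).
have /(congr1 (@complex.Re R)) /= eq := ccvg_unique l1 l2.
split=> //; split => // n.
by rewrite /q -eq E rmorphM rmorph_nat; ring.
Qed.

(** The imaginary part of [\int x^(j + 1) om / (om - x) dnu] is, up to sign,
    [Im om * \int x^(j + 2) / |om - x|^2 dnu]; a real first order expansion makes it
    [O(1 / |w|)], which bounds the moment of order [j + 2] by Fatou's lemma. *)
Let moment_step j : ~~ odd j -> (j.+2 <= K)%N -> inv j -> has_moment nu j.+2.
Proof.
move=> evj jK [hj cj].
have jK1 : (j.+1 <= K)%N := ltnW jK.
have := root_seq_expansion jK1; rewrite (_ : K - j.+1 = (K - j.+2).+1)%N; last by rewrite subnSK.
move=> e1; have := @expansion_le _ _ T0 (K - j.+2).+1 1 _ _ isT e1.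
move=> /(expansion_shift T0)/(expansion_cvg T0)/ccvg_bounded[C hC].
pose g n (x : R) := om n * (x%:C ^+ j * (x%:C / (om n - x%:C))).
pose h n (x : R) := x ^+ j.+2 * complex.Im (om n) / normc (om n - x%:C) ^+ 2.
have ge x : 0 <= x ^+ j.+2 :> R by apply: exprn_even_ge0; rewrite /= negbK.
have hg n x : h n x = -1 * complex.Im (g n x).
  have -> : g n x = (x ^+ j.+1)%:C * (1 + x%:C * (om n - x%:C)^-1).
    have := subR_neq0 x (om0 n) => u0.
    by rewrite /g rmorphXn exprSr; field.
  rewrite ImM /= mul0r addr0 ImD ImM /= mul0r addr0 add0r ImVE Im_subR /h exprSr; ring.
have ig n : cintegrable nu (g n).
  by apply: cintegrableZ; exact: cintegrable_resolvent_moment.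
have ih n : Rintegrable nu (h n).
  by rewrite /Rintegrable (funext (hg n)); apply: RintegrableZ; exact: (ig n).2.
have Inth n : N%:R * \int[nu]_x h n x = - complex.Im (root_seq j.+1 n).
  under eq_Rintegral do rewrite hg.
  rewrite RintegralZl //; last exact: (ig n).2.
  have -> : root_seq j.+1 n = (N%:R : R)%:C * cint nu (g n).
    rewrite rmorph_nat /g cintZ; last exact: cintegrable_resolvent_moment.
    by rewrite /= cj mulrCA.
  rewrite ImM [complex.Re _%:C]/= [complex.Im _%:C]/= mul0r addr0.
  by rewrite mulN1r mulrN.
have C0 : 0 <= C by apply: le_trans (hC 0%N); exact: normc_ge0.
have wn n : 0 < normc (w n) by rewrite normc_gt0 upper_neq0.
have h0 n x : 0 <= h n x.
  by rewrite /h divr_ge0 ?exprn_ge0 ?normc_ge0 // mulr_ge0 // ltW.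
have Inth_le n : \int[nu]_x h n x <= C / normc (w n).
  apply: (@le_trans _ _ (N%:R * \int[nu]_x h n x)).
    rewrite -[leLHS]mul1r ler_wpM2r ?ler1n //.
    by apply: Rintegral_ge0 => x _.
  rewrite Inth; apply: le_trans (ler_norm _) _; rewrite normrN.
  rewrite ler_pdivlMr // mulrC; apply: le_trans (hC n).
  rewrite normcM ler_wpM2l ?normc_ge0 //.
  by apply: le_trans _ (normc_Im _); rewrite ImD ImN /= subr0.
pose f n (x : R) := `|x| ^+ j.+2 / 4 * ((1 + `|x| * n.+1%:R^-1)^-1) ^+ 2.
have pos1 n (x : R) : 0 < 1 + `|x| * n.+1%:R^-1 by rewrite ltr_wpDr // mulr_ge0.
have f0 n x : 0 <= f n x.
  by rewrite /f mulr_ge0 ?divr_ge0 ?exprn_ge0 // invr_ge0 ltW.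
have mf n : measurable_fun setT (f n).
  apply: measurable_funM.
    by apply: measurable_funM => //; exact: measurable_absX.
  apply: measurable_funX; apply: measurable_inv_fun; apply: measurable_funD => //.
  by apply: measurable_funM => //; exact: normr_measurable.
have fh n x : f n x <= complex.Im (om n) * h n x.
  have u0 : 0 < normc (om n - x%:C) by rewrite normc_gt0 subR_neq0.
  have i0 := om0 n.
  rewrite /f /h -normrX (ger0_norm (ge x)).
  rewrite (_ : complex.Im (om n) * _ = x ^+ j.+2 *
     (complex.Im (om n) / normc (om n - x%:C)) ^+ 2); last by rewrite expr_div_n; ring.
  rewrite -mulrA ler_wpM2l //.
  rewrite (_ : 4^-1 * _ = ((2 * (1 + `|x| * n.+1%:R^-1))^-1) ^+ 2); last first.
    by rewrite invfM exprMn; congr (_ * _); field.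
  rewrite lerXn2r ?nnegrE ?invr_ge0 ?divr_ge0 ?(ltW i0) ?(ltW u0) //.
  rewrite ler_pdivlMr // mulrC ler_pdivrMr ?mulr_gt0 //.
  have xa : `|x| <= complex.Im (om n) * (`|x| * n.+1%:R^-1).
    rewrite mulrCA -[leLHS]mulr1 ler_wpM2l // ler_pdivlMr ?mul1r ?ltr0n //.
  have xa0 : 0 <= complex.Im (om n) * (`|x| * n.+1%:R^-1) by apply: le_trans xa.
  have := le_normcB (om n) x%:C; rewrite normc_real.
  have := om_cone n.
  have -> : complex.Im (om n) * (2 * (1 + `|x| * n.+1%:R^-1)) =
      2 * complex.Im (om n) + 2 * (complex.Im (om n) * (`|x| * n.+1%:R^-1)) by ring.
  move: xa xa0; set y := complex.Im (om n) * (`|x| * _) => xa xa0 h1 h2; lra.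
have iF n : Rintegrable nu (fun x => complex.Im (om n) * h n x) by exact: RintegrableZ.
have fi n : Rintegrable nu (f n).
  by apply: Rintegrable_le (mf n) _ (iF n) => x; rewrite ger0_norm.
have fC n : \int[nu]_x f n x <= 2 * C.
  apply: (@le_trans _ _ (\int[nu]_x (complex.Im (om n) * h n x))); first exact: Rintegral_mono (fi n) (iF n) (fh n).
  rewrite RintegralZl //; last exact: ih.
  have Iw : complex.Im (om n) <= 2 * normc (w n).
    by apply: le_trans (om_le n); apply: le_trans (normc_Im _); exact: ler_norm.
  apply: (@le_trans _ _ (2 * normc (w n) * (C / normc (w n)))).
    by apply: ler_pM => //; [exact: ltW | apply: Rintegral_ge0 => x _].
  by rewrite mulrACA mulfV ?mulr1 // gt_eqF.
have : Rintegrable nu (fun x => `|x| ^+ j.+2 / 4).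
  apply: (Rintegrable_fatou f0 _ fi fC).
    by apply: measurable_funM => //; exact: measurable_absX.
  move=> x; rewrite -[X in _ --> X]mulr1; apply: cvgMr.
  have l1 : (1 + `|x| * n.+1%:R^-1)^-1 @[n --> \oo] --> (1 : R).
    rewrite -[X in _ --> X]invr1; apply: cvgV => //.
    rewrite -[X in _ --> X]addr0; apply: cvgD; first exact: cvg_cst.
    rewrite -[X in _ --> X](mulr0 `|x|); apply: cvgMr; exact: cvg_harmonic.
  under eq_fun do rewrite expr2.
  rewrite [X in nbhs X](_ : 1 = 1 * 1); last by rewrite mulr1.
  exact: (cvgM l1 l1).
move=> /(RintegrableZ 4) h4; apply/has_moment_abs.
by move: h4; congr Rintegrable; apply/funext => x; rewrite mulrC divfK.
Qed.

Let inv_even m : (2 * m <= K)%N -> inv (2 * m).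
Proof.
elim: m => [|m IH] mK; first by rewrite muln0.
have e : (2 * m.+1 = (2 * m).+2)%N by rewrite mulnS.
rewrite e in mK *; have i0 := IH (ltnW (ltnW mK)).
have od : ~~ odd (2 * m) by rewrite oddM.
have h2 := moment_step od mK i0.
have [i1 _] := invS (ltnW mK) i0 (has_moment_le (leqnSn _) h2).
by have [] := invS mK i1 h2.
Qed.

Lemma subordinated_moments m j : (2 * m <= K)%N -> (0 < j <= 2 * m)%N ->
  has_moment nu j /\ N%:R * moment nu j = q j.
Proof.
move=> mK /andP[j0 jm]; have [hm _] := inv_even mK.
have hj := has_moment_le jm hm; split => //.
have H : forall i, (i <= 2 * m)%N -> inv i.
  elim => [|i IH] im; first exact: inv0.
  have [] // := invS (leq_trans im mK) (IH (ltnW im)) (has_moment_le im hm).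
case: j j0 jm hj => // j _ jm hj.
by have [] := invS (leq_trans jm mK) (H j (ltnW jm)) hj.
Qed.

End subordinated.

(** The expansions are taken along [w = i (n + T)], where [T] depends on a bound of the
    second moment of [mu] in such a way that the subordination identity holds. *)
Lemma free_root_moments (mu nu : probability R R) N m j : is_free_power nu N.+2 mu ->
  (0 < m)%N -> has_moment mu (2 * m) -> (0 < j <= 2 * m)%N ->
  has_moment nu j /\
  N.+2%:R * moment nu j = (root_poly N.+2%:R^-1 (2 * m) (moment_poly (2 * m) mu) j)`_0.
Proof.
move=> hp m0 hm jm.
have h2 : has_moment mu 2 by apply: has_moment_le hm; rewrite leq_pmulr.
pose B := 1 + `|moment mu 2|; pose T := 8 * B + 1.
have B1 : 1 <= B by rewrite lerDl.
have mB : moment mu 2 <= B by apply: le_trans (ler_norm _) _; rewrite lerDr.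
have T1 : 1 <= T by rewrite /T; lra.
have T0 : 0 < T by lra.
have Bw n : 8 * B < complex.Im (axis T n) by rewrite /= /T; have : 0 <= n%:R :> R by []; lra.
have est n := subord_estimates h2 mB B1 (ltW (Bw n)) (ltn0Sn N.+1).
have nle n : normc (subord mu N.+2 (axis T n)) <= normc (axis T n) + 2 * B.
  have [e1 _] := est n; rewrite -[subord _ _ _](subrK (axis T n)) addrC.
  by apply: le_trans (le_normcD _ _) _; rewrite lerD2l.
have Ge n : G nu (subord mu N.+2 (axis T n)) = G mu (axis T n).
  by apply: (free_power_subordination hp h2 mB B1); exact: Bw.
apply: (@subordinated_moments mu nu N.+2 (2 * m) T
  (fun n => subord mu N.+2 (axis T n))) => // n.
- by have [] := F_transform_estimates h2 mB B1 (ltW (Bw n)).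
- have [e1 e2] := est n; have := Bw n; have := nle n; rewrite normc_axis //= in e2 *; lra.
- have [e1 e2] := est n; move: e2; rewrite /= -natr1 /T; lra.
- by have := Bw n; have := nle n; rewrite normc_axis //=; lra.
Qed.

End root_moments.
(** * Non-crossing partitions *)

Section noncrossing.
Import mathcomp.boot.fintype mathcomp.boot.finset.
Local Close Scope classical_set_scope.
Local Open Scope set_scope.
Context {n : nat}.
Implicit Types (D V W A : {set 'I_n}) (p q : {set {set 'I_n}}) (x y u v : 'I_n).

(** [NC] relative to a subset of the points, so that the ground set can be cut. *)
Definition NCD D : {set {set {set 'I_n}}} :=
  [set p | finset.partition p D &&
    [forall V in p, forall W in p, (V != W) ==> ~~ crossing V W]]%SET.

Lemma crossingP V W : reflect (exists a b c d, [/\ a \in V, b \in W, c \in V & d \in W] /\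
   [/\ (a < b)%N, (b < c)%N & (c < d)%N]) (crossing V W).
Proof.
apply: (iffP existsP) => [[a /andP[aV /existsP[b /andP[bW /existsP[c /andP[cV /existsP[d]]]]]]]|].
  by move=> /andP[dW /and3P[h1 h2 h3]]; exists a, b, c, d.
move=> [a [b [c [d [[aV bW cV dW] [h1 h2 h3]]]]]]; exists a; rewrite aV /=.
apply/existsP; exists b; rewrite bW; apply/existsP; exists c; rewrite cV.
by apply/existsP; exists d; rewrite dW h1 h2 h3.
Qed.

(** Elementwise form of the membership in [NCD], against which the partitions built below
    are checked. *)
Definition nc_spec p D := [/\
  (forall W, W \in p -> W != set0 /\ W \subset D),
  (forall u, u \in D -> exists2 W, W \in p & u \in W),
  (forall W W' u, W \in p -> W' \in p -> u \in W -> u \in W' -> W = W') &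
  (forall V W a b c d, V \in p -> W \in p -> a \in V -> b \in W -> c \in V -> d \in W ->
     (a < b)%N -> (b < c)%N -> (c < d)%N -> V = W)].

Lemma NCDP p D : reflect (nc_spec p D) (p \in NCD D).
Proof.
rewrite inE; apply: (iffP andP) => [[pD /forall_inP nc]|[h1 h2 h3 h4]].
  have /and3P[/eqP cov /trivIsetP tr /negP n0] := pD; split.
  - move=> W Wp; split; first by apply/eqP => W0; apply: n0; rewrite -W0.
    by rewrite -cov; exact: bigcup_sup.
  - by move=> u; rewrite -cov => /bigcupP[W Wp uW]; exists W.
  - move=> W W' u Wp Wp' uW uW'; apply/eqP; apply/negPn/negP => WW'.
    by have /disjointFr/(_ uW) := tr _ _ Wp Wp' WW'; rewrite uW'.
  - move=> V W a b c d Vp Wp aV bW cV dW ab bc cd; apply/eqP; apply/negPn/negP => VW.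
    have /forall_inP/(_ _ Wp)/implyP/(_ VW)/negP := nc _ Vp.
    by apply; apply/crossingP; exists a, b, c, d.
split.
  apply/and3P; split.
  - apply/eqP/setP => u; apply/bigcupP/idP => [[W Wp uW]|/h2[W Wp uW]]; last by exists W.
    by have [_ /subsetP/(_ _ uW)] := h1 _ Wp.
  - apply/trivIsetP => A B Ap Bp AB; rewrite disjoints_subset; apply/subsetP => u uA.
    by rewrite inE; apply: contra AB => uB; rewrite (h3 A B u).
  - by apply/negP => /h1[]; rewrite eqxx.
apply/forall_inP => V Vp; apply/forall_inP => W Wp; apply/implyP => VW.
apply: contra VW => /crossingP[a [b [c [d [[aV bW cV dW] [ab bc cd]]]]]].
by apply/eqP; apply: (h4 V W a b c d).
Qed.

Lemma nc_pblock p D W u : nc_spec p D -> W \in p -> u \in W -> pblock p u = W.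
Proof.
move=> h Wp uW; apply: def_pblock => //.
by have /NCDP := h; rewrite inE => /andP[/and3P[]].
Qed.

(** Empty when [s] is, in accordance with its only partition having no block. *)
Definition head_block (s : seq 'I_n) p := if s is y :: _ then pblock p y else set0.

Section gluing.
Context (x : 'I_n) (s1 s2 : seq 'I_n).
Context (srt : sorted (fun i j : 'I_n => (i < j)%N) (x :: s1 ++ s2)).

Let D1 := [set z in s1].
Let D2 := [set z in s2].
Let D := [set z in x :: s1 ++ s2].

Let pw : pairwise (fun i j : 'I_n => (i < j)%N) (x :: s1 ++ s2).
Proof. by rewrite -sorted_pairwise // => a b c; exact: ltn_trans. Qed.

Let x1 u : u \in D1 -> (x < u)%N.
Proof.
rewrite inE => us; move: pw; rewrite pairwise_cons => /andP[/allP h _].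
by apply: h; rewrite mem_cat us.
Qed.

Let x2 u : u \in D2 -> (x < u)%N.
Proof.
rewrite inE => us; move: pw; rewrite pairwise_cons => /andP[/allP h _].
by apply: h; rewrite mem_cat us orbT.
Qed.

Let h12 u v : u \in D1 -> v \in D2 -> (u < v)%N.
Proof.
rewrite !inE => us vs; move: pw.
by rewrite pairwise_cons pairwise_cat => /and4P[_ /allrelP h _ _]; apply: h.
Qed.

Let head_min y t v : s2 = y :: t -> v \in D2 -> v != y -> (y < v)%N.
Proof.
move=> e; rewrite inE e in_cons => /orP[->//|vt] _; move: pw.
rewrite pairwise_cons pairwise_cat e pairwise_cons.
by case/and5P => _ _ _ /allP/(_ _ vt).
Qed.

Let memD u : (u \in D) = [|| u == x, u \in D1 | u \in D2].
Proof. by rewrite !inE mem_cat. Qed.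

Let x_notin1 : x \notin D1. Proof. by apply/negP => /x1; rewrite ltnn. Qed.
Let x_notin2 : x \notin D2. Proof. by apply/negP => /x2; rewrite ltnn. Qed.
Let disj12 u : u \in D1 -> u \in D2 -> False.
Proof. by move=> a b; have := h12 a b; rewrite ltnn. Qed.

(** The sequence [s1] consists of the points strictly between [x] and the second point of
    its block, which is the head of [s2]; [s2] is empty when the block is [{x}]. *)
Definition first_split p :=
  (p \in NCD D) && ([disjoint pblock p x & D1] && (if s2 is y :: _ then y \in pblock p x else true)).

(** Adds [x] to the first block of the partition of [s2]; [cut] is the inverse. *)
Definition glue (pq : {set {set 'I_n}} * {set {set 'I_n}}) :=
  let V := head_block s2 pq.2 in
  pq.1 :|: ((x |: V) |: (pq.2 :\ V)).

Definition cut p :=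
  let V := pblock p x :\ x in
  ([set W in p | W \subset D1],
   [set W in p | W \subset D2] :|: (if V == set0 then set0 else [set V])).

Let head_cases q : nc_spec q D2 ->
  (D2 = set0 /\ head_block s2 q = set0 /\ q = set0) \/
  (exists y, [/\ y \in D2, (forall v, v \in D2 -> v != y -> (y < v)%N),
     head_block s2 q \in q, y \in head_block s2 q &
     (if s2 is z :: _ then z == y else false)]).
Proof.
move=> h; rewrite /head_block; case e: s2 => [|y t].
  have D0 : D2 = set0 by apply/setP => u; rewrite !inE e.
  left; split=> //; split => //; apply/setP => W; rewrite inE; apply/negP => Wq.
  have [h1 _ _ _] := h; have [W0] := h1 _ Wq.
  by rewrite D0 subset0 (negPf W0).
right; exists y; have yD : y \in D2 by rewrite inE e mem_head.
have [h1 h2 h3 h4] := h; have [W Wq yW] := h2 _ yD.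
rewrite (nc_pblock h Wq yW); split => // v; exact: head_min e.
Qed.

Section glue_nc.
Context (p q : {set {set 'I_n}}) (hp : nc_spec p D1) (hq : nc_spec q D2).
Let V := head_block s2 q.

Let memg W : W \in glue (p, q) -> [\/ W \in p, W = x |: V | W \in q /\ W != V].
Proof.
rewrite !inE /= -/V => /or3P[h|/eqP h|/andP[h1 h2]]; [exact: Or31|exact: Or32|exact: Or33].
Qed.

Let mem_x u : u \in x |: V -> u = x \/ (u \in V /\ u \in D2 /\ V \in q).
Proof.
rewrite in_setU1 => /orP[/eqP ->|uV]; [by left|right].
have [[_ [V0 _]]|[y [_ _ Vq _ _]]] := head_cases hq.
  by move: uV; rewrite /V V0 inE.
by have [h1 _ _ _] := hq; have [_ /subsetP/(_ _ uV)] := h1 _ Vq.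
Qed.

Let in1 W u : W \in p -> u \in W -> u \in D1.
Proof. by have [h1 _ _ _] := hp => Wp uW; have [_ /subsetP/(_ _ uW)] := h1 _ Wp. Qed.
Let in2 W u : W \in q -> u \in W -> u \in D2.
Proof. by have [h1 _ _ _] := hq => Wp uW; have [_ /subsetP/(_ _ uW)] := h1 _ Wp. Qed.

Lemma glue_nc_spec : nc_spec (glue (p, q)) D.
Proof.
have [p1 p2 p3 p4] := hp; have [q1 q2 q3 q4] := hq; split.
- move=> W /memg[Wp|->|[Wq _]].
  + have [W0 /subsetP s] := p1 _ Wp; split => //; apply/subsetP => u /s us.
    by rewrite memD us orbT.
  + split; first by apply/set0Pn; exists x; rewrite setU11.
    by apply/subsetP => u /mem_x[->|[_ [us _]]]; rewrite memD ?eqxx // us !orbT.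
  + have [W0 /subsetP s] := q1 _ Wq; split => //; apply/subsetP => u /s us.
    by rewrite memD us !orbT.
- move=> u; rewrite memD => /or3P[/eqP ->|/p2[W Wp uW]|/q2[W Wq uW]].
  + by exists (x |: V); rewrite ?setU11 // !inE /= -/V eqxx !orbT.
  + by exists W => //; rewrite inE /= Wp.
  + have [WV|WV] := eqVneq W V.
      by exists (x |: V); rewrite ?in_setU1 -?WV ?uW ?orbT // !inE /= -/V WV eqxx !orbT.
    by exists W => //; rewrite !inE /= -/V WV Wq !orbT.
- move=> W W' u /memg[Wp|->|[Wq WV]] /memg[Wp'|->|[Wq' WV']] uW uW'.
  + exact: p3 uW uW'.
  + have := in1 Wp uW; case: (mem_x uW') => [->|[_ [u2 _]] u1].
      by rewrite (negPf x_notin1).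
    by case: (disj12 u1 u2).
  + by case: (disj12 (in1 Wp uW) (in2 Wq' uW')).
  + have := in1 Wp' uW'; case: (mem_x uW) => [->|[_ [u2 _]] u1].
      by rewrite (negPf x_notin1).
    by case: (disj12 u1 u2).
  + by [].
  + case: (mem_x uW) => [ux|[uV [_ Vq]]].
      by have := in2 Wq' uW'; rewrite ux (negPf x_notin2).
    by move: WV'; rewrite (q3 W' V u) // eqxx.
  + by case: (disj12 (in1 Wp' uW') (in2 Wq uW)).
  + case: (mem_x uW') => [ux|[uV [_ Vq]]].
      by have := in2 Wq uW; rewrite ux (negPf x_notin2).
    by move: WV; rewrite (q3 W V u) // eqxx.
  + exact: q3 uW uW'.
- have gt_x u W : W \in glue (p, q) -> u \in W -> u != x -> (x < u)%N.
    move=> /memg[Wp|->|[Wq _]] uW ux; first exact: x1 (in1 Wp uW).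
      by case: (mem_x uW) => [e|[_ [/x2]]] //; rewrite e eqxx in ux.
    exact: x2 (in2 Wq uW).
  move=> A B a b c d Ag Bg aA bB cA dB ab bc cd.
  have xa : (x <= a)%N.
    by have [->//|/(gt_x _ _ Ag aA)/ltnW] := eqVneq a x.
  have xb : (x < b)%N := leq_ltn_trans xa ab.
  have xc : (x < c)%N := ltn_trans xb bc.
  have xd : (x < d)%N := ltn_trans xc cd.
  have neq u : (x < u)%N -> u <> x by move=> h e; move: h; rewrite e ltnn.
  move: Ag Bg => /memg[Ap|eA|[Aq AV]] /memg[Bp|eB|[Bq BV]].
  + exact: p4 Ap Bp aA bB cA dB ab bc cd.
  + have c1 := in1 Ap cA; move: bB; rewrite eB => /mem_x[/(neq _ xb)//|[_ [b2 _]]].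
    by have := ltn_trans bc (h12 c1 b2); rewrite ltnn.
  + by have := ltn_trans bc (h12 (in1 Ap cA) (in2 Bq bB)); rewrite ltnn.
  + have d1 := in1 Bp dB; move: cA; rewrite eA => /mem_x[/(neq _ xc)//|[_ [c2 _]]].
    by have := ltn_trans cd (h12 d1 c2); rewrite ltnn.
  + by rewrite eA eB.
  + move: cA; rewrite eA => /mem_x[/(neq _ xc)//|[cV [c2 Vq]]].
    have [[_ [V0 _]]|[y [yD ymin _ yV _]]] := head_cases hq; first by move: cV; rewrite /V V0 inE.
    have by' : b != y.
      by apply: contra BV => /eqP e; rewrite (q3 B V y) // -e.
    have yb := ymin _ (in2 Bq bB) by'.
    by move: BV; rewrite -(q4 V B y b c d) ?eqxx.
  + by have := ltn_trans cd (h12 (in1 Bp dB) (in2 Aq cA)); rewrite ltnn.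
  + move: bB dB; rewrite eB => /mem_x[/(neq _ xb)//|[bV [b2 Vq]]].
    move=> /mem_x[/(neq _ xd)//|[dV [d2 _]]].
    by move: AV; rewrite (q4 A V a b c d) ?eqxx.
  + exact: q4 Aq Bq aA bB cA dB ab bc cd.
Qed.

Lemma glue_pblock : pblock (glue (p, q)) x = x |: V.
Proof.
by apply: (nc_pblock glue_nc_spec); rewrite ?setU11 // !inE /= -/V eqxx !orbT.
Qed.

Lemma x_notin_head : x \notin V.
Proof.
apply/negP => xV; have [[_ [V0 _]]|[y [_ _ Vq _ _]]] := head_cases hq.
  by move: xV; rewrite /V V0 inE.
by have := in2 Vq xV; rewrite (negPf x_notin2).
Qed.

Lemma glue_first_split : first_split (glue (p, q)).
Proof.
rewrite /first_split; apply/and3P; split.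
- by apply/NCDP; exact: glue_nc_spec.
- rewrite glue_pblock disjoints_subset; apply/subsetP => u /mem_x[->|[_ [u2 _]]].
    by rewrite in_setC x_notin1.
  by rewrite in_setC; apply/negP => u1; exact: disj12 u1 u2.
- rewrite glue_pblock.
  have [[D0 _]|[y [_ _ _ yV]]] := head_cases hq.
    case e: s2 D0 => [//|z t] /setP/(_ z); rewrite !inE e mem_head //.
  move: (yV); rewrite -/V => yV'; case: s2 => // z t /eqP ->.
    by rewrite in_setU1 yV' orbT.
Qed.

Lemma cut_glue : cut (glue (p, q)) = (p, q).
Proof.
have [p1 p2 p3 p4] := hp; have [q1 q2 q3 q4] := hq.
rewrite /cut glue_pblock setU1K ?x_notin_head //; congr pair; apply/setP => W.
  rewrite inE; apply/andP/idP => [[/memg[//|->|[Wq _]] /subsetP sW]|Wp].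
    by have := sW x (setU11 _ _); rewrite (negPf x_notin1).
    have [/set0Pn[u uW] _] := q1 _ Wq.
    by case: (disj12 (sW _ uW) (in2 Wq uW)).
  by split; [rewrite inE /= Wp | have [] := p1 _ Wp].
rewrite inE [X in X || _]inE.
have [[_ [V0 q0]]|[y [_ _ Vq yV _]]] := head_cases hq.
  rewrite -/V in V0; rewrite V0 eqxx in_set0 orbF [in RHS]q0 in_set0.
  apply/negP => /andP[/memg[Wp|->|[Wq _]] /subsetP sW]; last by move: Wq; rewrite q0 inE.
    have [/set0Pn[u uW] _] := p1 _ Wp.
    by case: (disj12 (in1 Wp uW) (sW _ uW)).
  by have := sW x (setU11 _ _); rewrite (negPf x_notin2).
have V0 : V != set0 by apply/set0Pn; exists y.
rewrite (negPf V0) in_set1; apply/orP/idP => [[/andP[/memg[Wp|->|[//]] /subsetP sW]|/eqP -> //]|Wq].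
    have [/set0Pn[u uW] _] := p1 _ Wp.
    by case: (disj12 (in1 Wp uW) (sW _ uW)).
  by have := sW x (setU11 _ _); rewrite (negPf x_notin2).
have [->|WV] := eqVneq W V; [by right|left].
by rewrite !inE /= -/V WV Wq !orbT /=; have [] := q1 _ Wq.
Qed.

Lemma glue_blocks : (glue (p, q) :\ (x |: V)) :&: p = p /\
  (glue (p, q) :\ (x |: V)) :\: p = q :\ V.
Proof.
have [p1 _ _ _] := hp; have [q1 _ _ _] := hq.
have px W : W \in p -> W != x |: V.
  move=> Wp; apply/eqP => e; have xW : x \in W by rewrite e setU11.
  by have := in1 Wp xW; rewrite (negPf x_notin1).
have qx W : W \in q -> W != x |: V.
  move=> Wp; apply/eqP => e; have xW : x \in W by rewrite e setU11.
  by have := in2 Wp xW; rewrite (negPf x_notin2).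
have pq W : W \in p -> W \in q -> False.
  by move=> Wp Wq; have [/set0Pn[u uW] _] := p1 _ Wp; case: (disj12 (in1 Wp uW) (in2 Wq uW)).
split; apply/setP => W; rewrite !inE /= -/V.
  have [Wp|] := boolP (W \in p); last by rewrite andbF.
  by rewrite (px _ Wp).
have [Wp|Wp] /= := boolP (W \in p).
  by apply/esym/negP => /andP[_ Wq]; exact: pq Wp Wq.
have [->|Wx] /= := eqVneq W (x |: V); last by [].
by apply/esym/negP => /andP[_ /qx]; rewrite eqxx.
Qed.

End glue_nc.

Section cut_nc.
Context (p : {set {set 'I_n}}) (fs : first_split p).
Let V := pblock p x.

Let hp : nc_spec p D. Proof. by case/andP: fs => /NCDP. Qed.
Let xD : x \in D. Proof. by rewrite memD eqxx. Qed.
Let Vp : V \in p.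
Proof. by have [_ h2 _ _] := hp; have [W Wp xW] := h2 _ xD; rewrite /V (nc_pblock hp Wp xW). Qed.
Let xV : x \in V.
Proof. by have [_ h2 _ _] := hp; have [W Wp xW] := h2 _ xD; rewrite /V (nc_pblock hp Wp xW). Qed.

Let VD1 u : u \in V -> u \in D1 -> False.
Proof.
by move=> uV u1; case/and3P: fs => _ /disjointFr/(_ uV); rewrite u1.
Qed.

Let V_D2 : V :\ x \subset D2.
Proof.
apply/subsetP => u; rewrite in_setD1 => /andP[ux uV].
have [h1 _ _ _] := hp; have [_ /subsetP/(_ _ uV)] := h1 _ Vp.
by rewrite memD (negPf ux) /= => /orP[/(VD1 uV)|].
Qed.

(** A block meeting both [D1] and [D2] would cross the block of [x] through the head of
    [s2]. *)
Let other W : W \in p -> W != V -> W \subset D1 \/ W \subset D2.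
Proof.
move=> Wp WV; have [h1 h2 h3 h4] := hp.
have [_ sW] := h1 _ Wp.
have xW u : u \in W -> u != x.
  by move=> uW; apply: contra WV => /eqP e; rewrite (h3 W V x) // -e.
have [/existsP[u /andP[uW u1]]|/existsPn none] := boolP [exists u, (u \in W) && (u \in D1)].
  left; apply/subsetP => v vW; have := subsetP sW _ vW.
  rewrite memD (negPf (xW _ vW)) /= => /orP[//|v2].
  exfalso; case/and3P: fs => _ _; case e: s2 => [|y t].
    by move: v2; rewrite inE e.
  rewrite -/V => yV; have y2 : y \in D2 by rewrite inE e mem_head.
  have vy : v != y by apply: contra WV => /eqP vy; rewrite (h3 W V v) // vy.
  have := h4 V W x u y v Vp Wp xV uW yV vW (x1 u1) (h12 u1 y2) (head_min e v2 vy).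
  by move=> VW; rewrite VW eqxx in WV.
right; apply/subsetP => v vW; have := subsetP sW _ vW.
rewrite memD (negPf (xW _ vW)) /= => /orP[v1|//].
by have := none v; rewrite vW v1.
Qed.

Let VnD2 : (V \subset D2) = false.
Proof. by apply/negP => /subsetP/(_ _ xV); rewrite (negPf x_notin2). Qed.

Lemma cut1_nc : (cut p).1 \in NCD D1.
Proof.
have [h1 h2 h3 h4] := hp; apply/NCDP; split => /=.
- by move=> W; rewrite inE => /andP[/h1[W0 _]].
- move=> u u1; have [|W Wp uW] := h2 u; first by rewrite memD u1 orbT.
  exists W => //; rewrite inE Wp /=.
  have WV : W != V by apply/eqP => WV; rewrite WV in uW; exact: VD1 uW u1.
  case: (other Wp WV) => // /subsetP/(_ _ uW) u2.
  by case: (disj12 u1 u2).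
- by move=> W W' u; rewrite !inE => /andP[a _] /andP[b _]; exact: h3.
- by move=> A B a b c d; rewrite !inE => /andP[Ap _] /andP[Bp _]; exact: h4.
Qed.

Let mem2 W : W \in (cut p).2 -> exists2 W', W' \in p &
  [/\ W \subset W', W \subset D2, W != set0 & (W' = V /\ W = V :\ x) \/ (W' != V /\ W = W')].
Proof.
have [h1 _ _ _] := hp; rewrite /= -/V in_setU inE => /orP[/andP[Wp W2]|].
  exists W => //; split => //; first by have [] := h1 _ Wp.
  by right; split => //; apply/eqP => WV; rewrite WV VnD2 in W2.
case: ifP => [|/negbT V0]; rewrite inE // => /eqP ->; exists V => //.
by split => //; [exact: subsetDl|left].
Qed.

Lemma cut2_nc : (cut p).2 \in NCD D2.
Proof.
have [h1 h2 h3 h4] := hp; apply/NCDP; split.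
- by move=> W /mem2[W' _ [_ W2 W0 _]].
- move=> u u2; have [|W Wp uW] := h2 u; first by rewrite memD u2 !orbT.
  have ux : u != x by apply/eqP => ux; move: u2; rewrite ux (negPf x_notin2).
  have [WV|WV] := eqVneq W V.
    have uV : u \in V :\ x by rewrite in_setD1 ux -WV.
    have V0 : V :\ x != set0 by apply/set0Pn; exists u.
    by exists (V :\ x) => //=; rewrite -/V (negPf V0) in_setU inE set11 orbT.
  exists W => //; rewrite /= in_setU inE Wp /=.
  case: (other Wp WV) => [/subsetP/(_ _ uW) u1|->//].
  by case: (disj12 u1 u2).
- move=> A B u /mem2[A' Ap [sA _ _ cA]] /mem2[B' Bp [sB _ _ cB]] uA uB.
  have e := h3 _ _ _ Ap Bp (subsetP sA _ uA) (subsetP sB _ uB).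
  case: cA cB => [[a1 a2]|[a1 a2]] [[b1 b2]|[b1 b2]].
  + by rewrite a2 b2.
  + by move: b1; rewrite -e a1 eqxx.
  + by move: a1; rewrite e b1 eqxx.
  + by rewrite a2 b2.
- move=> A B a b c d /mem2[A' Ap [sA _ _ cA]] /mem2[B' Bp [sB _ _ cB]] aA bB aA' dB ab bc cd.
  have e := h4 A' B' a b c d Ap Bp (subsetP sA _ aA) (subsetP sB _ bB)
    (subsetP sA _ aA') (subsetP sB _ dB) ab bc cd.
  case: cA cB => [[a1 a2]|[a1 a2]] [[b1 b2]|[b1 b2]].
  + by rewrite a2 b2.
  + by move: b1; rewrite -e a1 eqxx.
  + by move: a1; rewrite e b1 eqxx.
  + by rewrite a2 b2.
Qed.

Let head_cut : head_block s2 (cut p).2 = V :\ x.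
Proof.
have /NCDP hq := cut2_nc.
case/and3P: fs => _ _; rewrite -/V /head_block; case e: s2 => [|y t]; [move=> _|move=> yV].
  apply/esym/eqP; rewrite -subset0; apply: (subset_trans V_D2).
  by apply/subsetP => u; rewrite !inE e.
have yx : y != x.
  by apply/eqP => yx; have := x_notin2; rewrite -yx inE e mem_head.
have yV' : y \in V :\ x by rewrite in_setD1 yx.
apply: (nc_pblock hq) => //=; rewrite -/V.
have V0 : V :\ x != set0 by apply/set0Pn; exists y.
by rewrite (negPf V0) in_setU set11 orbT.
Qed.

Lemma glue_cut : glue (cut p) = p.
Proof.
have [h1 h2 h3 h4] := hp.
rewrite /glue head_cut setD1K //; apply/setP => W.
rewrite !in_setU in_set1 in_setD1 [(cut p).1]/= inE.
have [->|WV] := eqVneq W V; first by rewrite Vp orbT.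
rewrite /=; apply/idP/idP => [/orP[/andP[]//|/andP[n0]]|Wp].
  rewrite /= in_setU inE => /orP[/andP[]//|].
  by case: ifP; rewrite inE // => _ /eqP e; move: n0; rewrite e eqxx.
rewrite Wp /=; case: (other Wp WV) => [->//|W2]; rewrite orbC.
have [W0 _] := h1 _ Wp.
have -> : W != V :\ x.
  apply/eqP => WVx; have [u uW] := set0Pn _ W0.
  have uV : u \in V by move: uW; rewrite WVx in_setD1 => /andP[].
  by move: WV; rewrite (h3 W V u) // eqxx.
by rewrite /= in_setU inE Wp W2.
Qed.

End cut_nc.

End gluing.

Section weights.
Context {K : comNzRingType} (kap : nat -> K) (kap0 : kap 0 = 1%R).
Local Open Scope ring_scope.

(** Once the first [j] points of its first block are removed, a partition still weights
    this block by its original size. *)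
Definition nc_weight j s p : K :=
  kap (#|head_block s p| + j)%N * \prod_(V in p :\ head_block s p) kap #|V|.

Definition nc_sum j (s : seq 'I_n) : K :=
  \sum_(p in NCD [set z in s]) nc_weight j s p.

Lemma nc_weight0 s p : p \in NCD [set z in s] ->
  nc_weight 0 s p = \prod_(V in p) kap #|V|.
Proof.
move=> /NCDP h; rewrite /nc_weight addn0 /head_block; case: s h => [|y t] h.
  have -> : p = set0.
    apply/setP => W; rewrite inE; apply/negP => Wp; have [h1 _ _ _] := h.
    have [/set0Pn[u uW] /subsetP sW] := h1 _ Wp.
    by have := sW _ uW; rewrite inE.
  by rewrite cards0 kap0 mul1r set0D.
have [_ h2 _ _] := h; have [|W Wp yW] := h2 y; first by rewrite inE mem_head.
by rewrite (nc_pblock h Wp yW) [RHS](big_setD1 W).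
Qed.

Lemma nc_sum0 s : nc_sum 0 s = \sum_(p in NCD [set z in s]) \prod_(V in p) kap #|V|.
Proof. by apply: eq_bigr => p; exact: nc_weight0. Qed.

Lemma nc_sum_nil j : nc_sum j [::] = kap j.
Proof.
rewrite /nc_sum (big_pred1 set0); last first.
  move=> p; apply/NCDP/eqP => [[h1 _ _ _]|->].
    apply/setP => W; rewrite inE; apply/negP => /h1[/set0Pn[u uW] /subsetP/(_ _ uW)].
    by rewrite inE.
  by split => [W|u|W W' u|V W a b c d]; rewrite inE.
by rewrite /nc_weight /= set0D big_set0 mulr1 cards0.
Qed.

Lemma nc_sum_first_split j x s1 s2 :
  sorted (fun i j : 'I_n => (i < j)%N) (x :: s1 ++ s2) ->
  \sum_(p | first_split x s1 s2 p) nc_weight j (x :: s1 ++ s2) p =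
  nc_sum 0 s1 * nc_sum j.+1 s2.
Proof.
move=> srt; rewrite (reindex_onto (glue x s2) (cut x s1 s2)); last first.
  by move=> p; exact: glue_cut.
rewrite /nc_sum big_distrlr pair_big /=; apply: eq_big => [[p q] /=|[p q] /=].
  apply/andP/andP => [[fs /eqP e]|[/NCDP hp /NCDP hq]].
    by have := cut1_nc srt fs; have := cut2_nc srt fs; rewrite e.
  by split; [exact: glue_first_split | apply/eqP; exact: cut_glue].
move=> /andP[fs /eqP e].
have hp := cut1_nc srt fs; have hq := cut2_nc srt fs; rewrite e /= in hp hq.
rewrite (nc_weight0 hp) {1}/nc_weight /=.
move: hp hq => /NCDP hp /NCDP hq.
rewrite (glue_pblock srt hp hq) cardsU1 (x_notin_head srt hq) /= add1n addSnnS.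
rewrite mulrCA; congr (_ * _).
have [e1 e2] := glue_blocks srt hp hq.
by rewrite (big_setID p) /= e1 e2.
Qed.

(** Summing over the position [i] of the second point of the first block: [find] locates
    it, and this turns its value into the two conditions of [first_split]. *)
Lemma find_take_drop (T : Type) (a : pred T) (s : seq T) i : (i <= size s)%N ->
  (find a s == i) = ~~ has a (take i s) && (if drop i s is y :: _ then a y else true).
Proof.
move=> si; rewrite -[in LHS](cat_take_drop i s) find_cat.
have st : size (take i s) = i by rewrite size_takel.
have [h|h] := boolP (has a (take i s)).
  by move: (h); rewrite has_find st => /ltn_eqF ->.
rewrite st -[X in _ == X]addn0 eqn_add2l /=.
by case: (drop i s) => [|y t] //=; case: (a y).
Qed.

(** The block of the first point [x] either is [{x}] or has a second point; the points
    strictly between these two, and the points from the second one on, carry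
    independent non-crossing partitions. *)
Lemma nc_sum_rec j x s : sorted (fun i j : 'I_n => (i < j)%N) (x :: s) ->
  nc_sum j (x :: s) = \sum_(i < (size s).+1) nc_sum 0 (take i s) * nc_sum j.+1 (drop i s).
Proof.
move=> srt; rewrite /nc_sum.
rewrite (partition_big (fun p => inord (find (mem (pblock p x)) s) : 'I_(size s).+1) predT) //=.
apply: eq_bigr => i _.
have srt' : sorted (fun i j : 'I_n => (i < j)%N) (x :: take i s ++ drop i s).
  by rewrite cat_take_drop.
rewrite -[_ * _](nc_sum_first_split j srt') cat_take_drop.
apply: eq_bigl => p; rewrite /first_split cat_take_drop; congr (_ && _).
have il : (i <= size s)%N by rewrite -ltnS.
rewrite -(inj_eq val_inj) /= inordK; last by rewrite ltnS find_size.
rewrite find_take_drop //; congr (_ && _).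
apply/hasPn/idP => [h|/disjointFl h u us]; last first.
  by apply: negbT; apply: h; rewrite inE.
rewrite disjoint_sym disjoints_subset; apply/subsetP => u; rewrite !inE => /h.
by rewrite inE.
Qed.

End weights.

Lemma enum_ord_sorted : sorted (fun i j : 'I_n => (i < j)%N) (enum 'I_n).
Proof. by have := iota_ltn_sorted 0 n; rewrite -val_enum_ord sorted_map. Qed.

End noncrossing.

Section cumulant_recursion.
Context {K : comNzRingType} (kap : nat -> K) (kap0 : kap 0 = 1%R).
Local Open Scope ring_scope.

Lemma sorted_take_drop (T : eqType) (r : rel T) i (s : seq T) : transitive r -> sorted r s ->
  sorted r (take i s) /\ sorted r (drop i s).
Proof. by move=> tr h; split; [exact: take_sorted|exact: drop_sorted]. Qed.

(** The recursion only involves the sizes of the sequences. *)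
Lemma nc_sum_size m : forall n n' j (s : seq 'I_n) (s' : seq 'I_n'),
  size s = m -> size s' = m ->
  sorted (fun i j : 'I_n => (i < j)%N) s -> sorted (fun i j : 'I_n' => (i < j)%N) s' ->
  nc_sum kap j s = nc_sum kap j s'.
Proof.
elim/ltn_ind: m => m IH n n' j [|x s] [|x' s'] sz; subst m => //= e; rewrite ?nc_sum_nil //.
move=> srt srt'; move: e => [e].
rewrite (nc_sum_rec kap0 _ srt) (nc_sum_rec kap0 _ srt') e; apply: eq_bigr => i _.
have [a1 a2] := sorted_take_drop i (fun _ _ _ => @ltn_trans _ _ _) (path_sorted srt).
have [b1 b2] := sorted_take_drop i (fun _ _ _ => @ltn_trans _ _ _) (path_sorted srt').
have il : (i <= size s)%N by rewrite -ltnS ltn_ord.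
congr (_ * _).
  by apply: (IH i) => //; rewrite ?size_takel ?e //= ltnS.
by apply: (IH (size s - i)%N); rewrite ?size_drop ?e //= ltnS leq_subr.
Qed.

(** At [j = 0] these are the moments of a law with free cumulants [kap], and at [m = 0]
    the cumulants themselves; the recursion relates all the pairs [(j, m)]. *)
Definition cumulant_moment j m : K := nc_sum kap j (enum 'I_m).

Lemma cumulant_moment0 j : cumulant_moment j 0 = kap j.
Proof.
rewrite /cumulant_moment; have : size (enum 'I_0) = 0%N by rewrite size_enum_ord.
by case: (enum 'I_0) => // _; exact: nc_sum_nil.
Qed.

Lemma cumulant_momentS j m : cumulant_moment j m.+1 =
  \sum_(i < m.+1) cumulant_moment 0 i * cumulant_moment j.+1 (m - i).
Proof.
rewrite /cumulant_moment; have := enum_ord_sorted (n := m.+1).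
have : size (enum 'I_m.+1) = m.+1 by rewrite size_enum_ord.
case: (enum 'I_m.+1) => // x s [sz] srt; rewrite (nc_sum_rec kap0 _ srt) sz.
apply: eq_bigr => i _; have il : (i <= m)%N by rewrite -ltnS.
have [a1 a2] := sorted_take_drop i (fun _ _ _ => @ltn_trans _ _ _) (path_sorted srt).
congr (_ * _).
  by apply: (@nc_sum_size i) => //; rewrite ?size_takel ?size_enum_ord ?sz //; exact: enum_ord_sorted.
apply: (@nc_sum_size (m - i)%N) => //; rewrite ?size_drop ?size_enum_ord ?sz //.
exact: enum_ord_sorted.
Qed.

Lemma cumulant_moment_NC m : \sum_(p in NC m) \prod_(V in p) kap #|V| = cumulant_moment 0 m.
Proof.
rewrite /cumulant_moment nc_sum0 //; apply: eq_bigl => p.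
rewrite (_ : [set z in enum 'I_m]%SET = [set: 'I_m]%SET) //.
by apply/setP => z; rewrite !inE mem_enum.
Qed.

End cumulant_recursion.
(** * Compound Poisson laws *)

Section cumulant_growth.
Context {R : realType}.
Local Open Scope ring_scope.

Definition catalan (m : nat) : R := cumulant_moment (fun=> 1) 0 m.

Lemma catalanS m : catalan m.+1 = \sum_(i < m.+1) catalan i * catalan (m - i).
Proof.
by rewrite /catalan cumulant_momentS.
Qed.

Lemma catalan_ge0 m : 0 <= catalan m.
Proof.
elim/ltn_ind: m => -[|m] IH; first by rewrite /catalan cumulant_moment0.
rewrite catalanS; apply: sumr_ge0 => i _; rewrite mulr_ge0 // IH //.
by rewrite ltnS leq_subr.
Qed.

Lemma triangle_sum (K : comNzRingType) (u v : nat -> K) L :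
  \sum_(m < L) \sum_(i < m.+1) u i * v (m - i)%N =
  \sum_(i < L) u i * \sum_(l < L - i) v l.
Proof.
elim: L => [|L IH]; first by rewrite !big_ord0.
rewrite big_ord_recr /= IH [in RHS]big_ord_recr /= subSnn big_ord1.
rewrite [in LHS]big_ord_recr /= subnn addrA; congr (_ + _).
rewrite -big_split /=; apply: eq_bigr => i _.
have iL : (i <= L)%N by apply: ltnW.
by rewrite subSn // big_ord_recr /= mulrDr.
Qed.

(** The generating series [C] of the Catalan numbers satisfies [C = 1 + x C^2], which
    keeps its partial sums at [x = 1 / 4] below 2. *)
Lemma catalan_sum_le2 L : \sum_(i < L) catalan i * 4^-1 ^+ i <= 2.
Proof.
elim: L => [|L IH]; first by rewrite big_ord0.
rewrite big_ord_recl /= expr0 mulr1 /catalan cumulant_moment0 //.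
pose u i := catalan i * 4^-1 ^+ i : R.
have u0 i : 0 <= u i by rewrite mulr_ge0 ?catalan_ge0 // exprn_ge0.
rewrite (eq_bigr (fun m : 'I_L => 4^-1 * \sum_(i < m.+1) u i * u (m - i)%N)); last first.
  move=> m _; rewrite /bump /= add1n -/(catalan _) catalanS exprS mulrCA; congr (_ * _).
  rewrite mulr_suml; apply: eq_bigr => i _.
  have im : (i <= m)%N by rewrite -ltnS.
  by rewrite /u mulrACA -exprD subnKC.
rewrite -mulr_sumr triangle_sum.
have S0 : 0 <= \sum_(i < L) u i by apply: sumr_ge0.
have : \sum_(i < L) u i * \sum_(l < L - i) u l <= (\sum_(i < L) u i) * \sum_(i < L) u i.
  rewrite mulr_suml; apply: ler_sum => i _; rewrite ler_wpM2l //.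
  rewrite -[in leRHS](subnK (ltnW (ltn_ord i))) big_split_ord /= lerDl.
  exact: sumr_ge0.
have : (\sum_(i < L) u i) * \sum_(i < L) u i <= 2 * 2 by rewrite ler_pM.
lra.
Qed.

Lemma catalan_le m : catalan m * 4^-1 ^+ m <= 2.
Proof.
apply: le_trans (catalan_sum_le2 m.+1); rewrite big_ord_recr /= lerDr.
by apply: sumr_ge0 => i _; rewrite mulr_ge0 ?catalan_ge0 // exprn_ge0.
Qed.

(** The recursion is positive, which compares it with the one of the Catalan numbers. *)
Lemma cumulant_moment_bound (kap : nat -> R) (B : R) j m : kap 0 = 1 -> 0 <= B ->
  (forall i, `|kap i| <= B ^+ i) ->
  `|cumulant_moment kap j m| <= B ^+ (j + m) * catalan m.
Proof.
move=> k0 B0 kB; elim/ltn_ind: m j => -[|m] IH j.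
  by rewrite cumulant_moment0 addn0 /catalan cumulant_moment0 mulr1.
rewrite cumulant_momentS // catalanS mulr_sumr; apply: le_trans (ler_norm_sum _ _ _) _.
apply: ler_sum => i _; have im : (i <= m)%N by rewrite -ltnS.
rewrite normrM; apply: (@le_trans _ _ ((B ^+ i * catalan i) * (B ^+ (j.+1 + (m - i)) * catalan (m - i)))).
  by rewrite ler_pM ?normr_ge0 ?IH // ltnS leq_subr.
by rewrite mulrACA -exprD addnCA addSn subnKC // addnS.
Qed.

End cumulant_growth.

Section compound_poisson.
Context {R : realType} (k : nat) (c b : 'I_k -> R) (kap : nat -> R).
Context (kap0 : kap 0 = 1) (kapE : forall j, kap j.+1 = \sum_(i < k) c i * b i ^+ j.+1).

Local Notation G := (cauchy_transform (R := R)).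

Lemma cumulant_growth : exists B, [/\ 1 <= B, forall i, `|b i| <= B &
  forall j, `|kap j| <= B ^+ j].
Proof.
have [sc [sc0 hc]] : exists sc : R, 0 <= sc /\ \sum_(i < k) `|c i| = sc.
  by eexists; split; last reflexivity; exact: sumr_ge0.
have [sb [sb0 hb]] : exists sb : R, 0 <= sb /\ forall i, `|b i| <= sb.
  exists (\sum_(i < k) `|b i|); split => [|i]; first exact: sumr_ge0.
  by rewrite (bigD1 i) //= lerDl; exact: sumr_ge0.
have sc1 : 1 <= 1 + sc by rewrite lerDl.
have sb1 : 1 <= 1 + sb by rewrite lerDl.
have [sc2 sb2] : 0 <= 1 + sc /\ 0 <= 1 + sb by split; lra.
exists ((1 + sc) * (1 + sb)); split.
- by rewrite -[leLHS]mulr1 ler_pM.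
- move=> i; apply: le_trans (hb i) _; apply: (@le_trans _ _ (1 + sb)); first by rewrite lerDr.
  by rewrite ler_peMl.
case=> [|j]; first by rewrite kap0 normr1 expr0.
rewrite kapE; apply: le_trans (ler_norm_sum _ _ _) _.
apply: (@le_trans _ _ (\sum_(i < k) `|c i| * (1 + sb) ^+ j.+1)).
  apply: ler_sum => i _; rewrite normrM normrX ler_wpM2l //.
  rewrite lerXn2r ?nnegrE //.
  by apply: le_trans (hb i) _; rewrite lerDr.
rewrite -mulr_suml hc exprMn ler_wpM2r ?exprn_ge0 //.
apply: (@le_trans _ _ (1 + sc)); first by rewrite lerDr.
by rewrite exprS ler_peMr ?exprn_ege1.
Qed.

Context (B : R) (B1 : 1 <= B) (atom_le : forall i, `|b i| <= B).
Context (cumulant_le : forall j, `|kap j| <= B ^+ j).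
Let B0 : 0 < B. Proof. exact: lt_le_trans B1. Qed.

Section functional_equation.
Context (mu : probability R R).
Context (hmu : forall m, has_moment mu m /\ moment mu m = cumulant_moment kap 0 m).
Context (t : R) (tB : 8 * B <= t).
Let w : R[i] := 0 +i* t.
Let z : R[i] := w^-1.
Let t0 : 0 < t. Proof. by apply: lt_le_trans tB; rewrite mulr_gt0. Qed.
Let w0 : 0 < complex.Im w. Proof. exact: t0. Qed.
Let nw : normc w = t.
Proof. by rewrite /= expr0n /= add0r sqrtr_sqr gtr0_norm. Qed.
Let nz : normc z = t^-1. Proof. by rewrite normcV nw. Qed.
Let zB : normc z * B <= 8^-1.
Proof. by rewrite nz mulrC ler_pdivrMr //; move: tB; lra. Qed.

Let A j m : R[i] := (cumulant_moment kap j m)%:C * z ^+ m.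
(** Partial sums of [\sum_m cumulant_moment j m / w^m]. *)
Let S L j := \sum_(m < L) A j m.
Let al m : R := catalan m * 4^-1 ^+ m.
Let al0 m : 0 <= al m. Proof. by rewrite mulr_ge0 ?catalan_ge0 // exprn_ge0. Qed.

Let A_le j m : normc (A j m) <= B ^+ j * (al m * 2^-1 ^+ m).
Proof.
rewrite normcM normcX normc_real.
apply: (@le_trans _ _ (B ^+ (j + m) * catalan m * normc z ^+ m)).
  by rewrite ler_wpM2r ?exprn_ge0 ?normc_ge0 // cumulant_moment_bound // ltW.
rewrite (_ : _ * _ * _ = B ^+ j * (catalan m * (normc z * B) ^+ m)); last by rewrite exprD exprMn; ring.
rewrite ler_wpM2l ?exprn_ge0 ?(ltW B0) // /al -mulrA -exprMn ler_wpM2l ?catalan_ge0 //.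
rewrite lerXn2r ?nnegrE ?mulr_ge0 ?normc_ge0 ?(ltW B0) //.
by apply: le_trans zB _; lra.
Qed.

Let half_le1 m : 2^-1 ^+ m <= 1 :> R.
Proof. by rewrite exprn_ile1 //; lra. Qed.

Let S_le L j : normc (S L j) <= 2 * B ^+ j.
Proof.
apply: le_trans (normc_sum _ _ _) _.
apply: (@le_trans _ _ (\sum_(m < L) B ^+ j * al m)).
  apply: ler_sum => m _; apply: le_trans (A_le j m) _.
  by rewrite ler_wpM2l ?exprn_ge0 ?(ltW B0) // ler_piMr.
by rewrite -mulr_sumr mulrC ler_wpM2r ?exprn_ge0 ?(ltW B0) // catalan_sum_le2.
Qed.

Let e L j := S L j - ((kap j)%:C + z * S L 0 * S L j.+1).

(** Truncating the series only breaks the recursion at the orders above [L]. *)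
Let e_le L j : normc (e L j) <= 3 * (B ^+ j * 2^-1 ^+ L).
Proof.
have E : S L.+1 j = (kap j)%:C + z * \sum_(i < L) A 0 i * \sum_(l < L - i) A j.+1 l.
  rewrite /S big_ord_recl /= {1}/A cumulant_moment0 expr0 mulr1; congr (_ + _).
  rewrite -triangle_sum mulr_sumr; apply: eq_bigr => m _.
  rewrite /A /bump /= add1n cumulant_momentS // rmorph_sum mulr_suml mulr_sumr.
  apply: eq_bigr => i _; have im : (i <= m)%N by rewrite -ltnS.
  have -> : z ^+ m.+1 = z * (z ^+ i * z ^+ (m - i)) by rewrite -exprD subnKC // exprS.
  by rewrite rmorphM; ring.
have E2 : z * S L 0 * S L j.+1 = z * (\sum_(i < L) A 0 i * \sum_(l < L - i) A j.+1 l) +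
    z * \sum_(i < L) A 0 i * \sum_(l < i) A j.+1 (L - i + l)%N.
  rewrite -mulrDr -big_split /= -mulrA; congr (_ * _).
  rewrite /S mulr_suml; apply: eq_bigr => i _; rewrite -mulrDr; congr (_ * _).
  by rewrite -[in LHS](subnK (ltnW (ltn_ord i))) big_split_ord.
have -> : e L j = - (A j L) - z * \sum_(i < L) A 0 i * \sum_(l < i) A j.+1 (L - i + l)%N.
  rewrite /e E2 addrA -E /S big_ord_recr /=; ring.
apply: le_trans (le_normcB _ _) _.
have h1 : normc (- A j L) <= 2 * (B ^+ j * 2^-1 ^+ L).
  rewrite normcN; apply: le_trans (A_le j L) _.
  rewrite [leRHS]mulrCA ler_wpM2l ?exprn_ge0 ?(ltW B0) //.
  by rewrite ler_wpM2r ?exprn_ge0 // catalan_le.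
suff h2 : normc (z * \sum_(i < L) A 0 i * \sum_(l < i) A j.+1 (L - i + l)%N) <= B ^+ j * 2^-1 ^+ L.
  lra.
rewrite normcM.
have h3 : normc (\sum_(i < L) A 0 i * \sum_(l < i) A j.+1 (L - i + l)%N) <=
    (\sum_(i < L) al i) * (\sum_(i < L) al i) * (B ^+ j.+1 * 2^-1 ^+ L).
  apply: le_trans (normc_sum _ _ _) _; rewrite -mulrA mulr_suml; apply: ler_sum => i _.
  have iL := ltnW (ltn_ord i).
  rewrite normcM.
  have hs : normc (\sum_(l < i) A j.+1 (L - i + l)%N) <=
     (\sum_(l < L) al l) * (B ^+ j.+1 * 2^-1 ^+ (L - i)).
    apply: le_trans (normc_sum _ _ _) _.
    apply: (@le_trans _ _ ((\sum_(l < i) al (L - i + l)%N) * (B ^+ j.+1 * 2^-1 ^+ (L - i)))).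
      rewrite mulr_suml; apply: ler_sum => l _; apply: le_trans (A_le _ _) _.
      rewrite mulrCA ler_wpM2l // ler_wpM2l ?exprn_ge0 ?(ltW B0) //.
      by rewrite exprD ler_piMr ?exprn_ge0.
    rewrite ler_wpM2r ?mulr_ge0 ?exprn_ge0 ?(ltW B0) //.
    rewrite -[in leRHS](subnK iL) big_split_ord /= lerDr.
    exact: sumr_ge0.
  have ha : normc (A 0 i) <= al i * 2^-1 ^+ i by have := A_le 0 i; rewrite expr0 mul1r.
  apply: le_trans (ler_pM (normc_ge0 _) (normc_ge0 _) ha hs) _.
  rewrite [leLHS](_ : _ = al i * ((\sum_(l < L) al l) * (B ^+ j.+1 * (2^-1 ^+ i * 2^-1 ^+ (L - i))))); last by ring.
  by rewrite -exprD subnKC.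
apply: le_trans (ler_wpM2l (normc_ge0 z) h3) _.
rewrite [leLHS](_ : _ = (normc z * B) * ((\sum_(i < L) al i) * (\sum_(i < L) al i)) * (B ^+ j * 2^-1 ^+ L)); last by rewrite exprS; ring.
rewrite -[leRHS]mul1r ler_wpM2r ?mulr_ge0 ?exprn_ge0 ?(ltW B0) //.
have s2 : \sum_(i < L) al i <= 2 by exact: catalan_sum_le2.
have s0 : 0 <= \sum_(i < L) al i by apply: sumr_ge0.
have : (\sum_(i < L) al i) * (\sum_(i < L) al i) <= 2 * 2 by rewrite ler_pM.
have : 0 <= normc z * B by rewrite mulr_ge0 ?normc_ge0 // ltW.
move: zB; set y := normc z * B; set s := _ * _ => y8 y0 s4.
have : y * s <= 8^-1 * (2 * 2) by rewrite ler_pM // mulr_ge0.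
lra.
Qed.

Let sumc : R := \sum_(i < k) `|c i|.
Let sumc0 : 0 <= sumc. Proof. exact: sumr_ge0. Qed.
Let g L := z * S L 0.
(** A closed form for the limit of [S L j], in terms of the approximation [g L] of
    [G w]. *)
Let a L j : R[i] := \sum_(i < k) (c i * b i ^+ j)%:C / (1 - (b i)%:C * g L).

Let gB L : normc (g L) * B <= 4^-1.
Proof.
rewrite normcM mulrAC; have := S_le L 0; rewrite expr0 mulr1 => h.
have : normc z * B * normc (S L 0) <= 8^-1 * 2.
  by rewrite ler_pM ?mulr_ge0 ?normc_ge0 // ltW.
lra.
Qed.

Let bgL L i : normc ((b i)%:C * g L) <= 4^-1.
Proof.
apply: le_trans (gB L); rewrite normcM normc_real mulrC ler_wpM2l ?normc_ge0 //.
Qed.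

Let den L i : 3 / 4 <= normc (1 - (b i)%:C * g L).
Proof.
by have := le_normc_dist 1 ((b i)%:C * g L); have := bgL L i; rewrite normc1; lra.
Qed.

Let a_rec L j : a L j.+1 = (kap j.+1)%:C + g L * a L j.+2.
Proof.
rewrite kapE rmorph_sum mulr_sumr -big_split /=; apply: eq_bigr => i _.
have d0 : 1 - (b i)%:C * g L != 0.
  by rewrite -normc_gt0; have := den L i; lra.
by apply: (mulIf d0); rewrite mulrDl !(mulfVK d0) -mulrA (mulfVK d0) !rmorphM !rmorphXn !exprS; ring.
Qed.

Let a_le : exists2 C, 0 <= C & forall L j, normc (a L j) <= C * B ^+ j.
Proof.
exists (2 * sumc) => [|L j]; first exact: mulr_ge0.
apply: le_trans (normc_sum _ _ _) _; rewrite -mulrA [sumc * _]mulrC mulrA mulr_sumr.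
apply: ler_sum => i _; rewrite normcM normcV normc_real normrM normrX.
have d := den L i; have d0 : 0 < normc (1 - (b i)%:C * g L) by lra.
rewrite ler_pdivrMr // mulrC [leRHS]mulrAC.
have bb : `|b i| ^+ j <= B ^+ j by rewrite lerXn2r ?nnegrE // ltW.
have h : `|b i| ^+ j * 1 <= B ^+ j * (2 * normc (1 - (b i)%:C * g L)).
  by rewrite ler_pM ?exprn_ge0 //; lra.
rewrite mulr1 in h; rewrite mulrC [leRHS](_ : _ = `|c i| * (B ^+ j * (2 * normc (1 - (b i)%:C * g L)))); last by ring.
by rewrite ler_wpM2l.
Qed.

(** The series [S L j] satisfies the recursion of the closed form [a L j] up to [e L j];
    the recursion contracts, hence the two are close. *)
Let d_le L j : normc (S L j.+1 - a L j.+1) <= 4 * (B ^+ j.+1 * 2^-1 ^+ L).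
Proof.
have BL i : 0 <= B ^+ i * 2^-1 ^+ L by rewrite mulr_ge0 ?exprn_ge0 // ltW.
have [C1 C10 aC] := a_le; pose C := 2 + C1.
have C0 : 0 <= C by rewrite /C; lra.
have H J : forall j, normc (S L j.+1 - a L j.+1) <= B ^+ j.+1 * (4 * 2^-1 ^+ L + C * 4^-1 ^+ J).
  elim: J => [|J IH] {}j.
    rewrite expr0 mulr1; apply: le_trans (le_normcB _ _) _.
    have := S_le L j.+1; have := aC L j.+1; have := BL j.+1; rewrite /C !mulrDr.
    have : 0 <= 2^-1 ^+ L :> R by rewrite exprn_ge0.
    set x := B ^+ j.+1; set y := 2^-1 ^+ L; move=> y0 xy h1 h2; lra.
  have -> : S L j.+1 - a L j.+1 = g L * (S L j.+2 - a L j.+2) + e L j.+1.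
    by rewrite a_rec /e /g; ring.
  apply: le_trans (le_normcD _ _) _; rewrite normcM.
  have h1 : normc (g L) * normc (S L j.+2 - a L j.+2) <=
     B ^+ j.+1 * (2^-1 ^+ L + C * 4^-1 ^+ J.+1).
    apply: le_trans (ler_wpM2l (normc_ge0 _) (IH j.+1)) _.
    rewrite [leLHS](_ : _ = normc (g L) * B * (B ^+ j.+1 * (4 * 2^-1 ^+ L + C * 4^-1 ^+ J))); last first.
      by rewrite [B ^+ j.+2]exprS; ring.
    rewrite [leRHS](_ : _ = 4^-1 * (B ^+ j.+1 * (4 * 2^-1 ^+ L + C * 4^-1 ^+ J))).
      rewrite ler_wpM2r // mulr_ge0 ?exprn_ge0 ?(ltW B0) // addr_ge0 // mulr_ge0 // exprn_ge0 //.
    by rewrite [4^-1 ^+ J.+1]exprS; field.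
  have h2 := e_le L j.+1.
  apply: le_trans (lerD h1 h2) _; rewrite !mulrDr; lra.
apply/ler_addgt0Pr => x x0.
have [|J hJ] := @geo_small R 4^-1 (B ^+ j.+1 * C) x _ x0; first by apply/andP; split; lra.
apply: le_trans (H J j) _; rewrite mulrDr mulrA lerD //; last by rewrite mulrA.
by rewrite mulrCA mulrA.
Qed.

(** The remainder of the moment expansion is bounded by an even moment, hence by a
    Catalan number. *)
Let S_cvg : ccvg (fun r => S (2 * r).+1 0) (w * G mu w).
Proof.
apply: (@cvg0_le _ _ (fun r => 4 * (4^-1 ^+ r))); last first.
  rewrite -[X in _ --> X](mulr0 4); apply: cvgMr.
  by apply: cvg_expr; rewrite ger0_norm //; lra.
move=> r; rewrite normc_ge0 normcB /=.
have [hm _] := hmu (2 * r).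
rewrite (cauchy_expansion_axis hm w0) (_ : \sum_(l < _) _ = S (2 * r).+1 0); last first.
  by apply: eq_bigr => l _; rewrite /A (hmu l).2.
rewrite addrAC subrr add0r normcM normcX -/z nz.
have hr : normc (resolvent_moment mu (2 * r) w) <= 2 * moment mu (2 * r).
  rewrite -RintegralZl //.
  apply: normc_cint_le; [exact: cmeasurable_resolvent_moment|exact: RintegrableZ|].
  move=> x; rewrite normcM normcX normc_real mulrC.
  rewrite -[x ^+ _]ger0_norm; last by rewrite exprn_even_ge0 // oddM.
  rewrite normrX ler_wpM2r ?exprn_ge0 //.
  by apply: le_trans (xresolvent_bound _ w0) _; rewrite nw divff ?gt_eqF //; lra.
have tm : moment mu (2 * r) <= B ^+ (2 * r) * catalan (2 * r).
  rewrite (hmu _).2; apply: le_trans (ler_norm _) _.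
  by have := cumulant_moment_bound 0 (2 * r) kap0 (ltW B0) cumulant_le.
have m0 : 0 <= moment mu (2 * r).
  by apply: Rintegral_ge0 => x _; rewrite exprn_even_ge0 // oddM.
apply: (@le_trans _ _ (t^-1 ^+ (2 * r) * (2 * (B ^+ (2 * r) * catalan (2 * r))))).
  rewrite ler_wpM2l ?exprn_ge0 ?invr_ge0 ?(ltW t0) //; apply: le_trans hr _.
  by rewrite ler_wpM2l.
rewrite [leLHS](_ : _ = 2 * (catalan (2 * r) * (t^-1 * B) ^+ (2 * r))); last by rewrite exprMn; ring.
have tB8 : t^-1 * B <= 8^-1 by rewrite -nz.
have -> : 4 * 4^-1 ^+ r = 2 * (2 * 2^-1 ^+ (2 * r)) :> R.
  by rewrite exprM (_ : 2^-1 ^+ 2 = 4^-1) ?mulrA; [congr (_ * _); ring|field].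
rewrite ler_wpM2l //; apply: (@le_trans _ _ (catalan (2 * r) * (4^-1 * 2^-1) ^+ (2 * r))).
  rewrite ler_wpM2l ?catalan_ge0 // lerXn2r ?nnegrE ?mulr_ge0 ?invr_ge0 ?(ltW t0) ?(ltW B0) //.
  by apply: le_trans tB8 _; lra.
by rewrite exprMn mulrA ler_wpM2r ?exprn_ge0 // catalan_le.
Qed.

(** The moment series [M = w * G w] satisfies [M - 1 = G * S1], where [S1] sums the first
    blocks with one point removed; summing the geometric series in the size of the first
    block gives the right-hand side. *)
Lemma compound_poisson_equation :
  w * G mu w - 1 = G mu w * \sum_(i < k) (c i * b i)%:C / (1 - (b i)%:C * G mu w).
Proof.
have wn0 : w != 0 := upper_neq0 w0.
have gl : ccvg (fun r => g (2 * r).+1) (G mu w).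
  have := ccvgM (ccvg_cst z) S_cvg; rewrite mulrA mulVf // mul1r.
  exact.
have nG : normc (G mu w) <= t^-1 := normc_cauchy_le mu w0.
have d0 i : 1 - (b i)%:C * G mu w != 0.
  rewrite -normc_gt0; have h := le_normc_dist 1 ((b i)%:C * G mu w).
  have h2 : normc ((b i)%:C * G mu w) <= B * t^-1.
    by rewrite normcM normc_real ler_pM ?normc_ge0.
  have h3 : B * t^-1 <= 8^-1 by rewrite mulrC -nz.
  by apply: lt_le_trans h; rewrite normc1; lra.
have al1 : ccvg (fun r => a (2 * r).+1 1)
    (\sum_(i < k) (c i * b i)%:C / (1 - (b i)%:C * G mu w)).
  rewrite /a; have H i : ccvg (fun r => (c i * b i ^+ 1)%:C / (1 - (b i)%:C * g (2 * r).+1))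
      ((c i * b i)%:C / (1 - (b i)%:C * G mu w)).
    rewrite expr1; apply: ccvgM; first exact: ccvg_cst.
    apply: ccvgV => //; apply: ccvgB; first exact: ccvg_cst.
    by apply: ccvgM => //; exact: ccvg_cst.
  exact: ccvg_sum.
have l1 := ccvgB S_cvg (ccvg_cst 1).
have l2 := ccvgM gl al1.
have l3 := ccvgB l1 l2.
have : ccvg (fun r => S (2 * r).+1 0 - 1 - g (2 * r).+1 * a (2 * r).+1 1) 0.
  apply/ccvg0P/(@cvg0_le _ _ (fun r => 4 * 4^-1 ^+ r)); last first.
    rewrite -[X in _ --> X](mulr0 4); apply: cvgMr.
    by apply: cvg_expr; rewrite ger0_norm //; lra.
  move=> r; rewrite normc_ge0 /=; set L := (2 * r).+1.
  have -> : S L 0 - 1 - g L * a L 1 = g L * (S L 1 - a L 1) + e L 0.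
    by rewrite /e kap0 /g; ring.
  apply: le_trans (le_normcD _ _) _; rewrite normcM.
  have h1 := d_le L 0; have h2 := e_le L 0; rewrite expr0 mul1r in h2.
  have h3 : normc (g L) * normc (S L 1 - a L 1) <= 2^-1 ^+ L.
    apply: le_trans (ler_wpM2l (normc_ge0 _) h1) _.
    rewrite expr1 mulrCA !mulrA -[leRHS]mul1r ler_wpM2r ?exprn_ge0 //.
    by have := gB L; lra.
  have -> : 4^-1 ^+ r = 2 * 2^-1 ^+ L :> R.
    by rewrite /L exprS mulrA divff // mul1r exprM; congr (_ ^+ _); field.
  have : 0 <= 2^-1 ^+ L :> R by rewrite exprn_ge0.
  lra.
move=> /(ccvg_unique l3)/eqP; rewrite subr_eq0 => /eqP; exact.
Qed.

End functional_equation.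
End compound_poisson.
(** * Convergence of the cumulants of the free roots *)

Section coefficientwise_convergence.
Context {R : realType}.
Implicit Types (p q : {poly R}) (u v : nat -> {poly R}).

Definition coef_cvg u p := forall i, (u n)`_i @[n --> \oo] --> p`_i.

Lemma cvg_ub (u : nat -> R) (l : R) : u @ \oo --> l -> exists2 C, 1 <= C & forall n, u n <= C.
Proof.
move=> /cvgP/cvg_seq_bounded/pinfty_ex_gt0[C C0 /= hC].
exists (C + 1); first by rewrite lerDr ltW.
move=> n; apply: le_trans (ler_norm _) _; apply: le_trans (hC n I) _.
by rewrite lerDl.
Qed.

Lemma coef_cvg_cst p : coef_cvg (fun=> p) p.
Proof. by move=> i; exact: cvg_cst. Qed.

Lemma coef_cvgD u v p q : coef_cvg u p -> coef_cvg v q ->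
  coef_cvg (fun n => u n + v n) (p + q).
Proof. by move=> hp hq i; rewrite coefD; under eq_fun do rewrite coefD; exact: cvgD. Qed.

Lemma coef_cvgB u v p q : coef_cvg u p -> coef_cvg v q ->
  coef_cvg (fun n => u n - v n) (p - q).
Proof. by move=> hp hq i; rewrite coefB; under eq_fun do rewrite coefB; exact: cvgB. Qed.

Lemma coef_cvgM u v p q : coef_cvg u p -> coef_cvg v q ->
  coef_cvg (fun n => u n * v n) (p * q).
Proof.
move=> hp hq i; rewrite coefM; under eq_fun do rewrite coefM.
apply: cvg_big => [|j _]; first exact: add_continuous.
by apply: cvgM; [exact: hp|exact: hq].
Qed.

Lemma coef_cvgX u p l : coef_cvg u p -> coef_cvg (fun n => u n ^+ l) (p ^+ l).
Proof.
move=> hp; elim: l => [|l IH]; first by rewrite expr0; exact: coef_cvg_cst.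
by rewrite exprS; under eq_fun do rewrite exprS; exact: coef_cvgM.
Qed.

Lemma coef_cvg_sum L (U : nat -> nat -> {poly R}) (l_ : nat -> {poly R}) :
  (forall l, coef_cvg (U l) (l_ l)) ->
  coef_cvg (fun n => \sum_(l < L) U l n) (\sum_(l < L) l_ l).
Proof.
move=> hu; elim: L => [|L IH].
  by rewrite big_ord0; under eq_fun do rewrite big_ord0; exact: coef_cvg_cst.
by rewrite big_ord_recr; under eq_fun do rewrite big_ord_recr; exact: coef_cvgD.
Qed.

Lemma coef_cvg_root_poly (eps_ : nat -> R) eps K u p j :
  eps_ @ \oo --> eps -> coef_cvg u p ->
  coef_cvg (fun n => root_poly (eps_ n) K (u n) j) (root_poly eps K p j).
Proof.
move=> heps hp; elim: j => // j IH /=; apply: coef_cvgM.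
  by move=> i; rewrite coef_drop_poly; under eq_fun do rewrite coef_drop_poly; exact: IH.
have h1 := @coef_cvg_cst 1; apply: coef_cvgM.
  apply: coef_cvgD => //; apply: coef_cvgM; last exact: coef_cvgB.
  by move=> i; rewrite coefC; under eq_fun do rewrite coefC; case: ifP => // _; exact: cvg_cst.
by apply: (@coef_cvg_sum K.+1 (fun l n => (1 - u n) ^+ l)) => l; apply: coef_cvgX; exact: coef_cvgB.
Qed.

End coefficientwise_convergence.

Section cumulants_of_roots.
Context {R : realType}.
Implicit Types (kap : nat -> R).

(** At [eps = 0] the recursion defining [root_poly] is the recursion between the partial
    sums over non-crossing partitions, so its constant terms are the free cumulants. *)
Lemma root_poly0 kap K (p : {poly R}) j i : kap 0 = 1 ->
  (forall i, (i <= K)%N -> p`_i = cumulant_moment kap 0 i) -> (i + j <= K)%N ->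
  (root_poly 0 K p j)`_i = cumulant_moment kap j i.
Proof.
move=> kap0 hp; elim: j i => [|j IH] i ijK; first by rewrite addn0 in ijK; exact: hp.
have p0 : p`_0 = 1 by rewrite hp // cumulant_moment0.
have [s hs] := mul_inv_modXn K p0.
pose A := \poly_(l < K.+1) cumulant_moment kap j.+1 l.
rewrite /= polyC0 mul0r addr0 mul1r.
have -> : (drop_poly 1 (root_poly 0 K p j) * inv_modXn K p)`_i =
    (p * A * inv_modXn K p)`_i.
  rewrite !coefM; apply: eq_bigr => l _; congr (_ * _).
  have li : (l <= i)%N by rewrite -ltnS.
  have liK : (l.+1 + j <= K)%N by rewrite addSnnS (leq_trans _ ijK) // leq_add2r.
  rewrite coef_drop_poly addn1 IH // cumulant_momentS // coefM.
  apply: eq_bigr => r _; have rl : (r <= l)%N by rewrite -ltnS.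
  have lK : (l < K.+1)%N by rewrite ltnS (leq_trans _ liK) // addSn ltnW // ltnS leq_addr.
  rewrite hp; last by rewrite -ltnS (leq_ltn_trans rl).
  by rewrite coef_poly (leq_ltn_trans (leq_subr _ _) lK).
rewrite mulrAC hs mulrDl mul1r coefD -mulrA coefXnM.
have iK : (i < K.+1)%N by rewrite ltnS (leq_trans _ ijK) // leq_addr.
by rewrite iK addr0 coef_poly iK.
Qed.

(** The moments of the roots are polynomial in the moments of the laws and in [1 / N],
    so that one can pass to the limit in the coefficients. *)
Lemma free_root_cumulants (mu_ nu_ : nat -> probability R R) kap m j : kap 0 = 1 ->
  (forall n, is_free_power (nu_ n) n.+2 (mu_ n)) ->
  (forall n, has_moment (mu_ n) (2 * m)) ->
  (forall i, (i <= 2 * m)%N -> moment (mu_ n) i @[n --> \oo] --> cumulant_moment kap 0 i) ->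
  (0 < j <= 2 * m)%N ->
  (forall n, has_moment (nu_ n) j) /\
  n.+2%:R * moment (nu_ n) j @[n --> \oo] --> kap j.
Proof.
move=> kap0 hp hm cm jm; have m0 : (0 < m)%N by case: m jm {hm cm} => //; case: j.
have H n := free_root_moments (hp n) m0 (hm n) jm.
split=> [n|]; first by have [] := H n.
under eq_fun do rewrite (H _).2.
pose p := \poly_(i < (2 * m).+1) cumulant_moment kap 0 i.
rewrite -[kap j]cumulant_moment0 -(@root_poly0 kap (2 * m) p j 0) //; last 2 first.
- by move=> i im; rewrite coef_poly ltnS im.
- by case/andP: jm.
apply: (@coef_cvg_root_poly _ (fun n => n.+2%:R^-1)) => [|i].
  by have := @cvg_harmonic R; rewrite -(cvg_shiftS).
rewrite coef_poly; under eq_fun do rewrite coef_poly; case: ifP => im; last exact: cvg_cst.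
by apply: cm; rewrite -ltnS.
Qed.

End cumulants_of_roots.

(** * Convergence of Cauchy transforms on a half-line *)

Section resolvent_limit.
Context {R : realType} (k : nat) (c b : 'I_k -> R) (nu_ : nat -> probability R R).
Context (hnu : forall j, (0 < j <= 2 * k.+1)%N -> (forall n, has_moment (nu_ n) j) /\
  n.+2%:R * moment (nu_ n) j @[n --> \oo] --> \sum_(i < k) c i * b i ^+ j).

Lemma horner_limit (q : {poly R[i]}) : (size q <= 2 * k + 1)%N ->
  (forall n, cintegrable (nu_ n) (fun x => x%:C ^+ 2 * q.[x%:C])) /\
  ccvg (fun n => n.+2%:R * cint (nu_ n) (fun x => x%:C ^+ 2 * q.[x%:C]))
    (\sum_(i < k) (c i)%:C * (b i)%:C ^+ 2 * q.[(b i)%:C]).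
Proof.
move=> sq.
have hj l : (l < size q)%N -> (0 < l.+2 <= 2 * k.+1)%N.
  by move=> lq; have := leq_trans lq sq; rewrite addn1 mulnS add2n !ltnS.
have E (x : R) : x%:C ^+ 2 * q.[x%:C] = \sum_(l < size q) q`_l * x%:C ^+ l.+2.
  rewrite horner_coef mulr_sumr; apply: eq_bigr => l _.
  by rewrite mulrCA -exprD.
have ig n l : (l < size q)%N -> cintegrable (nu_ n) (fun x => q`_l * x%:C ^+ l.+2).
  by move=> /hj /hnu[hn _]; apply: cintegrableZ; exact: cintegrable_xX.
split=> [n|].
  by rewrite (funext E); have [] := cint_sum (ig n).
under eq_fun => n.
  rewrite (eq_cint _ E) (cint_sum (ig n)).2 mulr_sumr.
  rewrite (eq_bigr (fun l : 'I_(size q) => q`_l * (n.+2%:R * moment (nu_ n) l.+2)%:C)); last first.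
    move=> l _; rewrite cintZ; last by apply: cintegrable_xX; have [] := hnu (hj _ (ltn_ord l)).
    by rewrite cint_xX rmorphM rmorph_nat mulrCA.
  over.
have -> : \sum_(i < k) (c i)%:C * (b i)%:C ^+ 2 * q.[(b i)%:C] =
   \sum_(l < size q) q`_l * (\sum_(i < k) c i * b i ^+ l.+2)%:C.
  under eq_bigr do rewrite -mulrA E mulr_sumr.
  rewrite exchange_big /=; apply: eq_bigr => l _.
  rewrite rmorph_sum mulr_sumr; apply: eq_bigr => i _.
  by rewrite rmorphM rmorphXn mulrCA.
apply: (@ccvg_sum _ _ _ _ (fun (l : 'I_(size q)) n => q`_l * (n.+2%:R * moment (nu_ n) l.+2)%:C)) => l.
apply: ccvgM; first exact: ccvg_cst.
by apply: ccvg_real; have [] := hnu (hj _ (ltn_ord l)).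
Qed.

(** With [P = \prod (X - b i)], the function [P f / (f - x)] is a polynomial up to
    [P x / (f - x)], and the scaled measures [x^2 nu_n] asymptotically charge only the
    roots of [P] since the integrals of [P^2] tend to 0. *)
Lemma resolvent_limit (f : R[i]) : 0 < complex.Im f ->
  ccvg (fun n => n.+2%:R * resolvent_moment (nu_ n) 1 f)
    (\sum_(i < k) (c i)%:C * (b i)%:C ^+ 2 / (f - (b i)%:C)).
Proof.
move=> f0.
pose P := \prod_(a <- [seq b i | i <- enum 'I_k]) ('X - a%:P).
pose PC := map_poly (real_complex R) P.
have PCx (x : R) : PC.[x%:C] = P.[x]%:C by rewrite horner_map.
have Pb i : PC.[(b i)%:C] = 0.
  rewrite PCx; have /rootP -> // : root P (b i).
  by rewrite root_prod_XsubC map_f // mem_enum.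
have sP : (size PC <= k.+1)%N.
  by rewrite size_map_poly size_prod_XsubC size_map size_enum_ord.
have Pf : PC.[f] != 0.
  rewrite /PC rmorph_prod horner_prod prodf_seq_neq0; apply/allP => a _ /=.
  by rewrite rmorphB /= map_polyX map_polyC hornerD hornerN hornerX hornerC; exact: subR_neq0.
have [q hq] : exists q, PC - PC.[f]%:P = q * ('X - f%:P).
  by apply/factor_theorem; rewrite rootE hornerD hornerN hornerC subrr.
have sq : (size q <= 2 * k + 1)%N.
  have [->|q0] := eqVneq q 0; first by rewrite size_poly0.
  have : (size (PC - PC.[f]%:P)%R <= k.+1)%N.
    rewrite (leq_trans (size_polyD _ _)) // geq_max sP size_polyN.
    by rewrite (leq_trans (size_polyC_leq1 _)).
  rewrite hq size_Mmonic ?monicXsubC // size_XsubC addn2 /= => h.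
  by apply: (leq_trans (ltnW h)); rewrite addn1 ltnS leq_pmull.
have decomp (x : R) : PC.[f] / (f - x%:C) = q.[x%:C] + PC.[x%:C] / (f - x%:C).
  have u0 := subR_neq0 x f0.
  have := congr1 (fun p => p.[x%:C]) hq; rewrite hornerM !hornerD !hornerN !hornerC hornerX => h.
  apply: (mulIf u0); rewrite mulrDl !divfK //.
  by rewrite -opprB mulrN -h; ring.
have sP2 : (size (PC ^+ 2) <= 2 * k + 1)%N.
  rewrite expr2 (leq_trans (size_polyMleq _ _)) //.
  rewrite -subn1 leq_subLR; apply: leq_trans (leq_add sP sP) _.
  by rewrite mul2n -addnn addn1 add1n addSn addnS.
have [_ lT] := horner_limit sq.
have [iP2 lP2] := horner_limit sP2.
pose J n := \int[nu_ n]_x (x ^+ 2 * P.[x] ^+ 2).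
have E2 (x : R) : x%:C ^+ 2 * (PC ^+ 2).[x%:C] = (x ^+ 2 * P.[x] ^+ 2)%:C.
  by rewrite horner_exp PCx -!rmorphXn -rmorphM.
have iJ n : Rintegrable (nu_ n) (fun x => x ^+ 2 * P.[x] ^+ 2).
  by have := (iP2 n).1; rewrite (_ : (fun x => _) = (fun x => x ^+ 2 * P.[x] ^+ 2)) //; apply/funext => x; rewrite E2.
have lJ : n.+2%:R * J n @[n --> \oo] --> (0 : R).
  move: lP2; rewrite big1 => [/ccvgP[h _]|i _]; last by rewrite horner_exp Pb expr0n /= mulr0.
  rewrite (_ : (fun n => _) = (fun n => complex.Re
    (n.+2%:R * cint (nu_ n) (fun x => x%:C ^+ 2 * (PC ^+ 2).[x%:C])))) //.
  apply/funext => n; by rewrite (eq_cint _ E2) cint_real -(rmorph_nat (real_complex R)) -rmorphM.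
have [hm2 lm2] := @hnu 2 (leq_pmulr 2 (ltn0Sn k)).
have [C C1 hC] := cvg_ub lm2.
pose r n := n.+2%:R * cint (nu_ n) (fun x => x%:C ^+ 2 * (PC.[x%:C] / (f - x%:C))).
pose e0 := (2 * complex.Im f)^-1.
have e00 : 0 < e0 by rewrite invr_gt0 mulr_gt0.
have mr : cmeasurable (fun x : R => x%:C ^+ 2 * (PC.[x%:C] / (f - x%:C))).
  apply: cmeasurableM; first exact: cmeasurable_xX.
  apply: cmeasurableM; last exact: cmeasurable_resolvent.
  rewrite (_ : (fun x => _) = (fun x : R => (P.[x])%:C)); last by apply/funext => x; rewrite PCx.
  apply: cmeasurable_real; apply: continuous_measurable_fun; exact: continuous_horner.
have hh (del : R) (x : R) : 0 < del -> normc (x%:C ^+ 2 * (PC.[x%:C] / (f - x%:C))) <=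
   e0 * (del * x ^+ 2 + del^-1 * (x ^+ 2 * P.[x] ^+ 2)).
  move=> d0; rewrite normcM normcX normc_real real_normK ?num_real // normcM PCx normc_real.
  rewrite (_ : e0 * _ = x ^+ 2 * ((del + del^-1 * P.[x] ^+ 2) / 2 * (complex.Im f)^-1)); last first.
    by rewrite /e0; field; rewrite !gt_eqF.
  rewrite ler_wpM2l ?sqr_ge0 // ler_pM ?normc_ge0 //; last exact: normc_resolvent.
  rewrite ler_pdivlMr // -real_normK ?num_real //; set p := `|_|.
  have h : del - 2 * p + del^-1 * p ^+ 2 = del^-1 * (del - p) ^+ 2 by field; rewrite gt_eqF.
  have : 0 <= del^-1 * (del - p) ^+ 2 by rewrite mulr_ge0 ?sqr_ge0 // invr_ge0 ltW.
  rewrite -h; lra.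
have ih (del : R) n : Rintegrable (nu_ n) (fun x => e0 * (del * x ^+ 2 + del^-1 * (x ^+ 2 * P.[x] ^+ 2))).
  apply: RintegrableZ; apply: RintegrableD; apply: RintegrableZ; [exact: hm2|exact: iJ].
have ir n : cintegrable (nu_ n) (fun x : R => x%:C ^+ 2 * (PC.[x%:C] / (f - x%:C))).
  by apply: (cintegrable_le mr _ (ih 1 n)) => x; exact: hh.
have lr : ccvg r 0.
  apply/ccvg0P; apply: cvg0_approx => [n|x x0]; first exact: normc_ge0.
  (* Makes [e0 * del] times the scaled second moments at most [x]. *)
  pose del := x / (e0 * C).
  have C0 : 0 < C by lra.
  have d0 : 0 < del by rewrite divr_gt0 // mulr_gt0.
  exists (fun n => e0 * del^-1 * (n.+2%:R * J n)).
    by rewrite -[X in _ --> X](mulr0 (e0 * del^-1)); exact: cvgMr.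
  apply: nearW => n; rewrite /r normcM -(rmorph_nat (real_complex R)) normc_real ger0_norm //.
  have h1 : normc (cint (nu_ n) (fun x => x%:C ^+ 2 * (PC.[x%:C] / (f - x%:C)))) <=
      e0 * (del * moment (nu_ n) 2 + del^-1 * J n).
    apply: le_trans (normc_cint_le mr (ih del n) (fun x => hh del x d0)) _.
    rewrite RintegralZl //; last by apply: RintegrableD; apply: RintegrableZ; [exact: hm2|exact: iJ].
    rewrite RintegralD //; [|exact: RintegrableZ (hm2 n)|exact: RintegrableZ (iJ n)].
    by rewrite !RintegralZl //; [exact: iJ|exact: hm2].
  apply: le_trans (ler_wpM2l (ler0n _ _) h1) _.
  rewrite (_ : n.+2%:R * _ = e0 * del^-1 * (n.+2%:R * J n) + (e0 * del) * (n.+2%:R * moment (nu_ n) 2)); last by ring.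
  rewrite lerD2l; apply: (@le_trans _ _ (e0 * del * C)); first by rewrite ler_wpM2l // ltW // mulr_gt0.
  by rewrite (_ : e0 * del * C = x) // /del; field; rewrite !gt_eqF.
have := ccvgM (ccvg_cst PC.[f]^-1) (ccvgD lT lr).
rewrite addr0 mulr_sumr (eq_bigr (fun i => (c i)%:C * (b i)%:C ^+ 2 / (f - (b i)%:C))); last first.
  move=> i _; have := decomp (b i); rewrite Pb mul0r addr0 => <-.
  by have u0 := subR_neq0 (b i) f0; field; rewrite u0 Pf.
congr ccvg; apply/funext => n; rewrite /r -mulrDr -cintD //; last by have [] := horner_limit sq.
rewrite mulrCA; congr (_ * _).
rewrite -cintZ; last by apply: cintegrableD => //; have [] := horner_limit sq.
apply: eq_cint => x; rewrite -mulrDr -decomp.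
by have u0 := subR_neq0 x f0; field; rewrite u0 Pf.
Qed.

End resolvent_limit.

Section cauchy_limit.
Context {R : realType}.

Local Notation G := (cauchy_transform (R := R)).

(** Two terms of the expansion of [om * G_nu om], combined with the subordination
    identity [G_nu om = 1 / f]. *)
Lemma subord_equation (mu nu : probability R R) N (w : R[i]) :
  let om := subord mu N.+2 w in let f := F_transform mu w in
  0 < complex.Im om -> G mu w != 0 -> G nu om = G mu w -> has_moment nu 2 ->
  (w - f) * (1 + (N.+2%:R^-1)%:C * ((w - f) / f)) =
  (N.+2%:R * moment nu 1)%:C + N.+2%:R * resolvent_moment nu 1 om.
Proof.
move=> om f om0 G0 Gom h2; have n0 : (N.+2%:R : R[i]) != 0 by rewrite pnatr_eq0.
have f0 : f != 0 by rewrite invr_eq0.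
have h1 : has_moment nu 1 by exact: has_moment_le h2.
have := zcauchy_transform nu om0; rewrite Gom => h.
have r0 : resolvent_moment nu 0 om = om / f - 1.
  rewrite /f /F_transform invrK h addrAC subrr add0r; apply: eq_cint => x.
  by rewrite expr0 mul1r.
have := resolvent_momentS h1 om0; rewrite r0 => /(congr1 (fun z => N.+2%:R * z)).
move=> E; rewrite rmorphM rmorph_nat -mulrDr -E.
rewrite fmorphV rmorph_nat (_ : om = f + (w - f) / N.+2%:R) //.
by move: n0; move: (N.+2%:R : R[i]) => m m0; field; rewrite f0 m0.
Qed.

Lemma resolvent_moment_lipschitz (nu : probability R R) (z w : R[i]) :
  0 < complex.Im z -> 0 < complex.Im w -> has_moment nu 2 ->
  normc (resolvent_moment nu 1 z - resolvent_moment nu 1 w) <=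
  normc (z - w) / (complex.Im z * complex.Im w) * moment nu 2.
Proof.
move=> z0 w0 h2; have h1 : has_moment nu 1 by exact: has_moment_le h2.
rewrite /resolvent_moment -cintB; try exact: cintegrable_resolvent_moment.
rewrite -RintegralZl //; apply: normc_cint_le.
- by apply: cmeasurableB; exact: cmeasurable_resolvent_moment.
- exact: RintegrableZ.
move=> x; have u0 := subR_neq0 x z0; have v0 := subR_neq0 x w0.
rewrite (_ : _ - _ = (w - z) * ((z - x%:C)^-1 * (w - x%:C)^-1) * x%:C ^+ 2); last first.
  by rewrite expr1; field; rewrite u0 v0.
rewrite normcM normcX normc_real real_normK ?num_real // ler_wpM2r ?sqr_ge0 //.
rewrite normcM normcB ler_wpM2l ?normc_ge0 // normcM invfM.
by rewrite ler_pM ?normc_ge0 //; exact: normc_resolvent.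
Qed.

Context (k : nat) (c b : 'I_k -> R) (kap : nat -> R).
Context (kap0 : kap 0 = 1) (kapE : forall j, kap j.+1 = \sum_(i < k) c i * b i ^+ j.+1).
Context (mu : probability R R) (mu_ nu_ : nat -> probability R R).
Context (hmu : forall m, has_moment mu m /\ moment mu m = cumulant_moment kap 0 m).
Context (hroot : forall n, is_free_power (nu_ n) n.+2 (mu_ n)).
Context (hfin : forall n, has_moment (mu_ n) (2 * k.+1)).
Context (hcvg : forall i, (i <= 2 * k.+1)%N ->
  moment (mu_ n) i @[n --> \oo] --> cumulant_moment kap 0 i).

(** Both [F mu w] and, up to a vanishing error, [F (mu_ n) w] are fixed points of a map
    which contracts when [w] is high enough. *)
Lemma cauchy_cvg_axis : exists s0 : R, forall t, s0 < t ->
  ccvg (fun n => G (mu_ n) (0 +i* t)) (G mu (0 +i* t)).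
Proof.
have hnu j : (0 < j <= 2 * k.+1)%N -> (forall n, has_moment (nu_ n) j) /\
    n.+2%:R * moment (nu_ n) j @[n --> \oo] --> \sum_(i < k) c i * b i ^+ j.
  move=> jk; have [h1 h2] := free_root_cumulants kap0 hroot hfin hcvg jk; split=> //.
  by case: j jk h1 h2 => // j _ _; rewrite kapE.
have two_le : (2 <= 2 * k.+1)%N by rewrite leq_pmulr.
have [B0 [B01 B0b B0k]] := cumulant_growth kap0 kapE.
have [B2 B21 hB2] := cvg_ub (hcvg two_le).
have [hnu2 lnu2] := hnu 2 two_le.
have [hnu1 lnu1] := hnu 1 (ltnW two_le).
have [C C1 hC] := cvg_ub lnu2.
pose B := B0 + B2 + `|moment mu 2|.
have m2 : 0 <= `|moment mu 2| by [].
have B1 : 1 <= B by rewrite /B; lra.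
(* [8 B] is for the estimates on [F]; then [Im F] and [Im om] are at least [t - 2 B],
   and [2 C] makes the resolvent term contract by a factor 2. *)
exists (8 * B + 2 * C) => t ht.
set w : R[i] := 0 +i* t.
have wt : complex.Im w = t by [].
have wB : 8 * B <= complex.Im w by rewrite wt; lra.
have h2_ n : has_moment (mu_ n) 2 by exact: has_moment_le (hfin n).
have b2_ n : moment (mu_ n) 2 <= B by apply: le_trans (hB2 n) _; rewrite /B; lra.
have b2 : moment mu 2 <= B by apply: le_trans (ler_norm _) _; rewrite /B; lra.
have h2 := (hmu 2).1.
have w0 : w != 0 by apply: upper_neq0; lra.
pose f n := F_transform (mu_ n) w; pose F := F_transform mu w.
pose om n := subord (mu_ n) n.+2 w.
have [_ wG0 FB] := F_transform_estimates h2 b2 B1 wB.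
have G0 : G mu w != 0 by move: wG0; rewrite mulf_eq0 negb_or => /andP[].
have F0 : F != 0 by rewrite invr_eq0.
have ImF : t - 2 * B <= complex.Im F.
  by have := le_trans (normc_Im _) FB; rewrite ImD ImN wt ler_norml => /andP[h _]; rewrite /F; lra.
have ImF0 : 0 < complex.Im F by lra.
have est n : [/\ G (mu_ n) w != 0, normc (w - f n) <= 2 * B,
    t - 2 * B <= complex.Im (om n) & t - 2 * B <= normc (f n)].
  have [_ wGn fB] := F_transform_estimates (h2_ n) (b2_ n) B1 wB.
  have [_ oI] := subord_estimates (h2_ n) (b2_ n) B1 wB (ltn0Sn n.+1).
  split=> //; first by move: wGn; rewrite mulf_eq0 negb_or => /andP[].
    by rewrite normcB.
  have := le_trans (normc_Im _) fB; rewrite ImD ImN wt ler_norml => /andP[h _].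
  by apply: le_trans (le_trans (ler_norm _) (normc_Im _)); rewrite /f; lra.
have omI n : 0 < complex.Im (om n) by have [_ _ h _] := est n; lra.
have fn0 n : f n != 0 by rewrite -normc_gt0; have [_ _ _ h] := est n; lra.
pose L := \sum_(i < k) (c i)%:C * (b i)%:C ^+ 2 / (F - (b i)%:C).
have limE : w - F = (\sum_(i < k) c i * b i ^+ 1)%:C + L.
  have tB0 : 8 * B0 <= t by move: ht; rewrite /B; lra.
  have E := compound_poisson_equation kap0 kapE B01 B0b B0k hmu tB0; rewrite -/w in E.
  have -> : w - F = F * (w * G mu w - 1) by rewrite mulrBr mulr1 mulrCA mulVf // mulr1.
  rewrite E mulrA mulVf // mul1r /L rmorph_sum -big_split /=; apply: eq_bigr => i _.
  rewrite (_ : G mu w = F^-1); last by rewrite /F /F_transform invrK.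
  have u0 := subR_neq0 (b i) ImF0.
  by rewrite expr1 !rmorphM; field; rewrite u0 F0.
have eqn n : (w - f n) * (1 + (n.+2%:R^-1)%:C * ((w - f n) / f n)) =
    (n.+2%:R * moment (nu_ n) 1)%:C + n.+2%:R * resolvent_moment (nu_ n) 1 (om n).
  apply: subord_equation => //; [exact: omI|by have [] := est n|].
  by apply: (free_power_subordination (hroot n) (h2_ n) (b2_ n) B1); move: ht; lra.
pose e n := (n.+2%:R^-1 : R).
have le : e n @[n --> \oo] --> (0 : R) by have := @cvg_harmonic R; rewrite -(cvg_shiftS).
pose E n := normc ((n.+2%:R * moment (nu_ n) 1)%:C - (\sum_(i < k) c i * b i ^+ 1)%:C) +
  normc (n.+2%:R * resolvent_moment (nu_ n) 1 F - L) + e n * (2 * B).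
have lE : E n @[n --> \oo] --> (0 : R).
  rewrite -[X in _ --> X]addr0 -[X in _ --> X + _]addr0; apply: cvgD; [apply: cvgD|].
  - exact: ccvg_real lnu1.
  - exact: (resolvent_limit hnu ImF0).
  - by rewrite -[X in _ --> X](mul0r (2 * B)); exact: cvgMl.
have dE n : normc (f n - F) <= 2 * E n + 2 * B * e n.
  have [_ fB oI nf] := est n.
  have e0 : 0 < e n by rewrite invr_gt0.
  have oF : normc (om n - F) <= normc (f n - F) + e n * (2 * B).
    have -> : om n - F = (f n - F) + (e n)%:C * (w - f n).
      by rewrite /om /subord /e fmorphV rmorph_nat /f; ring.
    apply: le_trans (le_normcD _ _) _; rewrite lerD2l normcM normc_real ger0_norm ?(ltW e0) //.
    by rewrite ler_wpM2l // ltW.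
  have D : f n - F = - ((n.+2%:R * moment (nu_ n) 1)%:C - (\sum_(i < k) c i * b i ^+ 1)%:C)
     - (n.+2%:R * resolvent_moment (nu_ n) 1 F - L)
     - n.+2%:R * (resolvent_moment (nu_ n) 1 (om n) - resolvent_moment (nu_ n) 1 F)
     + (e n)%:C * (w - f n) * ((w - f n) / f n).
    have -> : f n - F = (w - F) - (w - f n) by ring.
    rewrite limE [X in _ - X](_ : _ = (n.+2%:R * moment (nu_ n) 1)%:C +
       n.+2%:R * resolvent_moment (nu_ n) 1 (om n) - (e n)%:C * (w - f n) * ((w - f n) / f n)); last first.
      by rewrite -eqn /e; ring.
    ring.
  have lip : normc (n.+2%:R * (resolvent_moment (nu_ n) 1 (om n) - resolvent_moment (nu_ n) 1 F)) <=
      normc (om n - F) / 2.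
    rewrite normcM -(rmorph_nat (real_complex R)) normc_real ger0_norm //.
    have h := resolvent_moment_lipschitz (omI n) ImF0 (hnu2 n).
    apply: le_trans (ler_wpM2l (ler0n _ _) h) _.
    rewrite mulrCA -mulrA ler_wpM2l ?normc_ge0 //.
    have p0 : 0 < complex.Im (om n) * complex.Im F by rewrite mulr_gt0.
    rewrite mulrC ler_pdivrMr //; apply: le_trans (hC n) _.
    have : (t - 2 * B) * (t - 2 * B) <= complex.Im (om n) * complex.Im F by rewrite ler_pM //; lra.
    have : 2 * C <= (t - 2 * B) * (t - 2 * B) by rewrite -[leLHS]mul1r ler_pM //; lra.
    lra.
  have err : normc ((e n)%:C * (w - f n) * ((w - f n) / f n)) <= e n * (2 * B).
    rewrite 3!normcM normc_real ger0_norm ?(ltW e0) // -mulrA ler_wpM2l ?(ltW e0) //.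
    rewrite -[leRHS]mulr1 ler_pM ?mulr_ge0 ?normc_ge0 //.
    by rewrite normcV ler_pdivrMr ?normc_gt0 // mul1r; move: fB nf; lra.
  have := le_normcD (- ((n.+2%:R * moment (nu_ n) 1)%:C - (\sum_(i < k) c i * b i ^+ 1)%:C)
     - (n.+2%:R * resolvent_moment (nu_ n) 1 F - L)
     - n.+2%:R * (resolvent_moment (nu_ n) 1 (om n) - resolvent_moment (nu_ n) 1 F))
     ((e n)%:C * (w - f n) * ((w - f n) / f n)).
  rewrite -D.
  have := le_normcB (- ((n.+2%:R * moment (nu_ n) 1)%:C - (\sum_(i < k) c i * b i ^+ 1)%:C)
     - (n.+2%:R * resolvent_moment (nu_ n) 1 F - L))
     (n.+2%:R * (resolvent_moment (nu_ n) 1 (om n) - resolvent_moment (nu_ n) 1 F)).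
  have := le_normcB (- ((n.+2%:R * moment (nu_ n) 1)%:C - (\sum_(i < k) c i * b i ^+ 1)%:C))
     (n.+2%:R * resolvent_moment (nu_ n) 1 F - L).
  rewrite [normc (- _)]normcN /E => i1 i2 i3; lra.
have lf : ccvg f F.
  apply: (@cvg0_le _ _ (fun n => 2 * E n + 2 * B * e n)) => [n|].
    by rewrite normc_ge0 dE.
  rewrite -[X in _ --> X]addr0; apply: cvgD.
    by rewrite -[X in _ --> X](mulr0 2); exact: cvgMr.
  by rewrite -[X in _ --> X](mulr0 (2 * B)); exact: cvgMr.
have := ccvgV F0 lf; rewrite /F /F_transform invrK; congr ccvg; apply/funext => n.
by rewrite /f /F_transform invrK.
Qed.

End cauchy_limit.
(** * From Cauchy transforms to weak convergence *)

Section cauchy_continuity.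
Context {R : realType}.
Implicit Types (mu : probability R R) (z : R[i]).

Local Notation G := (cauchy_transform (R := R)).

(** A disc centred far up the imaginary axis contains the given point and
    stays away from the real line, where all Cauchy transforms are bounded. *)
Lemma cauchy_cvg (mu_ : nat -> probability R R) mu (s0 : R) :
  (forall t, s0 < t -> ccvg (fun n => G (mu_ n) (0 +i* t)) (G mu (0 +i* t))) ->
  forall z, 0 < complex.Im z -> ccvg (fun n => G (mu_ n) z) (G mu z).
Proof.
move=> hs [x y] /= y0.
(* The point lies in the disc as soon as [x^2 + 3/4 y^2 < Y y]. *)
pose del := y / 2; pose Y := `|s0| + (x ^+ 2 + y ^+ 2) / y + 1.
pose c : R[i] := 0 +i* Y; pose r := Y - del.
have del0 : 0 < del by rewrite divr_gt0.
have n0 : 0 <= `|s0| by [].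
have ns : s0 <= `|s0| by exact: ler_norm.
have Yy : (`|s0| + 1) * y + x ^+ 2 + y ^+ 2 = Y * y.
  by rewrite /Y; field; rewrite gt_eqF.
have x2 : 0 <= x ^+ 2 by rewrite sqr_ge0.
have q0 : y <= (x ^+ 2 + y ^+ 2) / y by rewrite ler_pdivlMr // -expr2 lerDr.
have Ys : s0 < Y by rewrite /Y; lra.
have r0 : 0 < r by rewrite /r /del /Y; lra.
have disc_Im z : normc (z - c) <= r -> del <= complex.Im z.
  move=> h; have := le_trans (normc_Im _) h; rewrite ImD ImN /r ler_norml => /andP[h3 _].
  by rewrite [complex.Im c]/= in h3; lra.
have zr : normc ((x +i* y) - c) < r.
  rewrite -(@ltr_pXn2r _ 2) ?nnegrE ?normc_ge0 ?(ltW r0) // normc_sq.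
  rewrite ReD ReN ImD ImN /= oppr0 addr0 /r /del.
  have : 0 < y ^+ 2 by rewrite exprn_gt0.
  have : 0 < (`|s0| + 1) * y by rewrite mulr_gt0 // ltr_pwDr.
  have -> : (Y - y / 2) ^+ 2 = Y ^+ 2 - Y * y + y ^+ 2 / 4 by field.
  have -> : (y - Y) ^+ 2 = y ^+ 2 - 2 * (Y * y) + Y ^+ 2 by ring.
  rewrite -Yy; move: (y ^+ 2) (x ^+ 2) (Y ^+ 2) (_ * y) => y2 x2' Y2 s; lra.
have aG mu' : poly_approx c r (G mu').
  apply: (@poly_approx_cauchy R mu' c c r r id) => //; [exact: ltW| |exact: poly_approx_id].
  by rewrite /r /=; lra.
have bG mu' z : normc (z - c) <= r -> normc (G mu' z) <= del^-1.
  move=> /disc_Im zd; have z0 : 0 < complex.Im z by apply: lt_le_trans zd.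
  by apply: le_trans (normc_cauchy_le mu' z0) _; rewrite lef_pV2 ?posrE.
have := @vitali _ (fun n z => G (mu_ n) z - G mu z) c r (del^-1 + del^-1) 1 (x +i* y) r0 ltr01.
move=> /(_ _ _ _ zr) h.
have /(_ _ _ _)/ccvgD/(_ (ccvg_cst (G mu (x +i* y)))) := h.
rewrite add0r => H; have := H _ _ _; under eq_fun do rewrite subrK; apply.
- by move=> n; apply: poly_approxB => //; exact: ltW.
- move=> n z zc; apply: le_trans (le_normcB _ _) _; rewrite lerD //; exact: bG.
- move=> s /andP[s1 _].
  have -> : c + (0 +i* s) = 0 +i* (Y + s) by rewrite -[LHS]/((0 + 0) +i* (Y + s)) addr0.
  have : ccvg (fun n => G (mu_ n) (0 +i* (Y + s))) (G mu (0 +i* (Y + s))) by apply: hs; lra.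
  by move=> /ccvgB/(_ (ccvg_cst _)) h'; rewrite -[X in ccvg _ X](subrr (G mu (0 +i* (Y + s)))); exact: h'.
Qed.

End cauchy_continuity.

Section poisson_kernel.
Context {R : realType}.
Implicit Types (mu : probability R R) (f : R -> R).

Local Notation G := (cauchy_transform (R := R)).

Definition poisson (e x u : R) : R := e / ((u - x) ^+ 2 + e ^+ 2).

Lemma poisson_ge0 e x u : 0 < e -> 0 <= poisson e x u.
Proof. by move=> e0; rewrite divr_ge0 ?ltW // ltr_wpDl ?sqr_ge0 // exprn_gt0. Qed.

Lemma poisson_le e x u : 0 < e -> poisson e x u <= e^-1.
Proof.
move=> e0; have d0 : 0 < (u - x) ^+ 2 + e ^+ 2 by rewrite ltr_wpDl ?sqr_ge0 // exprn_gt0.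
by rewrite ler_pdivrMr // mulrC ler_pdivlMr // -expr2 lerDr sqr_ge0.
Qed.

Lemma poisson_sq_le e x u : 0 < e -> (u - x) ^+ 2 * poisson e x u <= e.
Proof.
move=> e0; have d0 : 0 < (u - x) ^+ 2 + e ^+ 2 by rewrite ltr_wpDl ?sqr_ge0 // exprn_gt0.
by rewrite mulrA ler_pdivrMr // mulrC ler_wpM2l ?(ltW e0) // lerDl sqr_ge0.
Qed.

Lemma measurable_poisson e : 0 < e -> measurable_fun setT (fun p : R * R => poisson e p.1 p.2).
Proof.
move=> e0; apply: measurable_funM => //.
have -> : (fun p : R * R => ((p.2 - p.1) ^+ 2 + e ^+ 2)^-1) =
   (fun y : R => (y ^+ 2 + e ^+ 2)^-1) \o (fun p : R * R => p.2 - p.1) by [].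
apply: measurableT_comp; last by apply: measurable_funB.
apply: measurable_inv_fun; apply: measurable_funD => //.
Qed.

Lemma measurable_poissonr e x : 0 < e -> measurable_fun setT (poisson e x).
Proof.
move=> e0; apply: measurable_funM => //; apply: measurable_inv_fun.
by apply: measurable_funD => //; apply: measurable_funX; apply: measurable_funB.
Qed.

Lemma poisson_sym e x u : poisson e x u = poisson e u x.
Proof. by rewrite /poisson -sqrrN opprB. Qed.

Lemma poisson_cauchy mu (e u : R) : 0 < e ->
  \int[mu]_x poisson e x u = - complex.Im (G mu (u +i* e)).
Proof.
move=> e0; pose g x := complex.Im ((u +i* e - x%:C)^-1).
have ig : Rintegrable mu g by exact: (cintegrable_resolvent mu (e0 : 0 < complex.Im (u +i* e))).2.
have -> : complex.Im (G mu (u +i* e)) = \int[mu]_x g x by [].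
rewrite -mulN1r -RintegralZl //; apply: eq_Rintegral => x _.
by rewrite /g /poisson /= !subr0; ring.
Qed.

Lemma real_id_measurable : measurable_fun setT (id : measurableTypeR R -> R).
Proof. by move=> _ B mB; rewrite setTI; exact: mB. Qed.

(** Carries the uniform law over to the default measurable structure of the line, which has
    the same measurable sets but another display. *)
Definition real_id : measurableTypeR R -> R := id.
HB.instance Definition _ := isMeasurableFun.Build _ _ _ _ real_id real_id_measurable.

Lemma Rintegral_fubini (P Q : probability R R) (h : R * R -> R) (C : R) :
  measurable_fun setT h -> (forall p, 0 <= h p <= C) ->
  measurable_fun setT (fun x => \int[Q]_y h (x, y)) /\
  \int[P]_x \int[Q]_y h (x, y) = \int[Q]_y \int[P]_x h (x, y).
Proof.
move=> mh hC; have mh' : measurable_fun setT (EFin \o h) by exact/measurable_EFinP.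
have h0 p : (0 <= (EFin \o h) p)%E by rewrite lee_fin; have /andP[] := hC p.
have iQ x : Rintegrable Q (fun y => h (x, y)).
  apply: Rintegrable_le (Rintegrable_cst Q C).
    exact: measurableT_comp mh (measurable_pair1 x).
  by move=> y; have /andP[h1 h2] := hC (x, y); rewrite ger0_norm.
have iP y : Rintegrable P (fun x => h (x, y)).
  apply: Rintegrable_le (Rintegrable_cst P C).
    exact: measurableT_comp mh (measurable_pair2 y).
  by move=> x; have /andP[h1 h2] := hC (x, y); rewrite ger0_norm.
have eQ x : (\int[Q]_y h (x, y))%:E = (\int[Q]_y (EFin \o h) (x, y))%E.
  by rewrite fineK //; exact: integrable_fin_num (iQ x).
have eP y : (\int[P]_x h (x, y))%:E = (\int[P]_x (EFin \o h) (x, y))%E.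
  by rewrite fineK //; exact: integrable_fin_num (iP y).
split.
  apply/measurable_EFinP; rewrite (_ : _ \o _ = fubini_F Q (EFin \o h)).
    exact: measurable_fun_fubini_tonelli_F.
  by apply/funext => x; exact: eQ.
rewrite /Rintegral; congr fine.
under eq_integral do rewrite eQ; under [RHS]eq_integral do rewrite eP.
exact: fubini_tonelli.
Qed.

Context (A : R) (A1 : 1 < A).
Let A0 : - A < A. Proof. by move: A1; lra. Qed.
Let U : probability R R :=
  distribution (uniform_prob A0 : probability (measurableTypeR R) R) real_id.

Lemma uniform_atan e x : 0 < e ->
  2 * A * \int[U]_u poisson e x u = atan ((A - x) / e) + atan ((A + x) / e).
Proof.
move=> e0; have mp : measurable_fun setT (EFin \o poisson e x).
  by apply/measurable_EFinP; exact: measurable_poissonr.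
have p0 u : (0 <= (EFin \o poisson e x) u)%E by rewrite lee_fin poisson_ge0.
rewrite /Rintegral (ge0_integral_distribution _ mp p0).
rewrite integral_uniform //.
have dF (u : R) : is_derive u 1 (fun u => atan ((u - x) / e)) (poisson e x u).
  have d1 : is_derive u 1 (fun u => (u - x) * e^-1) e^-1.
    by apply: is_derive_eq; rewrite scaler0 add0r subr0 /GRing.scale /= mulr1.
  have := is_derive1_comp (f := @atan R) (g := fun u : R => (u - x) / e) (is_derive1_atan _) d1.
  move=> /is_derive_eq; apply; rewrite /poisson.
  have d0 : 0 < (u - x) ^+ 2 + e ^+ 2 by rewrite ltr_wpDl ?sqr_ge0 // exprn_gt0.
  have d0' : 1 + ((u - x) / e) ^+ 2 = ((u - x) ^+ 2 + e ^+ 2) / e ^+ 2.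
    by field; rewrite gt_eqF.
  by rewrite d0'; field; rewrite !gt_eqF.
have cP : continuous (poisson e x).
  move=> u; apply: cvgM; first exact: cvg_cst.
  apply: cvgV; first by rewrite gt_eqF // ltr_wpDl ?sqr_ge0 // exprn_gt0.
  apply: cvgD; last exact: cvg_cst.
  have c1 : (v - x) @[v --> u] --> u - x by apply: cvgB; [exact: cvg_id|exact: cvg_cst].
  exact: (cvgM c1 c1).
have cF u : {for u, continuous (fun u => atan ((u - x) / e))}.
  by apply/differentiable_continuous/derivable1_diffP.
rewrite (@continuous_FTC2 _ _ (fun u => atan ((u - x) / e))) //.
- rewrite -EFinB -EFinM /= opprK.
  rewrite (_ : - A - x = - (A + x)); last by ring.
  by rewrite mulNr atanN opprK; field; move: A1; lra.
- exact: continuous_subspaceT.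
- split=> [u _||].
  + by have [] := dF u.
  + by apply: cvg_at_right_filter; exact: cF.
  + by apply: cvg_at_left_filter; exact: cF.
- move=> u _; rewrite derive1E; exact: derive_val.
Qed.


Definition poisson_mass e x : R := (atan ((A - x) / e) + atan ((A + x) / e)) / pi.

Lemma poisson_mass_le1 e x : poisson_mass e x <= 1.
Proof.
rewrite ler_pdivrMr ?pi_gt0 // mul1r.
have := atan_ltpi2 ((A - x) / e); have := atan_ltpi2 ((A + x) / e); lra.
Qed.

(** Normalized so that the kernel has nearly total mass 1 inside the interval. *)
Definition poisson_int f e x : R := 2 * A / pi * \int[U]_u (f u * poisson e x u).

Lemma poisson_mass_ge eta : 0 < eta -> exists2 e0 : R, 0 < e0 &
  forall e x, 0 < e <= e0 -> `|x| <= A - 1 -> 1 - eta <= poisson_mass e x.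
Proof.
move=> eta0; have p0 := pi_gt0 R.
have /cvgrPdist_le/(_ (pi / 2 * eta)) := @cvgy_atan R.
have pe : 0 < pi / 2 * eta by rewrite mulr_gt0 // divr_gt0.
move=> /(_ pe)[M [_ hM]].
have n0 : 0 <= `|M| by [].
have nM : M <= `|M| by exact: ler_norm.
exists (`|M| + 1)^-1; first by rewrite invr_gt0; lra.
move=> e x /andP[e0 eM]; rewrite ler_norml => /andP[x1 x2].
have Me : M < e^-1.
  have : (`|M| + 1) <= e^-1 by rewrite -[leLHS]invrK lef_pV2 ?posrE // invr_gt0; lra.
  lra.
have := hM _ Me; rewrite ler_norml => /andP[_ h].
have a1 : atan e^-1 <= atan ((A - x) / e).
  by apply: le_atan; rewrite -[leLHS]mul1r ler_wpM2r ?invr_ge0 ?(ltW e0) //; lra.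
have a2 : atan e^-1 <= atan ((A + x) / e).
  by apply: le_atan; rewrite -[leLHS]mul1r ler_wpM2r ?invr_ge0 ?(ltW e0) //; lra.
rewrite /poisson_mass ler_pdivlMr //.
have : (1 - eta) * pi = 2 * (pi / 2 - pi / 2 * eta) by field.
lra.
Qed.

(** Uniform continuity on the interval, with a penalty elsewhere. *)
Lemma unif_modulus f (S eta : R) : continuous f -> (forall x, 0 <= f x <= S) -> 0 < eta ->
  exists2 K : R, 0 < K &
  forall x u, - A <= x <= A -> `|f u - f x| <= eta + K * (u - x) ^+ 2.
Proof.
move=> cf fS eta0.
have S0 : 0 <= S by have /andP[h1 h2] := fS 0; exact: le_trans h2.
have := (compact_near_coveringP _).1 (@segment_compact R (- A) A).
move=> /(_ R (0 : R)^'+ (fun d x => forall u, `|u - x| < d -> `|f u - f x| < eta) _).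
case=> [x _|d /= d0 hd].
  have /cvgrPdist_lt/(_ (eta / 2)) := cf x.
  have e20 : 0 < eta / 2 by rewrite divr_gt0.
  move=> /(_ e20) /nbhs_ballP[r /= r0 hr].
  near=> y d => /= u ud.
  have xy : `|x - y| < r / 2 by near: y; apply: nbhsx_ballx; rewrite divr_gt0.
  have dr : d < r / 2 by near: d; apply: nbhs_right_lt; rewrite divr_gt0.
  have h1 : `|f x - f y| < eta / 2 by apply: hr; rewrite /ball /=; lra.
  have h2 : `|f x - f u| < eta / 2.
    apply: hr; rewrite /ball /= (_ : x - u = (x - y) - (u - y)); last by ring.
    by apply: le_lt_trans (ler_normB _ _) _; lra.
  rewrite (_ : f u - f y = (f x - f y) - (f x - f u)); last by ring.
  by apply: le_lt_trans (ler_normB _ _) _; lra.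
have {}hd : forall x u, - A <= x <= A -> `|u - x| < d / 2 -> `|f u - f x| < eta.
  move=> x u xA; apply: (hd (d / 2)).
  - by rewrite /ball /= sub0r normrN gtr0_norm; lra.
  - by rewrite divr_gt0.
  - by rewrite /= in_itv.
have d2 : 0 < d / 2 by rewrite divr_gt0.
exists ((S + 1) / (d / 2) ^+ 2) => [|x u xA]; first by rewrite divr_gt0 ?exprn_gt0 //; lra.
have q0 : 0 <= (S + 1) / (d / 2) ^+ 2 * (u - x) ^+ 2.
  by rewrite mulr_ge0 ?sqr_ge0 // divr_ge0 ?sqr_ge0 //; lra.
have [ud|ud] := ltP `|u - x| (d / 2).
  by have := hd _ _ xA ud; lra.
have : S + 1 <= (S + 1) / (d / 2) ^+ 2 * (u - x) ^+ 2.
  rewrite mulrAC ler_pdivlMr ?exprn_gt0 // ler_wpM2l //; first lra.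
  by rewrite -[leRHS]real_normK ?num_real // lerXn2r ?nnegrE ?(ltW d2).
have /andP[f1 f2] := fS u; have /andP[f3 f4] := fS x.
have : `|f u - f x| <= S by rewrite ler_norml; apply/andP; split; lra.
lra.
Unshelve. all: by end_near.
Qed.

Context (f : R -> R) (S : R).
Context (cf : continuous f) (fS : forall x, 0 <= f x <= S).
Let S0 : 0 <= S. Proof. by have /andP[h1 h2] := fS 0; exact: le_trans h2. Qed.
Let mf : measurable_fun setT f. Proof. exact: continuous_measurable_fun. Qed.
Let h e (p : R * R) := f p.2 * poisson e p.1 p.2.
Let mh e : 0 < e -> measurable_fun setT (h e).
Proof.
move=> e0; apply: measurable_funM; last exact: measurable_poisson.
exact: measurableT_comp mf measurable_snd.
Qed.
Let hb e p : 0 < e -> 0 <= h e p <= S * e^-1.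
Proof.
move=> e0; have /andP[f1 f2] := fS p.2.
by rewrite mulr_ge0 ?poisson_ge0 //= ler_pM ?poisson_ge0 ?poisson_le.
Qed.
Let A2pi : 0 < 2 * A / pi.
Proof. by rewrite divr_gt0 ?pi_gt0 // mulr_gt0 //; move: A1; lra. Qed.
Let iU e x : 0 < e -> Rintegrable U (poisson e x).
Proof.
move=> e0; apply: Rintegrable_le (Rintegrable_cst U e^-1); first exact: measurable_poissonr.
by move=> u; rewrite ger0_norm ?poisson_ge0 ?poisson_le.
Qed.
Let iUf e x : 0 < e -> Rintegrable U (fun u => f u * poisson e x u).
Proof.
move=> e0; apply: Rintegrable_le (Rintegrable_cst U (S * e^-1)).
  by apply: measurable_funM => //; exact: measurable_poissonr.
by move=> u; have /andP[h1 h2] := hb (x, u) e0; rewrite ger0_norm.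
Qed.
Let massE e x : 0 < e -> 2 * A / pi * \int[U]_u poisson e x u = poisson_mass e x.
Proof. by move=> e0; rewrite mulrAC uniform_atan. Qed.

Let poisson_int_bound e x : 0 < e -> 0 <= poisson_int f e x <= S.
Proof.
move=> e0; apply/andP; split.
  rewrite mulr_ge0 ?(ltW A2pi) //; apply: Rintegral_ge0 => u _.
  by have /andP[] := hb (x, u) e0.
apply: (@le_trans _ _ (2 * A / pi * \int[U]_u (S * poisson e x u))).
  rewrite ler_wpM2l ?(ltW A2pi) //; apply: Rintegral_mono; [exact: iUf| |].
    by apply: RintegrableZ; exact: iU.
  by move=> u; have /andP[_ h2] := fS u; rewrite ler_wpM2r ?poisson_ge0.
rewrite RintegralZl //; last exact: iU.
rewrite mulrCA massE // -[leRHS]mulr1 ler_wpM2l //; exact: poisson_mass_le1.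
Qed.

Lemma poisson_int_measurable e : 0 < e -> measurable_fun setT (poisson_int f e).
Proof.
move=> e0; apply: measurable_funM => //.
by have [] := Rintegral_fubini U U (mh e0) (fun p => hb p e0).
Qed.

(** Well inside the interval the kernel concentrates at [x]; elsewhere the error, at most
    [S], is absorbed by a multiple of [x ^+ 2], which bounded second moments control. *)
Lemma poisson_int_approx eta : 0 < eta -> exists2 e : R, 0 < e &
  forall x, `|poisson_int f e x - f x| <= eta + S / (A - 1) ^+ 2 * x ^+ 2.
Proof.
move=> eta0; have eta3 : 0 < eta / 3 by rewrite divr_gt0.
have A10 : 0 < A - 1 by move: A1; lra.
have [K K0 hK] := unif_modulus cf fS eta3.
have S1 : 0 < S + 1 by rewrite ltr_wpDl.
have [|e0 e00 he] := @poisson_mass_ge (eta / 3 / (S + 1)); first by rewrite divr_gt0.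
(* Makes the quadratic penalty contribute at most [eta / 3]. *)
pose e1 := eta / 3 / (2 * A / pi * K).
have e10 : 0 < e1 by rewrite divr_gt0 // mulr_gt0.
pose e := Num.min e0 e1.
have ep : 0 < e by rewrite lt_min e00.
have ee0 : e <= e0 by rewrite ge_min lexx.
have ee1 : e <= e1 by rewrite ge_min lexx orbT.
exists e => // x.
have /andP[f1 f2] := fS x; have /andP[t1 t2] := poisson_int_bound x ep.
have q0 : 0 <= S / (A - 1) ^+ 2 * x ^+ 2.
  by rewrite mulr_ge0 ?sqr_ge0 // divr_ge0 ?sqr_ge0.
have [xA|xA] := leP `|x| (A - 1); last first.
  have : `|poisson_int f e x - f x| <= S by rewrite ler_norml; apply/andP; split; lra.
  suff : S <= S / (A - 1) ^+ 2 * x ^+ 2 by lra.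
  rewrite mulrAC ler_pdivlMr ?exprn_gt0 // ler_wpM2l //.
  by rewrite -[leRHS]real_normK ?num_real // lerXn2r ?nnegrE ?(ltW A10) // ltW.
have xAA : - A <= x <= A by move: xA; rewrite ler_norml => /andP[x1 x2]; apply/andP; split; lra.
have m1 := poisson_mass_le1 e x; have m2 := he e x _ xA.
have {}m2 : 1 - eta / 3 / (S + 1) <= poisson_mass e x by apply: m2; rewrite ep.
have iD : Rintegrable U (fun u => f u * poisson e x u - f x * poisson e x u).
  by apply: RintegrableB; [exact: iUf|apply: RintegrableZ; exact: iU].
have E : poisson_int f e x - f x = 2 * A / pi *
    \int[U]_u (f u * poisson e x u - f x * poisson e x u) + f x * (poisson_mass e x - 1).
  rewrite RintegralB //; [|exact: iUf|by apply: RintegrableZ; exact: iU].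
  rewrite RintegralZl //; last exact: iU.
  by rewrite -massE // /poisson_int; ring.
have ib : Rintegrable U (fun u => eta / 3 * poisson e x u + K * e).
  by apply: RintegrableD; [apply: RintegrableZ; exact: iU|exact: Rintegrable_cst].
have h1 : `|\int[U]_u (f u * poisson e x u - f x * poisson e x u)| <=
    \int[U]_u (eta / 3 * poisson e x u + K * e).
  apply: Rintegral_le_bound => //; first exact: Rintegrable_measurable iD.
  move=> u; have p0 := poisson_ge0 x u ep.
  rewrite -mulrBl normrM [`|poisson e x u|]ger0_norm //.
  apply: le_trans (ler_wpM2r p0 (hK x u xAA)) _.
  by rewrite mulrDl lerD2l -mulrA ler_wpM2l ?(ltW K0) ?poisson_sq_le.
have h2 : 2 * A / pi * \int[U]_u (eta / 3 * poisson e x u + K * e) <= eta / 3 + eta / 3.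
  rewrite RintegralD //; [|by apply: RintegrableZ; exact: iU|exact: Rintegrable_cst].
  rewrite Rintegral_prob_cst RintegralZl //; last exact: iU.
  rewrite mulrDr mulrCA massE // lerD //.
    by rewrite -[leRHS]mulr1 ler_wpM2l // ltW.
  by rewrite mulrA mulrC -ler_pdivlMr // mulr_gt0.
have h3 : `|f x * (poisson_mass e x - 1)| <= eta / 3.
  rewrite normrM ger0_norm // ler0_norm ?subr_le0 // opprB.
  apply: (@le_trans _ _ ((S + 1) * (eta / 3 / (S + 1)))).
    by rewrite ler_pM //; lra.
  by rewrite mulrC divfK // gt_eqF //; lra.
rewrite E; apply: le_trans (ler_normD _ _) _.
have : `|2 * A / pi * \int[U]_u (f u * poisson e x u - f x * poisson e x u)| <=
   eta / 3 + eta / 3.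
  rewrite normrM gtr0_norm //; apply: le_trans h2; rewrite ler_wpM2l //; exact: ltW.
lra.
Qed.

(** By Fubini's theorem the integral depends on the law only through the imaginary parts
    of its Cauchy transform at height [e]. *)
Lemma poisson_int_cvg (mu_ : nat -> probability R R) mu e : 0 < e ->
  (forall z, 0 < complex.Im z -> ccvg (fun n => G (mu_ n) z) (G mu z)) ->
  \int[mu_ n]_x poisson_int f e x @[n --> \oo] --> \int[mu]_x poisson_int f e x.
Proof.
move=> e0 hG.
have E mu' : \int[mu']_x poisson_int f e x =
    2 * A / pi * \int[U]_u (f u * \int[mu']_x poisson e x u).
  have iT : Rintegrable mu' (fun x => \int[U]_u (f u * poisson e x u)).
    apply: Rintegrable_le (Rintegrable_cst mu' (S * e^-1)).
      by have [] := Rintegral_fubini mu' U (mh e0) (fun p => hb p e0).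
    move=> x; rewrite ger0_norm; last first.
      by apply: Rintegral_ge0 => u _; have /andP[] := hb (x, u) e0.
    rewrite -[leRHS](Rintegral_prob_cst U); apply: Rintegral_mono; [exact: iUf|exact: Rintegrable_cst|].
    by move=> u; have /andP[] := hb (x, u) e0.
  rewrite /poisson_int RintegralZl //; congr (_ * _).
  have [_ ->] := Rintegral_fubini mu' U (mh e0) (fun p => hb p e0).
  apply: eq_Rintegral => u _; rewrite /h /= RintegralZl //.
  apply: Rintegrable_le (Rintegrable_cst mu' e^-1).
    by under eq_fun do rewrite poisson_sym; exact: measurable_poissonr.
  by move=> x; rewrite ger0_norm ?poisson_ge0 ?poisson_le.
rewrite E; under eq_fun do rewrite E; apply: cvgMr.
have mI mu' : measurable_fun setT (fun u => f u * \int[mu']_x poisson e x u).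
  apply: measurable_funM => //.
  have mp' : measurable_fun setT (fun p : R * R => poisson e p.2 p.1).
    under eq_fun do rewrite poisson_sym; exact: measurable_poisson.
  have hp (p : R * R) : 0 <= poisson e p.2 p.1 <= e^-1 by rewrite poisson_ge0 //= poisson_le.
  exact: (Rintegral_fubini mu' mu' mp' hp).1.
apply: (@Rintegral_cvg _ U _ _ (cst (S * e^-1))) => //; first exact: Rintegrable_cst.
  move=> n u; have /andP[f1 f2] := fS u.
  have i0 : 0 <= \int[mu_ n]_x poisson e x u by apply: Rintegral_ge0 => x _; exact: poisson_ge0.
  rewrite ger0_norm ?mulr_ge0 //= ler_pM // -[leRHS](Rintegral_prob_cst (mu_ n)).
  apply: Rintegral_mono; [|exact: Rintegrable_cst|by move=> x; exact: poisson_le].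
  apply: Rintegrable_le (Rintegrable_cst _ e^-1).
    by under eq_fun do rewrite poisson_sym; exact: measurable_poissonr.
  by move=> x; rewrite ger0_norm ?poisson_ge0 ?poisson_le.
move=> u; apply: cvgMr; rewrite poisson_cauchy //; under eq_fun do rewrite poisson_cauchy //.
by apply: cvgN; have /ccvgP[] := hG (u +i* e) e0.
Qed.

End poisson_kernel.

(** Bounded second moments prevent mass from escaping to infinity. *)
Lemma weak_cvg_cauchy {R : realType} (mu_ : nat -> probability R R) (mu : probability R R) (C : R) :
  (forall z, 0 < complex.Im z ->
     ccvg (fun n => cauchy_transform (mu_ n) z) (cauchy_transform mu z)) ->
  (forall n, has_moment (mu_ n) 2 /\ moment (mu_ n) 2 <= C) ->
  has_moment mu 2 /\ moment mu 2 <= C ->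
  weak_cvg mu_ mu.
Proof.
move=> hG hmu_ hmu f cf [M [_ hM]].
pose S0 := `|M| + 1.
have fb x : `|f x| <= S0 by apply: (hM S0) => //; rewrite /S0; have := ler_norm M; lra.
have S00 : 0 < S0 by rewrite /S0; have : 0 <= `|M| by []; lra.
pose g x := f x + S0; pose S := 2 * S0.
have cg : continuous g by move=> x; apply: cvgD; [exact: cf|exact: cvg_cst].
have gS x : 0 <= g x <= S.
  by have := fb x; rewrite ler_norml /g /S => /andP[h1 h2]; apply/andP; split; lra.
have mg : measurable_fun setT g by exact: continuous_measurable_fun.
have ig mu' : Rintegrable mu' g.
  by apply: Rintegrable_le (Rintegrable_cst mu' S) => // x; have /andP[? ?] := gS x; rewrite ger0_norm.
have gf (mu' : probability R R) : \int[mu']_x f x = \int[mu']_x g x - S0.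
  rewrite -[X in _ - X](Rintegral_prob_cst mu' S0) -RintegralB //; [|exact: ig|exact: Rintegrable_cst].
  by apply: eq_Rintegral => x _; rewrite /g addrK.
rewrite gf; under eq_fun do rewrite gf; apply: cvgB; last exact: cvg_cst.
apply/cvgrPdist_le => e e0.
have C0 : 0 <= C by apply: le_trans hmu.2; apply: Rintegral_ge0 => x _; exact: sqr_ge0.
have S1 : 0 < S by rewrite /S mulr_gt0.
(* Large enough for the quadratic error to integrate to at most [e / 8]. *)
pose A := 2 + 8 * S * C / e.
have A2 : 2 <= A by rewrite /A lerDl divr_ge0 ?(ltW e0) // !mulr_ge0 // ltW.
have A1 : 1 < A by lra.
have e8 : 0 < e / 8 by rewrite divr_gt0.
have [eps eps0 happ] := poisson_int_approx A1 cg gS e8.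
set T := poisson_int A1 g eps in happ.
have mT : measurable_fun setT T by exact: poisson_int_measurable.
have tail : S / (A - 1) ^+ 2 * C <= e / 8.
  have A10 : 0 < A - 1 by lra.
  rewrite mulrAC ler_pdivrMr ?exprn_gt0 //.
  apply: (@le_trans _ _ (e / 8 * (A - 1))); last first.
    rewrite ler_wpM2l ?(ltW e8) // expr2 -[leLHS]mulr1 ler_wpM2l //; lra.
  have -> : e / 8 * (A - 1) = e / 8 + S * C by rewrite /A; field; rewrite gt_eqF.
  lra.
have close mu' : has_moment mu' 2 /\ moment mu' 2 <= C ->
   Rintegrable mu' T /\ `|\int[mu']_x T x - \int[mu']_x g x| <= e / 4.
  move=> [h2 m2].
  have ib : Rintegrable mu' (fun x => e / 8 + S / (A - 1) ^+ 2 * x ^+ 2).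
    by apply: RintegrableD; [exact: Rintegrable_cst|exact: RintegrableZ].
  have iTg : Rintegrable mu' (fun x => T x - g x).
    by apply: Rintegrable_le ib => //; exact: measurable_funB.
  have iT : Rintegrable mu' T.
    have := RintegrableD iTg (ig mu'); congr Rintegrable; apply/funext => x.
    by rewrite subrK.
  split=> //; rewrite -RintegralB //; last exact: ig.
  apply: le_trans (Rintegral_le_bound _ ib happ) _; first exact: measurable_funB.
  rewrite RintegralD //; [|exact: Rintegrable_cst|exact: RintegrableZ].
  rewrite Rintegral_prob_cst RintegralZl //.
  have h3 : S / (A - 1) ^+ 2 * moment mu' 2 <= S / (A - 1) ^+ 2 * C.
    by rewrite ler_wpM2l // divr_ge0 ?sqr_ge0 // ltW.
  by move: h3; rewrite /moment => h3; lra.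
have /cvgrPdist_le/(_ (e / 4)) := poisson_int_cvg (A1 := A1) cg gS eps0 hG.
have e4 : 0 < e / 4 by rewrite divr_gt0.
move=> /(_ e4); apply: filterS => n; rewrite -/T => hn.
have [_ c1] := close _ hmu; have [_ c2] := close _ (hmu_ n).
rewrite (_ : _ - _ = - (\int[mu]_x T x - \int[mu]_x g x) + (\int[mu]_x T x - \int[mu_ n]_x T x)
  + (\int[mu_ n]_x T x - \int[mu_ n]_x g x)); last by ring.
apply: le_trans (ler_normD _ _) _; have := ler_normD (- (\int[mu]_x T x - \int[mu]_x g x)) (\int[mu]_x T x - \int[mu_ n]_x T x).
rewrite normrN; lra.
Qed.

(** * Transfer to laws of random variables *)

Section transfer.
Context {R : realType}.

Lemma atomic_moment k (a b : 'I_k -> R) (nu : probability R R) j : (forall i, 0 <= a i) ->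
  (forall B : set R, measurable B -> nu B = (\sum_(i < k) (a i)%:E * \d_(b i) B)%E) ->
  moment nu j = \sum_(i < k) a i * b i ^+ j.
Proof.
case: k a b => [|k] a b a0 hnu.
  have := hnu setT measurableT; rewrite big_ord0 probability_setT => /eqP.
  by rewrite onee_eq0.
(* Finite sums of measures are indexed by [nat], whence the use of [inord]. *)
pose m_ (n : nat) : {measure set R -> \bar R} := mscale (NngNum (a0 (inord n))) \d_(b (inord n)).
have E (g : R -> \bar R) : measurable_fun setT g -> (forall x, 0 <= g x)%E ->
    (\int[nu]_x g x = \sum_(i < k.+1) (a i)%:E * g (b i))%E.
  move=> mg g0; rewrite (@eq_measure_integral _ _ _ _ (msum m_ k.+1)); last first.
    move=> B mB _; rewrite /msum; etransitivity; first exact: hnu.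
    by apply: eq_bigr => i _; rewrite /m_ /= /mscale /= inord_val.
  rewrite ge0_integral_measure_sum //; apply: eq_bigr => i _.
  by rewrite /m_ inord_val ge0_integral_mscale // integral_dirac // diracT mul1e.
pose f (x : R) := (x ^+ j)%:E.
have mf : measurable_fun setT f by apply/measurable_EFinP; exact: exprn_measurable.
have fp x : (f^\+ x = (Num.max (x ^+ j) 0)%:E)%E by rewrite funeposE /f EFin_max.
have fn x : (f^\- x = (Num.max (- x ^+ j) 0)%:E)%E by rewrite funenegE /f EFin_max.
rewrite /moment /Rintegral integralE !E.
- rewrite (eq_bigr (fun i => (a i * Num.max (b i ^+ j) 0)%:E)) => [|i _]; last by rewrite fp.
  rewrite [X in (_ - X)%E](eq_bigr (fun i => (a i * Num.max (- b i ^+ j) 0)%:E)) => [|i _]; last by rewrite fn.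
  rewrite !sumEFin -EFinB /= -sumrB; apply: eq_bigr => i _; rewrite -mulrBr; congr (_ * _).
  move: (b i ^+ j) => y; have [y0|/ltW y0] := leP 0 y.
    by rewrite (max_idPr _) ?oppr_le0 // subr0.
  by rewrite (max_idPl _) ?oppr_ge0 // sub0r opprK.
- exact: measurable_funeneg.
- by move=> x; rewrite funeneg_ge0.
- exact: measurable_funepos.
- by move=> x; rewrite funepos_ge0.
Qed.

End transfer.

Theorem theorem1p6 (R : realType)
    (d : nat -> measure_display) (T : forall n, measurableType (d n))
    (P : forall n, probability (T n) R) (X : forall n, {RV (P n) >-> R})
    (HID : forall n, freely_infinitely_divisible (distribution (P n) (X n) : probability R R))
    (lambda : R) (Hlambda : 0 < lambda)
    (k : nat) (Hk : (1 <= k)%N) (a b : 'I_k -> R) (Ha : forall i, 0 <= a i)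
    (nu : probability R R)
    (Hnu : forall A : set R, measurable A ->
       nu A = (\sum_(i < k) (a i)%:E * \d_(b i) A)%E)
    (mu : probability R R) (Hmu : is_free_compound_poisson lambda nu mu)
    (Hfin : forall i n : nat, (1 <= i <= 2 * k + 2)%N ->
       (P n).-integrable setT (fun w => (X n w ^+ i)%:E))
    (Hcvg : forall i : nat, (1 <= i <= 2 * k + 2)%N ->
       ('E_(P n)[(fun w => (X n w ^+ i)%R)])%E @[n --> \oo] --> (moment mu i)%:E) :
  weak_cvg (fun n => distribution (P n) (X n) : probability R R) mu.
Proof.
pose D n : probability R R := distribution (P n) (X n).
have mX i : measurable_fun setT (EFin \o (fun x : R => x ^+ i)).
  by apply/measurable_EFinP; exact: exprn_measurable.
have hD n i : (1 <= i <= 2 * k + 2)%N -> has_moment (D n) i.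
  by move=> hi; apply: (integrable_pushforward _ (mX i)) => //; exact: Hfin.
have mD n i : (1 <= i <= 2 * k + 2)%N -> moment (D n) i = fine ('E_(P n)[(fun w => (X n w ^+ i)%R)])%E.
  move=> hi; rewrite unlock /moment /Rintegral; congr fine.
  by apply: (integral_distribution (mX i)); exact: Hfin.
(* The subordination arguments need at least two convolution factors, whence [n.+2]. *)
have [nu_ hroot] : {nu_ : nat -> probability R R | forall n, is_free_power (nu_ n) n.+2 (D n)}.
  by exists (fun n => sval (cid (HID n n.+2 isT))) => n; exact: svalP (cid (HID n n.+2 isT)).
pose kap j := if j is j'.+1 then lambda * moment nu j else 1.
have kapE j : kap j.+1 = \sum_(i < k) lambda * a i * b i ^+ j.+1.
  by rewrite /kap (atomic_moment _ Ha Hnu) mulr_sumr; apply: eq_bigr => i _; rewrite mulrA.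
have hmu m : has_moment mu m /\ moment mu m = cumulant_moment kap 0 m.
  case: m => [|m]; first by split; [exact: has_moment0|rewrite moment0 cumulant_moment0].
  have [h1 ->] := Hmu m.+1 isT; split=> //; rewrite -cumulant_moment_NC //.
  apply: eq_bigr => p; rewrite inE => /andP[/and3P[_ _ p0] _]; apply: eq_bigr => V Vp.
  have : (0 < #|V|)%N by rewrite card_gt0; apply: contraNneq p0 => <-.
  by case: #|V|.
have k2 : (2 * k.+1 = 2 * k + 2)%N by rewrite mulnS addnC.
have hcvg i : (i <= 2 * k.+1)%N -> moment (D n) i @[n --> \oo] --> cumulant_moment kap 0 i.
  rewrite -(hmu i).2; case: i => [_|i ik].
    by under eq_fun do rewrite moment0; rewrite moment0; exact: cvg_cst.
  have hi : (1 <= i.+1 <= 2 * k + 2)%N by rewrite -k2.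
  by under eq_fun do rewrite (mD _ _ hi); have /fine_cvgP[_] := Hcvg _ hi.
have two_le : (1 <= 2 <= 2 * k + 2)%N by rewrite leq_addl.
have hfin n : has_moment (D n) (2 * k.+1) by apply: hD; rewrite k2 leqnn andbT addn2.
have [C _ hC] := cvg_ub (hcvg 2 ltac:(by rewrite k2 leq_addl)).
have [s0 hs] := cauchy_cvg_axis (erefl : kap 0 = 1) kapE hmu hroot hfin hcvg.
have n0 : 0 <= `|moment mu 2| by [].
apply: (@weak_cvg_cauchy _ D mu (C + `|C| + `|moment mu 2|)) (cauchy_cvg hs) _ _.
  by move=> n; split; [exact: hD|have := hC n; have : 0 <= `|C| by []; lra].
by split; [exact: (hmu 2).1|have := ler_norm (moment mu 2); have := ler_norm (- C); rewrite normrN; lra].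
Qed.
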